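(* Let $K$ be a field of positive characteristic $\mathrm{char}(K)\ge m+2$, $V=K^m$ with a non-degenerate bilinear form that is symmetric ($\epsilon=1$, $G=\mathrm{O}(V)$) or skew symmetric ($\epsilon=-1$, $G=\mathrm{Sp}(V)$, $m=2n$). Then the kernel of the algebra homomorphism $F_{\epsilon,r}^r:B_r(\epsilon m)\to\mathrm{End}_G(V^{\otimes r})$ is generated, as a two-sided ideal of the Brauer algebra $B_r(\epsilon m)$, - by $\Phi$ in the case of the symplectic group ($\epsilon=-1$), for $r\ge n+1$; - by $E=E_\ell$ with $\ell=\left[\frac{m+1}{2}\right]$ in the case of the orthogonal group ($\epsilon=1$), for $r\ge m+1$.
   Context: Brauer diagrams. For $k,\ell\in\mathbb{N}$, a $(k,\ell)$ Brauer diagram is a partition into pairs (arcs) of $k$ lower nodes and $\ell$ upper nodes (each row numbered left to right). $B_k^\ell(\delta)$ is the $K$-vector space with basis the $(k,\ell)$ diagrams. Composition is bilinear with $D_1\circ D_2=\delta^fD$, obtained by placing $D_1$ above $D_2$, identifying middle nodes and deleting the $f$ closed loops; $D\otimes D'$ is juxtaposition with $D'$ on the right. $B_r(\delta)=B_r^r(\delta)$ is the Brauer algebra. $I$ is the $(1,1)$ diagram, $X$ the $(2,2)$ crossing, $A$ the $(2,0)$ diagram, $U$ the $(0,2)$ diagram. $s_i=I^{\otimes(i-1)}\otimes X\otimes I^{\otimes(r-i-1)}$, $e_i=I^{\otimes(i-1)}\otimes(U\circ A)\otimes I^{\otimes(r-i-1)}$; $K\mathrm{Sym}_r\subset B_r(\delta)$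 is generated by the $s_i$. For $s<r$, $B_s(\delta)\subset B_r(\delta)$ via $b\mapsto b\otimes I^{\otimes(r-s)}$. $I_q=I^{\otimes q}$; $A_q$ (resp. $U_q$) is the $(2q,0)$ (resp. $(0,2q)$) diagram joining node $i$ with $2q+1-i$; $X_{s,t}$ is the $(s+t,s+t)$ diagram joining lower $i$ to upper $t+i$ ($1\le i\le s$) and lower $s+j$ to upper $j$ ($1\le j\le t$). $\Phi\in B_{n+1}(-2n)$ is $$\Phi=\sum_{k=0}^{[(n+1)/2]}\frac{1}{(2^kk!)^2(n+1-2k)!}\,\Sigma(n+1)E(k)\Sigma(n+1),\quad \Sigma(n+1)=\sum_{\sigma\in\mathrm{Sym}_{n+1}}\sigma,\quad E(k)=\prod_{j=1}^ke_{n+2-2j},$$ (it is an integral combination of Brauer diagrams, so defined over any field). For $0\le i\le m+1$ and $p=m+1-i$, $E_i\in B_{m+1}(m)$ is $$E_i=(I_i\otimes A_p\otimes I_p)\circ\Big(\sum_{\sigma\in\mathrm{Sym}_{m+1}}(-1)^{|\sigma|}\sigma\otimes X_{p,p}\Big)\circ(I_i\otimes U_p\otimes I_p).$$ $G$ is the isometry group of the form $(-,-)$. With a basis $b_i$ of $V$ and dual basis $\bar b_i$, $(\bar b_i,b_j)=\delta_{ij}$, $F_{\epsilon,r}^r$ sends $s_i$ to $\epsilon P$ ($P$ the flip $v\otimes w\mapsto w\otimes v$) acting on tensor factors $i,i+1$, and $e_i$ to $v\otimes w\mapsto(v,w)\sum_jb_j\otimes\bar b_j$ on factors $i,i+1$.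 $[x]$ denotes integer part. *)

(* Defs.v *)
From HB Require Import structures.
From mathcomp Require Import all_boot all_order all_fingroup all_algebra.
From mathcomp Require Import zify.

Set Implicit Arguments.
Unset Strict Implicit.
Unset Printing Implicit Defensive.

Import GRing.Theory.

Section Pairing.
Variable N : finType.
Implicit Types (P : {set {set N}}) (x y : N).

Definition pairing P : bool :=
  partition P [set: N] && [forall (B | B \in P), #|B| == 2].

Lemma pairing_crit P : set0 \notin P ->
  (forall x, exists2 y, y != x &
     forall B, (B \in P) && (x \in B) = (B == [set x; y])) -> pairing P.
Proof.
move=> P0 hP; apply/andP; split; last first.
  apply/forall_inP => B BP.
  have /set0Pn [x xB] : B != set0 by apply: contraNneq P0 => <-.
  have [y neq_yx /(_ B)] := hP x; rewrite BP xB => /esym/eqP ->.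
  by rewrite cards2 [x == y]eq_sym neq_yx.
apply/and3P; split=> //.
  apply/eqP/setP => x; rewrite inE; apply/bigcupP.
  have [y _ /(_ [set x; y])] := hP x; rewrite eqxx => /andP[h1 h2].
  by exists [set x; y].
apply/trivIsetP => A B AP BP; apply: contraNT => /pred0Pn [x /andP[/= xA xB]].
have [y _ hB] := hP x.
by move: (hB A) (hB B); rewrite AP BP xA xB => /esym/eqP -> /esym/eqP ->.
Qed.

Lemma pairing_inv (f : N -> N) :
  involutive f -> (forall x, f x != x) -> pairing [set [set x; f x] | x : N].
Proof.
move=> fK fN; apply: pairing_crit.
  apply/imsetP => -[x _ /setP /(_ x)]; by rewrite !inE eqxx.
move=> x; exists (f x) => // B; apply/andP/eqP => [[/imsetP [z _ ->]]|->].
  by rewrite !inE => /orP[/eqP -> //|/eqP ->]; rewrite fK setUC.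
by rewrite !inE eqxx; split=> //; apply/imsetP; exists x.
Qed.

Definition mate P x : N := odflt x [pick y | [set x; y] \in P].

Lemma pairing_ex P x : pairing P ->
  exists2 y, y != x & forall B, (B \in P) && (x \in B) = (B == [set x; y]).
Proof.
case/andP=> /and3P[/eqP cP tP _] /forall_inP hP.
have : x \in cover P by rewrite cP inE.
case/bigcupP=> A AP xA; have /cards2P [u [v [neq_uv defA]]] := hP _ AP.
have [y neq_yx defA'] : exists2 y, y != x & A = [set x; y].
  move: xA; rewrite defA !inE => /orP[/eqP->|/eqP->].
    by exists v; rewrite // eq_sym.
  by exists u; rewrite // setUC.
exists y => // B; apply/andP/eqP => [[BP xB]|->]; last first.
  by rewrite -defA' AP xA.
rewrite -defA'; apply/eqP; move/trivIsetP: tP => /(_ B A BP AP).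
case: eqP => // _ /(_ isT) /pred0P /(_ x) /=; by rewrite xA xB.
Qed.

Lemma mateE P x y : pairing P -> ([set x; y] \in P) = (y == mate P x).
Proof.
move=> hP; have [z neq_zx hz] := pairing_ex x hP.
have E w : ([set x; w] \in P) = (w == z).
  have := hz [set x; w]; rewrite set21 andbT => ->.
  apply/eqP/eqP => [|-> //] /setP E.
  have := E w; have := E z; rewrite !inE !eqxx !orbT (negPf neq_zx) /=.
  by move/eqP => ->.
rewrite E /mate; case: pickP => [w|/(_ z)] /=; rewrite E ?eqxx //.
by move/eqP ->.
Qed.

Lemma mateN P x : pairing P -> mate P x != x.
Proof.
move=> hP; have [z neq_zx /(_ [set x; z])] := pairing_ex x hP.
by rewrite eqxx => /andP[]; rewrite mateE // => /eqP <-.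
Qed.

Lemma mateK P : pairing P -> involutive (mate P).
Proof.
by move=> hP x; apply/esym/eqP; rewrite -mateE // setUC mateE.
Qed.

Lemma pairing_mate P B x : pairing P -> B \in P -> x \in B ->
  B = [set x; mate P x].
Proof.
move=> hP BP xB; have [z neq_zx hz] := pairing_ex x hP.
have : [set x; mate P x] \in P by rewrite mateE.
move=> h; have := hz [set x; mate P x]; rewrite h set21 => /esym/eqP ->.
by apply/eqP; rewrite -hz BP xB.
Qed.

End Pairing.

(* In the union of two partial matchings, the component of an end point is a
   path, hence contains exactly two end points.  *)
Lemma two_ends (T : finType) (a b : T -> T) (e : rel T) (t : T) :
  involutive a -> involutive b ->
  (forall x, ~~ ((a x == x) && (b x == x))) ->
  (forall x y, e x y -> y = a x \/ y = b x) ->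
  (forall x, connect e x (a x)) -> (forall x, connect e x (b x)) ->
  (a t == t) || (b t == t) ->
  #|[set u | connect e t u && ((a u == u) || (b u == u))]| = 2.
Proof.
wlog bt : a b / b t == t => [hw|].
  move=> aK bK abN eab ea eb /orP[|] h; last by apply: (hw a b); rewrite ?h ?orbT.
  rewrite -(hw b a) ?h ?orbT //.
  - by apply: eq_card => u; rewrite !inE orbC.
  - by move=> x; rewrite andbC abN.
  - by move=> x y /eab[]; [right|left].
move/eqP: bt => bt aK bK abN eab ea eb _.
pose s x := a (b x).
have s_inj : injective s by move=> x y /(inv_inj aK) /(inv_inj bK).
set n := fingraph.order s t.
have itn i : i <= n -> b (iter i s t) = iter (n - i) s t.
  elim: i => [_|i IH hi]; first by rewrite subn0 /= iter_order.
  apply: s_inj; rewrite {1}/s bK /= {1}/s aK IH; last exact: ltnW.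
  by rewrite -[RHS]/(iter (n - i.+1).+1 s t) subnSK.
have ita i : i < n -> a (iter i.+1 s t) = iter (n - i) s t.
  by move=> hi; rewrite /= {1}/s aK itn // ltnW.
have it_inj i j : i < n -> j < n -> iter i s t = iter j s t -> i = j.
  by move=> hi hj E; rewrite -(findex_iter hi) -(findex_iter hj) E.
have n_gt0 : 0 < n by exact: fingraph.order_gt0.
have itN : iter n s t = t by rewrite iter_order.
have conE u : connect e t u = fconnect s t u.
  apply/idP/idP.
    case/connectP=> p; elim/last_ind: p u => [|p v IH] u /=.
      by move=> _ ->; rewrite connect0.
    rewrite rcons_path last_rcons => /andP[pp ev] ->.
    have := IH _ pp erefl; move: (last t p) ev => w ev tw.
    have hw : findex s t w < n by exact: findex_max.
    have Ew := iter_findex tw; case: (eab _ _ ev) => ->; rewrite -{1}Ew.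
      case: (findex s t w) hw => [|i] hi.
        have -> : a (iter 0 s t) = s t by rewrite /s bt.
        exact: fconnect1.
      by rewrite ita ?fconnect_iter // ltnW.
    by rewrite itn ?fconnect_iter // ltnW.
  move=> tu; rewrite -(iter_findex tu); elim: (findex s t u) => [|i IH] /=.
    exact: connect0.
  exact: connect_trans (connect_trans IH (eb _)) (ea _).
have main h (z := iter h s t) : 0 < h -> h < n ->
    (a z == z) || (b z == z) ->
    (forall i, i < n -> (a (iter i s t) == iter i s t)
       || (b (iter i s t) == iter i s t) -> i = 0 \/ i = h) ->
    #|[set u | connect e t u && ((a u == u) || (b u == u))]| = 2.
  move=> h0 hn hz hu; transitivity #|[set t; z]|; last first.
    rewrite cards2; case: eqP => // E.
    by have := it_inj 0 h n_gt0 hn E; move: h0; case: h {z hz hu hn E}.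
  congr #|pred_of_set _|; apply/setP=> u; rewrite !inE conE.
  apply/andP/orP => [[tu]|[/eqP->|/eqP->]].
  - rewrite -(iter_findex tu) => /(hu _ (findex_max tu))[] ->; [left|right] => //.
  - by rewrite bt eqxx orbT connect0.
  - by rewrite fconnect_iter.
have bfix i : i < n -> b (iter i s t) == iter i s t -> i = 0 \/ i + i = n.
  move=> hi; rewrite itn; last exact: ltnW.
  case: i hi => [|i] hi; first by left.
  by move/eqP=> /it_inj E; right; have := E _ hi; lia.
have afix i : i < n -> a (iter i s t) == iter i s t -> i + i = n.+1.
  case: i => [|i] hi.
    move=> /= at0; have := abN t; by rewrite at0 bt eqxx.
  rewrite ita; last exact: ltnW.
  case: i hi => [|i] hi.
    rewrite subn0 itN => /eqP E; have := @it_inj 0 1 n_gt0 hi E; lia.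
  by move/eqP => /it_inj E; have := E _ hi; lia.
have [nodd|neven] := boolP (odd n).
  have n1 : n != 1.
    apply/eqP=> n1; have st : s t = t by rewrite -{2}itN n1.
    have at0 : a t = t by rewrite -{2}st /s bt.
    by have := abN t; rewrite at0 bt !eqxx.
  apply: (main (n./2.+1)); try by lia.
    apply/orP; left; rewrite ita; last by lia.
    by apply/eqP; congr (iter _ s t); lia.
  by move=> i hi /orP[/(afix _ hi)|/(bfix _ hi)]; lia.
apply: (main n./2); try by lia.
  apply/orP; right; rewrite itn; last by lia.
  by apply/eqP; congr (iter _ s t); lia.
by move=> i hi /orP[/(afix _ hi)|/(bfix _ hi)]; lia.
Qed.

(* Nodes of a (k, l) diagram: [inl i] is the lower node i, [inr j] the upper
   node j, both numbered from 0. *)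
Definition node (k l : nat) : Type := ('I_k + 'I_l)%type.

Definition diagram (k l : nat) : Type :=
  {P : {set {set node k l}} | pairing P}.

Definition diagram_of_inv k l (f : node k l -> node k l)
    (fK : involutive f) (fN : forall x, f x != x) : diagram k l :=
  exist (fun P => is_true (pairing P)) _ (pairing_inv fK fN).

Section Elementary.

Definition perm_mate r (s : 'S_r) (x : node r r) : node r r :=
  match x with inl i => inr (s i) | inr j => inl ((s^-1)%g j) end.

Lemma perm_mateK r (s : 'S_r) : involutive (perm_mate s).
Proof. by case=> i /=; rewrite ?permK ?permKV. Qed.

Lemma perm_mateN r (s : 'S_r) x : perm_mate s x != x.
Proof. by case: x. Qed.

(* lower i joined to upper s i *)
Definition perm_diag r (s : 'S_r) : diagram r r :=
  diagram_of_inv (perm_mateK s) (perm_mateN s).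

Definition id_diag q : diagram q q := perm_diag 1%g.

Lemma rev_ord_neq q (i : 'I_(q + q)) : rev_ord i != i.
Proof. by apply/eqP => /(congr1 val) /=; have := ltn_ord i; lia. Qed.

Definition cap_mate q (x : node (q + q) 0) : node (q + q) 0 :=
  match x with inl i => inl (rev_ord i) | inr j => inr j end.

Lemma cap_mateK q : involutive (@cap_mate q).
Proof. by case=> [i|[]] //=; rewrite rev_ordK. Qed.

Lemma cap_mateN q (x : node (q + q) 0) : cap_mate x != x.
Proof.
case: x => [i|[]] //=; apply/eqP => -[] /eqP; exact/negP/rev_ord_neq.
Qed.

Definition cap_diag q : diagram (q + q) 0 :=
  diagram_of_inv (@cap_mateK q) (@cap_mateN q).

Definition cup_mate q (x : node 0 (q + q)) : node 0 (q + q) :=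
  match x with inl i => inl i | inr j => inr (rev_ord j) end.

Lemma cup_mateK q : involutive (@cup_mate q).
Proof. by case=> [[]|j] //=; rewrite rev_ordK. Qed.

Lemma cup_mateN q (x : node 0 (q + q)) : cup_mate x != x.
Proof.
case: x => [[]|j] //=; apply/eqP => -[] /eqP; exact/negP/rev_ord_neq.
Qed.

Definition cup_diag q : diagram 0 (q + q) :=
  diagram_of_inv (@cup_mateK q) (@cup_mateN q).

(* The first s lower nodes are joined in order to the last s upper nodes, and
   the last t lower nodes to the first t upper nodes. *)
Definition cross_mate s t (x : node (s + t) (t + s)) : node (s + t) (t + s) :=
  match x with
  | inl i => match split i with
             | inl i1 => inr (rshift t i1)
             | inr i2 => inr (lshift s i2) end
  | inr j => match split j with
             | inl j1 => inl (rshift s j1)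
             | inr j2 => inl (lshift t j2) end
  end.

Lemma cross_mateK s t : involutive (@cross_mate s t).
Proof.
case=> i /=; case: (splitP i) => j ij /=.
- have -> : split (rshift t j) = inr j by exact: (unsplitK (inr j)).
  by congr inl; apply: val_inj.
- have -> : split (lshift s j) = inl j by exact: (unsplitK (inl j)).
  by congr inl; apply: val_inj.
- have -> : split (rshift s j) = inr j by exact: (unsplitK (inr j)).
  by congr inr; apply: val_inj.
- have -> : split (lshift t j) = inl j by exact: (unsplitK (inl j)).
  by congr inr; apply: val_inj.
Qed.

Lemma cross_mateN s t (x : node (s + t) (t + s)) : cross_mate x != x.
Proof. by case: x => i /=; case: splitP. Qed.

Definition cross_diag s t : diagram (s + t) (t + s) :=
  diagram_of_inv (@cross_mateK s t) (@cross_mateN s t).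

End Elementary.

(* [D1 : diagram l q] is placed above [D2 : diagram k l]. *)
Section Glue.
Variables (k l q : nat) (D1 : diagram l q) (D2 : diagram k l).

(* lower + (middle + upper) nodes *)
Definition gnode : Type := ('I_k + ('I_l + 'I_q))%type.

Definition gnode_bot (x : node k l) : gnode :=
  match x with inl i => inl i | inr j => inr (inl j) end.
Definition gnode_top (x : node l q) : gnode := inr x.
Definition gnode_out (x : node k q) : gnode :=
  match x with inl i => inl i | inr j => inr (inr j) end.

Definition glued_arcs : {set {set gnode}} :=
  [set gnode_bot @: (B : {set node k l}) | B in val D2]
  :|: [set gnode_top @: (B : {set node l q}) | B in val D1].

Definition glued_adj : rel gnode := fun x y => [set x; y] \in glued_arcs.

Definition glued : {set {set node k q}} :=
  equivalence_partition
    [rel x y | connect glued_adj (gnode_out x) (gnode_out y)] [set: node k q].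

Definition loops : nat :=
  #|[set C in equivalence_partition (connect glued_adj) [set: gnode] |
       C \subset [set inr (inl j) | j : 'I_l]]|.

Let bot_mate (x : gnode) : gnode :=
  match x with
  | inl i => gnode_bot (mate (val D2) (inl i))
  | inr (inl j) => gnode_bot (mate (val D2) (inr j))
  | inr (inr _) => x
  end.

Let top_mate (x : gnode) : gnode :=
  match x with inl _ => x | inr y => gnode_top (mate (val D1) y) end.

Lemma gnode_bot_inj : injective gnode_bot.
Proof. by case=> i [] j //= [->]. Qed.

Lemma gnode_top_inj : injective gnode_top.
Proof. by move=> i j [->]. Qed.

Lemma gnode_out_inj : injective gnode_out.
Proof. by case=> i [] j //= [->]. Qed.

Let bot_mate_bot x : bot_mate (gnode_bot x) = gnode_bot (mate (val D2) x).
Proof. by case: x. Qed.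

Let bot_mateK : involutive bot_mate.
Proof.
by case=> [i|[j|j]] //=; rewrite bot_mate_bot mateK //; exact: valP.
Qed.

Let top_mateK : involutive top_mate.
Proof. by case=> [i|j] //=; rewrite mateK //; exact: valP. Qed.

Let bot_mateN x : bot_mate (gnode_bot x) != gnode_bot x.
Proof. by rewrite bot_mate_bot (inj_eq gnode_bot_inj) mateN //; exact: valP. Qed.

Let top_mateN x : top_mate (gnode_top x) != gnode_top x.
Proof. by rewrite (inj_eq gnode_top_inj) mateN //; exact: valP. Qed.

Lemma imset_pair (T T' : finType) (f : T -> T') x y :
  f @: [set x; y] = [set f x; f y].
Proof. by rewrite imsetU !imset_set1. Qed.

Lemma set2_inj (T : finType) (x y z w : T) : [set x; y] = [set z; w] ->
  (x = z /\ y = w) \/ (x = w /\ y = z).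
Proof.
move=> /setP E; have := E x; have := E y; have := E z; have := E w.
rewrite !inE !eqxx ?orbT /=.
move=> /orP[]/eqP hw /orP[]/eqP hz /esym/orP[]/eqP hy /esym/orP[]/eqP hx;
  by [left; split; congruence | right; split; congruence].
Qed.

Let pairP k' l' (D : diagram k' l') B : B \in val D ->
  exists x, B = [set x; mate (val D) x].
Proof.
move=> BD; have hD := valP D.
have /set0Pn [x xB] : B != set0.
  by case/andP: hD => /and3P[_ _ D0] _; apply: contraNneq D0 => <-.
by exists x; apply: pairing_mate.
Qed.

Let adjP x y : glued_adj x y -> y = bot_mate x \/ y = top_mate x.
Proof.
rewrite /glued_adj /glued_arcs inE => /orP[] /imsetP[B /pairP[z ->]]; rewrite imset_pair.
  case/set2_inj=> -[-> ->]; left; rewrite bot_mate_bot // mateK //.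
  exact: valP.
case/set2_inj=> -[-> ->]; right; rewrite //= mateK //.
exact: valP.
Qed.

Let adj_bot x : connect glued_adj x (bot_mate x).
Proof.
have adj z : glued_adj (gnode_bot z) (gnode_bot (mate (val D2) z)).
  rewrite /glued_adj /glued_arcs inE -imset_pair imset_f // mateE ?eqxx //; exact: valP.
by case: x => [i|[j|j]] /=; try exact: connect0; apply: connect1;
  [exact: (adj (inl i)) | exact: (adj (inr j))].
Qed.

Let adj_top x : connect glued_adj x (top_mate x).
Proof.
case: x => [i|j] /=; first exact: connect0.
apply: connect1; rewrite /glued_adj /glued_arcs inE -[inr j]/(gnode_top j) -imset_pair.
by rewrite (imset_f (fun B : {set node l q} => gnode_top @: B)) ?orbT // mateE
  ?eqxx //; exact: valP.
Qed.

Lemma glued_adj_sym : connect_sym glued_adj.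
Proof. by apply: sym_connect_sym => x y; rewrite /glued_adj setUC. Qed.

Let endE x : (bot_mate x == x) || (top_mate x == x) =
  (x \in [set gnode_out y | y : node k q]).
Proof.
apply/idP/imsetP => [|[[i|j] _ ->]]; rewrite /= ?eqxx ?orbT //.
case: x => [i _|[j|j _]]; [by exists (inl i)| |by exists (inr j)].
by rewrite (negPf (bot_mateN (inr j))) (negPf (top_mateN (inl j))).
Qed.

Lemma glued_pairing : pairing glued.
Proof.
have eqR : {in [set: node k q] & &, equivalence_rel
    [rel x y | connect glued_adj (gnode_out x) (gnode_out y)]}.
  move=> x y z _ _ _ /=; rewrite connect0; split=> // xy.
  exact: (same_connect glued_adj_sym xy).
rewrite /pairing; apply/andP; split; first exact: equivalence_partitionP.
apply/forall_inP => B /imsetP[x _ ->].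
rewrite -(card_imset _ gnode_out_inj).
rewrite -(@two_ends _ bot_mate top_mate glued_adj (gnode_out x)) //.
- apply/eqP/eq_card => u; rewrite [RHS]inE endE.
  apply/imsetP/andP => [[y]|[xu /imsetP[y _ E]]]; last first.
    by exists y; rewrite // !inE /= -E.
  by rewrite !inE /= => xy ->; rewrite xy imset_f.
- case=> [i|[j|j]]; rewrite negb_and.
  + by rewrite (bot_mateN (inl i)).
  + by rewrite (bot_mateN (inr j)).
  + by rewrite (top_mateN (inr j)) orbT.
- by rewrite endE imset_f.
Qed.

Definition comp_diag : diagram k q :=
  exist (fun P => is_true (pairing P)) glued glued_pairing.

End Glue.

(* [D'] is on the right of [D]. *)
Section Juxt.
Variables (k l k' l' : nat) (D : diagram k l) (D' : diagram k' l').

Definition node_left (x : node k l) : node (k + k') (l + l') :=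
  match x with inl i => inl (lshift k' i) | inr j => inr (lshift l' j) end.
Definition node_right (x : node k' l') : node (k + k') (l + l') :=
  match x with inl i => inl (rshift k i) | inr j => inr (rshift l j) end.

Definition juxt : {set {set node (k + k') (l + l')}} :=
  [set node_left @: (B : {set node k l}) | B in val D]
  :|: [set node_right @: (B : {set node k' l'}) | B in val D'].

Lemma node_left_inj : injective node_left.
Proof. by case=> i [] j //= [] E; congr (_ _); apply: val_inj. Qed.

Lemma node_right_inj : injective node_right.
Proof. by case=> i [] j //= [] E; congr (_ _); apply: val_inj; move: E => /=; lia. Qed.

Lemma node_left_right x y : node_left x <> node_right y.
Proof.
by case: x y => i [] j //= [] E; have := ltn_ord i; lia.
Qed.

Lemma juxt_pairing : pairing juxt.
Proof.
have [hD hD'] := (valP D, valP D'); apply: pairing_crit.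
  apply/negP; rewrite /juxt inE => /orP[] /imsetP[B BD] /esym/eqP.
    rewrite imset_eq0 => /eqP B0; case/andP: hD => /and3P[_ _].
    by rewrite -B0 BD.
  rewrite imset_eq0 => /eqP B0; case/andP: hD' => /and3P[_ _].
  by rewrite -B0 BD.
move=> x.
have [[y ->]|[y ->]] : (exists y, x = node_left y) \/ exists y, x = node_right y.
  by case: x => i; rewrite -(splitK i); case: (split i) => j; [left|right|left|right];
    (exists (inl j) + exists (inr j)).
- exists (node_left (mate (val D) y)).
    by rewrite (inj_eq node_left_inj) mateN.
  move=> B; apply/andP/eqP => [[]|->]; rewrite /juxt !inE.
    case/orP=> /imsetP[C CD ->] /imsetP[z zC] => [/node_left_inj yz|/node_left_right //].
    by rewrite (pairing_mate hD CD zC) yz imset_pair.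
  by rewrite eqxx -imset_pair imset_f ?mateE.
- exists (node_right (mate (val D') y)).
    by rewrite (inj_eq node_right_inj) mateN.
  move=> B; apply/andP/eqP => [[]|->]; rewrite /juxt !inE.
    case/orP=> /imsetP[C CD ->] /imsetP[z zC] => [/esym/node_left_right //|/node_right_inj yz].
    by rewrite (pairing_mate hD' CD zC) yz imset_pair.
  rewrite eqxx -imset_pair; split=> //; apply/orP; right.
  by rewrite (imset_f (fun C : {set node k' l'} => node_right @: C)) ?mateE.
Qed.

Definition juxt_diag : diagram (k + k') (l + l') :=
  exist (fun P => is_true (pairing P)) juxt juxt_pairing.

End Juxt.

Local Open Scope ring_scope.

(* The parameter delta only enters the composition. *)
Definition brauer (K : fieldType) (k l : nat) : Type :=
  {ffun diagram k l -> K^o}.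

HB.instance Definition _ (K : fieldType) k l :=
  GRing.Lmodule.on (brauer K k l).

Section Brauer.
Variable K : fieldType.
Implicit Types (k l q r : nat) (delta : K).

Definition basis_elt k l (D : diagram k l) : brauer K k l :=
  [ffun D' => (D' == D)%:R].

Definition brauer_comp delta k l q (a : brauer K l q) (b : brauer K k l) :
    brauer K k q :=
  \sum_(D1 : diagram l q) \sum_(D2 : diagram k l)
    (a D1 * b D2 * delta ^+ loops D1 D2) *: basis_elt (comp_diag D1 D2).

Definition brauer_tens k l k' l' (a : brauer K k l) (b : brauer K k' l') :
    brauer K (k + k') (l + l') :=
  \sum_(D : diagram k l) \sum_(D' : diagram k' l')
    (a D * b D') *: basis_elt (juxt_diag D D').

(* Transport along equalities k = k' and l = l'; the value is 0 if one of them
   fails, which does not happen below. *)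
Definition brauer_cast k' l' k l (x : brauer K k l) : brauer K k' l' :=
  match @eqP _ k k', @eqP _ l l' with
  | ReflectT ek, ReflectT el => ecast i (brauer K i l') ek
                                  (ecast j (brauer K k j) el x)
  | _, _ => 0
  end.

Definition brauer_id q : brauer K q q := basis_elt (id_diag q).
Definition brauer_A q : brauer K (q + q) 0 := basis_elt (cap_diag q).
Definition brauer_U q : brauer K 0 (q + q) := basis_elt (cup_diag q).
Definition brauer_X s t : brauer K (s + t) (t + s) :=
  basis_elt (cross_diag s t).
Definition brauer_perm r (s : 'S_r) : brauer K r r := basis_elt (perm_diag s).

(* I^{i-1} (x) x (x) I^{r-i-1}, for 1 <= i < r *)
Definition brauer_at r i (x : brauer K 2 2) : brauer K r r :=
  brauer_cast r r
    (brauer_tens (brauer_tens (brauer_id i.-1) x) (brauer_id (r - i.+1))).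

Definition brauer_s r i : brauer K r r := brauer_at r i (brauer_X 1 1).

Definition brauer_e delta r i : brauer K r r :=
  brauer_at r i (brauer_comp delta (brauer_U 1) (brauer_A 1)).

(* the embedding of B_s in B_r, for s <= r *)
Definition brauer_embed r s (x : brauer K s s) : brauer K r r :=
  brauer_cast r r (brauer_tens x (brauer_id (r - s))).

Definition Sigma r : brauer K r r := \sum_(s : 'S_r) brauer_perm s.

Definition Ek n k : brauer K n.+1 n.+1 :=
  let delta := - (n.*2)%:R in
  \big[@brauer_comp delta n.+1 n.+1 n.+1 / brauer_id n.+1]_(1 <= j < k.+1)
    brauer_e delta n.+1 (n + 2 - 2 * j).

(* The integers (2^k k!)^2 (n+1-2k)! divide the coefficients of the
   corresponding terms; here they are inverted in K, so that this is the right
   element only when char K = 0 or char K > n + 1. *)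
Definition Phi n : brauer K n.+1 n.+1 :=
  let delta := - (n.*2)%:R in
  \sum_(0 <= k < (n.+1)./2.+1)
    ((2 ^ k * k`!) ^ 2 * (n.+1 - 2 * k)`!)%:R^-1 *:
      brauer_comp delta (Sigma n.+1) (brauer_comp delta (Ek n k) (Sigma n.+1)).

(* 0 <= i <= m + 1 *)
Definition Eorth m i : brauer K m.+1 m.+1 :=
  let delta := m%:R in
  let p := (m.+1 - i)%N in
  let q := (m.+1 + (p + p))%N in
  brauer_comp delta
    (brauer_cast q m.+1
       (brauer_tens (brauer_tens (brauer_id i) (brauer_A p)) (brauer_id p)))
    (brauer_comp delta
       (\sum_(s : 'S_m.+1)
          (-1) ^+ odd_perm s *: brauer_tens (brauer_perm s) (brauer_X p p))
       (brauer_cast m.+1 q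
          (brauer_tens (brauer_tens (brauer_id i) (brauer_U p))
             (brauer_id p)))).

Definition two_sided_ideal delta r (J : brauer K r r -> Prop) : Prop :=
  [/\ J 0, forall x y, J x -> J y -> J (x + y)
     & forall a x, J x -> J (brauer_comp delta a x) /\ J (brauer_comp delta x a)].

Definition ideal_gen delta r (g x : brauer K r r) : Prop :=
  forall J, two_sided_ideal delta J -> J g -> J x.

End Brauer.

Section TensorSpace.
Variables (K : fieldType) (m : nat).
Let V := 'rV[K]_m.

(* V^{(x) r} for V = K^m, in coordinates with respect to the basis
   e_{w 1} (x) ... (x) e_{w r}, w : 'I_r -> 'I_m. *)
Definition tensor_space r : Type := {ffun {ffun 'I_r -> 'I_m} -> K^o}.

HB.instance Definition _ r := Vector.on (tensor_space r).

(* v_1 (x) ... (x) v_r *)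
Definition pure_tensor r (v : 'I_r -> V) : tensor_space r :=
  [ffun w : {ffun 'I_r -> 'I_m} => \prod_(i < r) v i 0 (w i)].

Variables (eps : bool) (form : {hermitian V for eps & idfun}).

(* the action of g^{(x) r} *)
Definition tensor_act r (g : 'End(V)) (t : tensor_space r) : tensor_space r :=
  \sum_(w : {ffun 'I_r -> 'I_m})
    t w *: pure_tensor (fun i => g (delta_mx 0 (w i))).

(* f \in End_G(V^{(x) r}), G the isometry group of the form *)
Definition equivariant r (f : 'End(tensor_space r)) : Prop :=
  forall g : 'End(V), isometry form form g ->
    forall t, f (tensor_act g t) = tensor_act g (f t).

(* F is the algebra homomorphism F_{epsilon, r}^r, with epsilon = (-1)^eps;
   b is a basis of V and b' the dual basis.  Since the s_i and e_i generate the
   Brauer algebra, F is determined by this. *)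
Record brauer_rep (b b' : m.-tuple V) r
    (F : {linear brauer K r r -> 'End(tensor_space r)}) : Prop := BrauerRep {
  brauer_rep_equivariant : forall x, equivariant (F x);
  brauer_rep1 : F (brauer_id K r) = \1%VF;
  brauer_repM : forall x y,
    F (brauer_comp ((-1) ^+ eps * m%:R) x y) = (F x \o F y)%VF;
  brauer_rep_s : forall (i j : 'I_r) (v : 'I_r -> V), j = i.+1 :> nat ->
    F (brauer_s K r i.+1) (pure_tensor v)
      = (-1) ^+ eps *: pure_tensor (fun a => v (tperm i j a));
  brauer_rep_e : forall (i j : 'I_r) (v : 'I_r -> V), j = i.+1 :> nat ->
    F (brauer_e ((-1) ^+ eps * m%:R) r i.+1) (pure_tensor v)
      = form (v i) (v j) *:
          \sum_(a < m) pure_tensor (fun c =>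
             if c == i then tnth b a else if c == j then tnth b' a else v c)
}.

End TensorSpace.

(* Main.v *)
Require Import Defs.
From mathcomp Require Import all_boot all_order all_fingroup all_algebra.
From mathcomp Require Import zify.

Set Implicit Arguments.
Unset Strict Implicit.
Unset Printing Implicit Defensive.

Import GRing.Theory.
Local Open Scope ring_scope.

(** A diagram is a fixed point free involution of the 2r nodes, and the
    symmetric group of all nodes permutes the diagrams. The matrix coefficients
    of the image of a diagram under F are, up to a sign, the products of the
    values of the form on its arcs (F_phi), so the kernel of F consists of the
    linear relations between these multilinear functions of 2r vectors (F_eq0).

    An alternating sum over more than m vectors of V vanishes (phi_alternate).
    In the symmetric case this yields the minors of size m + 1 of the Gram
    matrix. In the skew case, where m = 2n, the alternating sum over all but one
    of 2n + 2 nodes is a multiple of a Pfaffian, the sum of all diagrams with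
    given arcs outside these nodes. These relations suffice. A diagram with a long
    chain of arcs, increasing in the symmetric case and nested in the skew case,
    is the term of least weight of such a relation (chain_orth, chain_symp).
    For a diagram without a long chain, its nodes can be labelled by the vectors
    of an orthogonal or symplectic basis in such a way that only this diagram
    and diagrams of smaller weight are nonzero there (label_weight). Both facts
    are instances of the rearrangement inequality. By these two triangularities
    an ideal in the kernel that contains all minors, respectively Pfaffians, is
    the whole kernel (straightening).

    It remains to produce all these relations from a single one. Multiplication
    by permutations on both sides moves the nodes within the rows, and
    multiplication by the elements e_xy permits to assume that the arcs common
    to all terms of a relation join the two rows (reduce). In the skew case half
    of the 2n + 2 nodes then lie in each row, so that all Pfaffians are
    conjugate (pfaffian_ideal). Since the denominators in Phi are orders of
    stabilizers, Phi is the sum of all diagrams, which is a Pfaffian (Phi_sum,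
    embed_Phi). In the symmetric case the minors fall into types, by the number
    of lower nodes among the nodes that index the rows of the minor. Minors of
    equal type are conjugate (typed_base), and E_i is a minor of type m + 1 - i
    (embed_Eorth). Transposing a minor replaces the type a by m + 1 - a
    (typed_swap), and a count of exchanges of nodes produces the type a + 1 from
    the type a as long as m <= 2a (typed_step, count_ideal). For the middle
    value of i all types are reached in this way.

    The integers by which the argument divides are divisors of (m + 1)!, which
    are invertible because the characteristic is at least m + 2. *)

(** * Permutations *)

Lemma perm_on_tperm (T : finType) (S : {set T}) x y :
  x \in S -> y \in S -> perm_on S (tperm x y).
Proof.
by move=> xS yS; apply: subset_trans (tperm_on _ _) _; rewrite subUset !sub1set xS.
Qed.

Lemma ffun_neq (I : finType) (R : eqType) (f g : {ffun I -> R}) :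
  f != g -> exists i, f i != g i.
Proof.
move=> fg; apply/existsP; rewrite -negb_forall; apply: contra fg => /forallP h.
by apply/eqP/ffunP => i; apply/eqP.
Qed.

Section Extend.
Variables (S T : finType) (f : S -> T).
Hypothesis f_inj : injective f.
Implicit Types (s t : {perm S}) (x y : S) (z : T).

Definition ext_fun s z : T :=
  if [pick x | f x == z] is Some x then f (s x) else z.

Lemma ext_funE s x : ext_fun s (f x) = f (s x).
Proof.
rewrite /ext_fun; case: pickP => [y /eqP/f_inj -> //|/(_ x)].
by rewrite eqxx.
Qed.

Lemma ext_fun_id s z : z \notin codom f -> ext_fun s z = z.
Proof.
by rewrite /ext_fun; case: pickP => // x /eqP <-; rewrite codom_f.
Qed.

Lemma ext_fun_inj s : injective (ext_fun s).
Proof.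
apply: (can_inj (g := ext_fun s^-1)) => z.
have [/codomP[x ->]|zf] := boolP (z \in codom f).
  by rewrite !ext_funE permK.
by rewrite !ext_fun_id.
Qed.

Definition extp s : {perm T} := perm (@ext_fun_inj s).

Lemma extpE s x : extp s (f x) = f (s x).
Proof. by rewrite permE ext_funE. Qed.

Lemma extp_id s z : z \notin codom f -> extp s z = z.
Proof. by move=> zf; rewrite permE ext_fun_id. Qed.

Lemma extp_eq s (p : {perm T}) : (forall x, p (f x) = f (s x)) ->
  (forall z, z \notin codom f -> p z = z) -> extp s = p.
Proof.
move=> h1 h2; apply/permP => z.
have [/codomP[x ->]|zf] := boolP (z \in codom f).
  by rewrite extpE h1.
by rewrite extp_id ?h2.
Qed.

Lemma extpM s t : extp (s * t)%g = (extp s * extp t)%g.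
Proof.
by apply: extp_eq => [x|z zf]; rewrite permM ?extpE ?permM // !extp_id.
Qed.

Lemma extp1 : extp 1 = 1%g.
Proof. by apply: extp_eq => [x|z _]; rewrite !perm1. Qed.

Lemma extpV s : extp s^-1 = (extp s)^-1%g.
Proof. by apply/eqP; rewrite eq_sym eq_invg_mul -extpM mulgV extp1. Qed.

Lemma extp_tperm x y : extp (tperm x y) = tperm (f x) (f y).
Proof.
apply: extp_eq => [z|z zf]; first by rewrite (inj_tperm _ _ _ f_inj).
by rewrite tpermD //; apply: contraNneq zf => <-; exact: codom_f.
Qed.

Lemma odd_extp s : odd_perm (extp s) = odd_perm s.
Proof.
have [ts -> _] := prod_tpermP s; elim: ts => [|u ts IH].
  by rewrite !big_nil extp1 !odd_perm1.
rewrite !big_cons extpM !odd_permM IH extp_tperm !odd_tperm.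
by rewrite (inj_eq f_inj).
Qed.

Lemma extp_inj : injective extp.
Proof.
move=> s t st; apply/permP => x; apply: f_inj.
by rewrite -!extpE st.
Qed.

Lemma extp_perm_on s : perm_on (f @: [set: S]) (extp s).
Proof.
apply/subsetP => z; rewrite inE; apply: contraR => zf.
rewrite extp_id //; apply: contra zf => /codomP[x ->].
by rewrite imset_f ?inE.
Qed.

Lemma extp_onto (p : {perm T}) :
  perm_on (f @: [set: S]) p -> exists s, p = extp s.
Proof.
move=> pf; have ex x : {y | f y == p (f x)}.
  apply: sigW; have : p (f x) \in f @: [set: S].
    by rewrite perm_closed // imset_f ?inE.
  by case/imsetP => y _ ->; exists y.
have s_inj : injective (fun x => sval (ex x)).
  move=> x y E; apply: f_inj; apply: (@perm_inj _ p).
  by rewrite -(eqP (svalP (ex x))) E (eqP (svalP (ex y))).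
exists (perm s_inj); apply/esym/extp_eq => [x|z zf].
  by rewrite permE (eqP (svalP (ex x))).
apply: (out_perm pf); apply: contra zf => /imsetP[x _ ->].
exact: codom_f.
Qed.

Lemma sum_extp (M : nmodType) (F : {perm T} -> M) :
  \sum_(s : {perm S}) F (extp s)
    = \sum_(p | perm_on (f @: [set: S]) p) F p.
Proof.
transitivity (\sum_(s in [set: {perm S}]) F (extp s)).
  by apply: eq_bigl => s; rewrite inE.
rewrite -(big_imset F) /=; last by move=> s t _ _; apply: extp_inj.
apply: eq_bigl => p.
apply/imsetP/idP => [[s _ ->]|/extp_onto[s ->]]; last by exists s; rewrite ?inE.
exact: extp_perm_on.
Qed.

End Extend.

(** * Diagrams as fixed point free involutions *)

Definition dmate k l (D : diagram k l) : node k l -> node k l := mate (val D).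

Lemma dmateK k l (D : diagram k l) : involutive (dmate D).
Proof. exact: mateK (valP D). Qed.

Lemma dmateN k l (D : diagram k l) x : dmate D x != x.
Proof. exact: mateN (valP D). Qed.

Lemma dmate_inj k l (D : diagram k l) : injective (dmate D).
Proof. exact: inv_inj (dmateK D). Qed.

Lemma dmate_arc k l (D : diagram k l) x y :
  ([set x; y] \in val D) = (y == dmate D x).
Proof. exact: mateE (valP D). Qed.

Lemma diagram_ext k l (D D' : diagram k l) : dmate D =1 dmate D' -> D = D'.
Proof.
suff sub (C C' : diagram k l) : dmate C =1 dmate C' -> val C \subset val C'.
  by move=> E; apply/val_inj/eqP; rewrite eqEsubset !sub.
move=> E; apply/subsetP => B BC; have hC := valP C.
have /set0Pn[x xB] : B != set0.
  by case/andP: hC => /and3P[_ _ C0] _; apply: contraNneq C0 => <-.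
rewrite (pairing_mate hC BC xB) -[mate _ _]/(dmate C x) E.
by rewrite dmate_arc.
Qed.

Lemma dmate_of_inv k l (f : node k l -> node k l) fK fN :
  dmate (@diagram_of_inv k l f fK fN) =1 f.
Proof. by move=> x; apply/esym/eqP; rewrite -dmate_arc; apply: imset_f. Qed.

Section Relabel.
Variables (k l : nat).
Implicit Types (D : diagram k l) (p q : {perm node k l}) (x : node k l).

Definition relabel_mate p D x := p (dmate D ((p^-1)%g x)).

Lemma relabel_mateK p D : involutive (relabel_mate p D).
Proof. by move=> x; rewrite /relabel_mate permK dmateK permKV. Qed.

Lemma relabel_mateN p D x : relabel_mate p D x != x.
Proof.
rewrite /relabel_mate -{2}[x](permKV p) (inj_eq perm_inj); exact: dmateN.
Qed.

Definition relabel p D : diagram k l :=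
  diagram_of_inv (@relabel_mateK p D) (@relabel_mateN p D).

Lemma dmate_relabel p D x : dmate (relabel p D) x = p (dmate D ((p^-1)%g x)).
Proof. exact: dmate_of_inv. Qed.

Lemma dmate_relabelE p D x : dmate (relabel p D) (p x) = p (dmate D x).
Proof. by rewrite dmate_relabel permK. Qed.

Lemma relabel1 D : relabel 1 D = D.
Proof. by apply: diagram_ext => x; rewrite dmate_relabel invg1 !perm1. Qed.

(** Permutations are composed from left to right. *)
Lemma relabelM p q D : relabel (p * q)%g D = relabel q (relabel p D).
Proof.
by apply: diagram_ext => x; rewrite !dmate_relabel invMg !permM.
Qed.

Lemma relabelK p : cancel (relabel p) (relabel p^-1).
Proof. by move=> D; rewrite -relabelM mulgV relabel1. Qed.

Lemma relabelKV p : cancel (relabel p^-1) (relabel p).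
Proof. by move=> D; rewrite -relabelM mulVg relabel1. Qed.

Lemma relabel_eqP p D D' :
  (forall x, dmate D' (p x) = p (dmate D x)) -> relabel p D = D'.
Proof.
move=> h; apply: diagram_ext => x; rewrite -[x](permKV p).
by rewrite dmate_relabelE h.
Qed.

Lemma relabel_arc D x : relabel (tperm x (dmate D x)) D = D.
Proof.
apply: relabel_eqP => y; case: (tpermP x (dmate D x) y) => [->|->|].
- by rewrite tpermR dmateK.
- by rewrite dmateK tpermL.
move=> /eqP yx /eqP ydx; rewrite tpermD // eq_sym.
  by apply: contra ydx => /eqP <-; rewrite dmateK.
by rewrite (inj_eq (@dmate_inj _ _ D)).
Qed.

End Relabel.

(** * Composition without loops *)

Section Composition.
Variables (k l q : nat).
Implicit Types (C : diagram l q) (B : diagram k l) (D : diagram k q).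

Lemma glued_bot C B x :
  glued_adj C B (gnode_bot q x) (gnode_bot q (dmate B x)).
Proof.
rewrite /glued_adj /glued_arcs inE -imset_pair imset_f //.
by rewrite dmate_arc eqxx.
Qed.

Lemma glued_top C B x : glued_adj C B (inr x) (inr (dmate C x)).
Proof.
rewrite /glued_adj /glued_arcs inE -[inr x]/(gnode_top k x).
rewrite -[inr (dmate _ _)]/(gnode_top k (dmate C x)) -imset_pair.
rewrite (imset_f (fun A : {set node l q} => @gnode_top k l q @: A)) ?orbT //.
by rewrite dmate_arc eqxx.
Qed.

Lemma comp_diagP C B D :
  (forall x, connect (glued_adj C B) (@gnode_out k l q x)
               (@gnode_out k l q (dmate D x))) -> comp_diag C B = D.
Proof.
move=> h; apply: diagram_ext => x; apply/esym/eqP.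
rewrite -dmate_arc /=.
have /and3P[/eqP cv tv _] : partition (glued C B) setT.
  by case/andP: (glued_pairing C B).
have : x \in cover (glued C B) by rewrite cv inE.
case/bigcupP=> A Ag xA; have E : A = [set x; dmate (comp_diag C B) x].
  exact: pairing_mate (glued_pairing C B) Ag xA.
suff <- : A = [set x; dmate D x] by [].
apply/esym/eqP; rewrite eqEcard {2}E !cards2 ![x == _]eq_sym !dmateN andbT.
apply/subsetP => y; rewrite !inE => /orP[/eqP->//|/eqP->].
case/imsetP: (Ag) xA => z _ ->; rewrite !inE /= => zx.
exact: connect_trans zx (h x).
Qed.

Lemma loops0 C B :
  (forall j : 'I_l, exists x, connect (glued_adj C B) (inr (inl j))
               (@gnode_out k l q x)) -> loops C B = 0%N.
Proof.
move=> h; apply/eqP; rewrite cards_eq0; apply/eqP/setP=> A; rewrite !inE.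
apply/negP => /andP[AP sA].
case/imsetP: AP => z _ EA; have zA : z \in A by rewrite EA !inE connect0.
have /imsetP[j _ zj] := subsetP sA z zA; have [x cx] := h j.
have : gnode_out l x \in A by rewrite EA !inE zj.
by move/(subsetP sA)/imsetP => [i _]; case: x {cx} => y.
Qed.

End Composition.

Section Bilinear.
Variable K : fieldType.
Implicit Types (delta : K).

Lemma brauer_sum k l (x : brauer K k l) : x = \sum_D x D *: basis_elt K D.
Proof.
apply/ffunP => D; rewrite sum_ffunE (bigD1 D) //= big1 => [|D' neq].
  by rewrite !ffunE eqxx /= addr0 /GRing.scale /= mulr1.
by rewrite !ffunE eq_sym (negPf neq) scaler0.
Qed.

Lemma brauer_ind k l (P : brauer K k l -> Prop) :
  P 0 -> (forall x y, P x -> P y -> P (x + y)) ->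
  (forall c D, P (c *: basis_elt K D)) -> forall x, P x.
Proof. by move=> P0 PD PB x; rewrite (brauer_sum x); apply: (big_ind P). Qed.

Lemma basis_eltE k l (D D' : diagram k l) :
  basis_elt K D D' = (D' == D)%:R.
Proof. by rewrite ffunE. Qed.

Lemma brauer_compDl delta k l q (a a' : brauer K l q) (b : brauer K k l) :
  brauer_comp delta (a + a') b = brauer_comp delta a b + brauer_comp delta a' b.
Proof.
rewrite /brauer_comp -big_split; apply: eq_bigr => D1 _; rewrite -big_split.
by apply: eq_bigr => D2 _; rewrite /= -scalerDl ffunE !mulrDl.
Qed.

Lemma brauer_compDr delta k l q (a : brauer K l q) (b b' : brauer K k l) :
  brauer_comp delta a (b + b') = brauer_comp delta a b + brauer_comp delta a b'.
Proof.
rewrite /brauer_comp -big_split; apply: eq_bigr => D1 _; rewrite -big_split.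
by apply: eq_bigr => D2 _; rewrite /= -scalerDl ffunE !(mulrDl, mulrDr).
Qed.

Lemma brauer_compZl delta k l q c (a : brauer K l q) (b : brauer K k l) :
  brauer_comp delta (c *: a) b = c *: brauer_comp delta a b.
Proof.
rewrite /brauer_comp scaler_sumr; apply: eq_bigr => D1 _; rewrite scaler_sumr.
by apply: eq_bigr => D2 _; rewrite scalerA ffunE /GRing.scale /= !mulrA.
Qed.

Lemma brauer_compZr delta k l q c (a : brauer K l q) (b : brauer K k l) :
  brauer_comp delta a (c *: b) = c *: brauer_comp delta a b.
Proof.
rewrite /brauer_comp scaler_sumr; apply: eq_bigr => D1 _; rewrite scaler_sumr.
apply: eq_bigr => D2 _; rewrite scalerA ffunE /GRing.scale /=.
by rewrite (mulrCA (a D1)) !mulrA.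
Qed.

Lemma brauer_comp0l delta k l q (b : brauer K k l) :
  brauer_comp delta (0 : brauer K l q) b = 0.
Proof. by rewrite -(scale0r 0) brauer_compZl scale0r. Qed.

Lemma brauer_comp0r delta k l q (a : brauer K l q) :
  brauer_comp delta a (0 : brauer K k l) = 0.
Proof. by rewrite -(scale0r 0) brauer_compZr scale0r. Qed.

Lemma brauer_comp_suml delta k l q I (s : seq I) (P : pred I)
    (a : I -> brauer K l q) (b : brauer K k l) :
  brauer_comp delta (\sum_(i <- s | P i) a i) b
    = \sum_(i <- s | P i) brauer_comp delta (a i) b.
Proof.
apply: (big_morph (fun x => brauer_comp delta x b)) => [x y|].
  exact: brauer_compDl.
exact: brauer_comp0l.
Qed.

Lemma brauer_comp_sumr delta k l q I (s : seq I) (P : pred I)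
    (a : brauer K l q) (b : I -> brauer K k l) :
  brauer_comp delta a (\sum_(i <- s | P i) b i)
    = \sum_(i <- s | P i) brauer_comp delta a (b i).
Proof.
apply: (big_morph (brauer_comp delta a)) => [x y|].
  exact: brauer_compDr.
exact: brauer_comp0r.
Qed.

Lemma brauer_comp_basis delta k l q (D1 : diagram l q) (D2 : diagram k l) :
  brauer_comp delta (basis_elt K D1) (basis_elt K D2)
    = delta ^+ loops D1 D2 *: basis_elt K (comp_diag D1 D2).
Proof.
rewrite /brauer_comp (bigD1 D1) //= [X in _ + X]big1 => [|D neq]; last first.
  by apply: big1 => D' _; rewrite !ffunE (negPf neq) !mul0r scale0r.
rewrite addr0 (bigD1 D2) //= [X in _ + X]big1 => [|D neq]; last first.
  by rewrite !ffunE (negPf neq) mulr0 mul0r scale0r.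
by rewrite addr0 !ffunE !eqxx !mul1r.
Qed.

(** Composition of diagrams is read off from paths in the glued graph: a node
    of the middle row that is connected to an outer node lies on no closed
    loop. *)
Lemma comp_basis delta k l q (D1 : diagram l q) (D2 : diagram k l)
    (D : diagram k q) :
  (forall x, connect (glued_adj D1 D2) (gnode_out l x)
               (gnode_out l (dmate D x))) ->
  (forall j : 'I_l, exists x, connect (glued_adj D1 D2) (inr (inl j))
               (@gnode_out k l q x)) ->
  brauer_comp delta (basis_elt K D1) (basis_elt K D2) = basis_elt K D.
Proof.
move=> h1 h2; rewrite brauer_comp_basis (comp_diagP h1) loops0 //.
by rewrite expr0 scale1r.
Qed.

End Bilinear.

(** * Multiplication by permutations and by the elements e_xy *)

Section Multiplication.
Variable r : nat.
Local Notation T := (node r r).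
Implicit Types (D : diagram r r) (s : 'S_r) (x y : 'I_r).

Definition lowp s : {perm T} := extp (@inl_inj 'I_r 'I_r) s.
Definition upp s : {perm T} := extp (@inr_inj 'I_r 'I_r) s.

Lemma lowpl s i : lowp s (inl i) = inl (s i). Proof. exact: extpE. Qed.
Lemma uppr s i : upp s (inr i) = inr (s i). Proof. exact: extpE. Qed.
Lemma lowpr s i : lowp s (inr i) = inr i.
Proof. by apply: extp_id; apply/codomP => -[]. Qed.
Lemma uppl s i : upp s (inl i) = inl i.
Proof. by apply: extp_id; apply/codomP => -[]. Qed.
Definition luE := (lowpl, lowpr, uppl, uppr).

Lemma uppM s t : upp (s * t)%g = (upp s * upp t)%g.
Proof. exact: extpM. Qed.
Lemma lowp1 : lowp 1 = 1%g. Proof. exact: extp1. Qed.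
Lemma upp1 : upp 1 = 1%g. Proof. exact: extp1. Qed.
Lemma lowpV s : lowp s^-1 = (lowp s)^-1%g. Proof. exact: extpV. Qed.
Lemma uppV s : upp s^-1 = (upp s)^-1%g. Proof. exact: extpV. Qed.
Lemma odd_lowp s : odd_perm (lowp s) = odd_perm s. Proof. exact: odd_extp. Qed.
Lemma odd_upp s : odd_perm (upp s) = odd_perm s. Proof. exact: odd_extp. Qed.

Lemma dmate_perm s : dmate (perm_diag s) =1 perm_mate s.
Proof. exact: dmate_of_inv. Qed.

Lemma dmate_id z : dmate (id_diag r) z =
  match z with inl i => inr i | inr i => inl i end.
Proof. by rewrite dmate_perm; case: z => i /=; rewrite ?invg1 perm1. Qed.

Lemma perm_diagE s : perm_diag s = relabel (upp s) (id_diag r).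
Proof.
apply: diagram_ext => -[] i; rewrite dmate_relabel dmate_perm -uppV luE /=.
  by rewrite dmate_id luE.
by rewrite dmate_id luE.
Qed.

Variable K : fieldType.
Variable delta : K.
Local Notation "a '*c' b" := (brauer_comp delta a b) (at level 40, left associativity).
Local Notation "[b D ]" := (basis_elt K D) (at level 0, format "[b  D ]").

Lemma comp_perm_r D s : [b D] *c [b perm_diag s] = [b relabel (lowp s^-1) D].
Proof.
pose g (z : T) := match z with inl i => inl (s i) | _ => z end.
have cg (z : T) : connect (glued_adj D (perm_diag s)) (gnode_out r z) (inr (g z)).
  case: z => i; last exact: connect0.
  by have := connect1 (glued_bot D (perm_diag s) (inl i)); rewrite dmate_perm.
apply: comp_basis => [z|j].
  apply: (connect_trans (cg z)); apply: (connect_trans (connect1 (glued_top _ _ _))).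
  rewrite glued_adj_sym; suff -> : dmate D (g z) = g (dmate (relabel (lowp s^-1) D) z).
    exact: cg.
  rewrite dmate_relabel -lowpV invgK.
  have -> : lowp s z = g z by case: z => i; rewrite luE.
  by case: (dmate D _) => i; rewrite luE //= permKV.
exists (inl ((s^-1)%g j)); rewrite glued_adj_sym; have := cg (inl ((s^-1)%g j)).
by rewrite /= permKV.
Qed.

Lemma comp_perm_top k (D : diagram k r) s :
  brauer_comp delta [b perm_diag s] [b D]
    = [b relabel (extp (@inr_inj 'I_k 'I_r) s) D].
Proof.
have upr t i : extp (@inr_inj 'I_k 'I_r) t (inr i) = inr (t i) by exact: extpE.
have upl t i : extp (@inr_inj 'I_k 'I_r) t (inl i) = inl i.
  by apply: extp_id; apply/codomP => -[].
pose g (z : node k r) : node k r :=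
  match z with inr i => inr ((s^-1)%g i) | _ => z end.
have cg (z : node k r) : connect (glued_adj (perm_diag s) D) (gnode_out r z)
    (gnode_bot r (g z)).
  case: z => i; first exact: connect0.
  by have := connect1 (glued_top (perm_diag s) D (inr i)); rewrite dmate_perm.
apply: comp_basis => [z|j].
  apply: (connect_trans (cg z)); apply: (connect_trans (connect1 (glued_bot _ _ _))).
  rewrite glued_adj_sym; set D' := relabel _ D.
  suff -> : dmate D (g z) = g (dmate D' z) by exact: cg.
  rewrite dmate_relabel -extpV.
  have -> : extp (@inr_inj 'I_k 'I_r) s^-1 z = g z by case: z => i; rewrite ?upl ?upr.
  by case: (dmate D _) => i; rewrite ?upl ?upr //= permK.
exists (inr (s j)); rewrite glued_adj_sym; have := cg (inr (s j)).
by rewrite /= permK.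
Qed.

Lemma comp_perm_l D s : [b perm_diag s] *c [b D] = [b relabel (upp s) D].
Proof. exact: comp_perm_top. Qed.

Definition e_diag x y : diagram r r :=
  relabel (tperm (inl y) (inr x)) (id_diag r).

Lemma dmate_e x y z : x != y -> dmate (e_diag x y) z =
  if z == inl x then inl y else if z == inl y then inl x else
  if z == inr x then inr y else if z == inr y then inr x else
  dmate (id_diag r) z.
Proof.
move=> xy; rewrite dmate_relabel tpermV !dmate_id; have yx : y != x by rewrite eq_sym.
case: z => i; rewrite ?(inj_eq inl_inj) ?(inj_eq inr_inj) /=.
  case: (i =P x) => [->|/eqP ix].
    by rewrite tpermD ?tpermR // (inj_eq inl_inj).
  case: (i =P y) => [->|/eqP iy].
    by rewrite tpermL tpermD // (inj_eq inl_inj).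
  by rewrite !tpermD // ?(inj_eq inl_inj) ?(inj_eq inr_inj) // eq_sym.
case: (i =P x) => [->|/eqP ix].
  by rewrite tpermR tpermD // (inj_eq inr_inj).
case: (i =P y) => [->|/eqP iy].
  by rewrite tpermD ?tpermL // (inj_eq inr_inj).
by rewrite !tpermD // ?(inj_eq inl_inj) ?(inj_eq inr_inj) // eq_sym.
Qed.

(** The other factor arises by exchanging the node x with any upper node u, so
    that it joins y with u and x with the old partner of u. *)
Lemma comp_e_r D x y u : dmate D (inl x) = inl y ->
  [b relabel (tperm (inl x) (inr u)) D] *c [b e_diag x y] = [b D].
Proof.
move=> Dx; have xy : x != y.
  by apply/eqP => E; have := dmateN D (inl x); rewrite Dx E eqxx.
have Dy : dmate D (inl y) = inl x by rewrite -Dx dmateK.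
set D' := relabel _ D; pose E := e_diag x y.
have D'y : dmate D' (inl y) = inr u.
  rewrite dmate_relabel tpermV tpermD ?Dy ?tpermL // (inj_eq inl_inj) //.
have D'u : dmate D' (inr u) = inl y by rewrite -D'y dmateK.
set z := dmate D (inr u).
have zu : z != inr u by exact: dmateN.
have zx : z != inl x.
  by rewrite -Dy (inj_eq (@dmate_inj _ _ D)).
have zy : z != inl y by rewrite -Dx (inj_eq (@dmate_inj _ _ D)).
have D'x : dmate D' (inl x) = z.
  by rewrite dmate_relabel tpermV tpermL tpermD // eq_sym.
have c1 (t : T) : t != inl x -> t != inl y ->
    connect (glued_adj D' E) (gnode_out r t) (inr t).
  case: t => i tx ty; last exact: connect0.
  have := connect1 (glued_bot D' E (inl i)).
  by rewrite /E dmate_e // (negPf tx) (negPf ty) /= dmate_id.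
have cxy : connect (glued_adj D' E) (inr (inl x)) (inr (inl y)).
  have := connect1 (glued_bot D' E (inr x)).
  by rewrite /E dmate_e //= eqxx.
have cu : connect (glued_adj D' E) (inr (inr u)) (inr z).
  have := connect1 (glued_top D' E (inr u)); rewrite D'u => /connect_trans; apply.
  rewrite glued_adj_sym in cxy; apply: (connect_trans cxy).
  by have := connect1 (glued_top D' E (inl x)); rewrite D'x.
apply: comp_basis => [t|j].
  have [->|tx] := eqVneq t (inl x).
    have := connect1 (glued_bot D' E (inl x)).
    by rewrite /E dmate_e // eqxx Dx.
  have [->|ty] := eqVneq t (inl y).
    have := connect1 (glued_bot D' E (inl y)).
    rewrite /E dmate_e // eqxx (inj_eq inl_inj) eq_sym (negPf xy) Dy; exact.
  have dtx : dmate D t != inl x by rewrite -Dy (inj_eq (@dmate_inj _ _ D)).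
  have dty : dmate D t != inl y by rewrite -Dx (inj_eq (@dmate_inj _ _ D)).
  apply: (connect_trans (c1 t tx ty)).
  rewrite glued_adj_sym; apply: (connect_trans (c1 _ dtx dty)).
  rewrite glued_adj_sym.
  have [->|tu] := eqVneq t (inr u); first exact: cu.
  have [->|tz] := eqVneq t z.
    by rewrite /z dmateK glued_adj_sym.
  have := connect1 (glued_top D' E t); rewrite dmate_relabel tpermV.
  rewrite tpermD 1?eq_sym // tpermD 1?eq_sym //.
  by apply: contra tz => /eqP h; rewrite /z -h dmateK.
have [->|jx] := eqVneq j x.
  exists z; rewrite glued_adj_sym; apply: (connect_trans (c1 z zx zy)).
  rewrite glued_adj_sym; have := connect1 (glued_top D' E (inl x)).
  by rewrite D'x.
have [->|jy] := eqVneq j y.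
  exists (inr u); have := connect1 (glued_top D' E (inl y)).
  by rewrite D'y.
exists (inl j); rewrite glued_adj_sym; apply: c1; by rewrite (inj_eq inl_inj).
Qed.

(** The mirror image of the preceding lemma. *)
Lemma comp_e_l D x y u : dmate D (inr x) = inr y ->
  [b e_diag x y] *c [b relabel (tperm (inr x) (inl u)) D] = [b D].
Proof.
move=> Dx; have xy : x != y.
  by apply/eqP => E; have := dmateN D (inr x); rewrite Dx E eqxx.
have Dy : dmate D (inr y) = inr x by rewrite -Dx dmateK.
set D' := relabel _ D; pose E := e_diag x y.
have D'y : dmate D' (inr y) = inl u.
  rewrite dmate_relabel tpermV tpermD ?Dy ?tpermL // (inj_eq inr_inj) //.
have D'u : dmate D' (inl u) = inr y by rewrite -D'y dmateK.
set z := dmate D (inl u).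
have zu : z != inl u by exact: dmateN.
have zx : z != inr x by rewrite -Dy (inj_eq (@dmate_inj _ _ D)).
have zy : z != inr y by rewrite -Dx (inj_eq (@dmate_inj _ _ D)).
have D'x : dmate D' (inr x) = z.
  by rewrite dmate_relabel tpermV tpermL tpermD // eq_sym.
have c1 (t : T) : t != inr x -> t != inr y ->
    connect (glued_adj E D') (gnode_out r t) (gnode_bot r t).
  case: t => i tx ty; first exact: connect0.
  have := connect1 (glued_top E D' (inr i)).
  by rewrite /E dmate_e // (negPf tx) (negPf ty) /= dmate_id.
have cxy : connect (glued_adj E D') (gnode_bot r (inr x : T)) (gnode_bot r (inr y : T)).
  have := connect1 (glued_top E D' (inl x)).
  by rewrite /E dmate_e //= eqxx.
have cu : connect (glued_adj E D') (gnode_bot r (inl u : T)) (gnode_bot r z).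
  have := connect1 (glued_bot E D' (inl u)); rewrite D'u => /connect_trans; apply.
  rewrite glued_adj_sym in cxy; apply: (connect_trans cxy).
  by have := connect1 (glued_bot E D' (inr x)); rewrite D'x.
apply: comp_basis => [t|j].
  have [->|tx] := eqVneq t (inr x).
    have := connect1 (glued_top E D' (inr x)).
    by rewrite /E dmate_e //= eqxx Dx.
  have [->|ty] := eqVneq t (inr y).
    have := connect1 (glued_top E D' (inr y)).
    rewrite /E dmate_e //= eqxx (inj_eq inr_inj) eq_sym (negPf xy) Dy; exact.
  have dtx : dmate D t != inr x by rewrite -Dy (inj_eq (@dmate_inj _ _ D)).
  have dty : dmate D t != inr y by rewrite -Dx (inj_eq (@dmate_inj _ _ D)).
  apply: (connect_trans (c1 t tx ty)).
  rewrite glued_adj_sym; apply: (connect_trans (c1 _ dtx dty)).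
  rewrite glued_adj_sym.
  have [->|tu] := eqVneq t (inl u); first exact: cu.
  have [->|tz] := eqVneq t z.
    by rewrite /z dmateK glued_adj_sym.
  have := connect1 (glued_bot E D' t); rewrite dmate_relabel tpermV.
  rewrite tpermD 1?eq_sym // tpermD 1?eq_sym //.
  by apply: contra tz => /eqP h; rewrite /z -h dmateK.
have [->|jx] := eqVneq j x.
  exists z; rewrite glued_adj_sym; apply: (connect_trans (c1 z zx zy)).
  rewrite glued_adj_sym; have := connect1 (glued_bot E D' (inr x)).
  by rewrite D'x.
have [->|jy] := eqVneq j y.
  exists (inl u); have := connect1 (glued_bot E D' (inr y)).
  by rewrite D'y.
exists (inr j); rewrite glued_adj_sym; apply: c1; by rewrite (inj_eq inr_inj).
Qed.

Lemma comp_id_r (a : brauer K r r) : a *c brauer_id K r = a.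
Proof.
rewrite [a in LHS]brauer_sum brauer_comp_suml {2}[a]brauer_sum.
apply: eq_bigr => D _.
by rewrite brauer_compZl comp_perm_r invg1 lowp1 relabel1.
Qed.

Lemma comp_id_l (a : brauer K r r) : brauer_id K r *c a = a.
Proof.
rewrite [a in LHS]brauer_sum brauer_comp_sumr {2}[a]brauer_sum.
apply: eq_bigr => D _.
by rewrite brauer_compZr comp_perm_l upp1 relabel1.
Qed.

End Multiplication.

(** * Juxtaposition and casts *)

Section JuxtCast.
Variable K : fieldType.

Lemma dmate_juxt_left k l k' l' (D : diagram k l) (D' : diagram k' l') x :
  dmate (juxt_diag D D') (node_left k' l' x) = node_left k' l' (dmate D x).
Proof.
apply/esym/eqP; rewrite -dmate_arc /= /juxt inE -imset_pair imset_f //.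
by rewrite dmate_arc.
Qed.

Lemma dmate_juxt_right k l k' l' (D : diagram k l) (D' : diagram k' l') x :
  dmate (juxt_diag D D') (node_right k l x) = node_right k l (dmate D' x).
Proof.
apply/esym/eqP; rewrite -dmate_arc /= /juxt inE -imset_pair.
rewrite (imset_f (fun C : {set node k' l'} => @node_right k l k' l' @: C)) ?orbT //.
by rewrite dmate_arc.
Qed.

Lemma nodeP k l k' l' (P : node (k + k') (l + l') -> Prop) :
  (forall x, P (node_left k' l' x)) -> (forall x, P (node_right k l x)) ->
  forall x, P x.
Proof.
move=> hl hr [] i; rewrite -(splitK i); case: (split i) => j.
- exact: (hl (inl j)).
- exact: (hr (inl j)).
- exact: (hl (inr j)).
- exact: (hr (inr j)).
Qed.

Lemma brauer_tens_basis k l k' l' (D : diagram k l) (D' : diagram k' l') :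
  brauer_tens (basis_elt K D) (basis_elt K D') = basis_elt K (juxt_diag D D').
Proof.
rewrite /brauer_tens (bigD1 D) //= [X in _ + X]big1 => [|C neq]; last first.
  by apply: big1 => C' _; rewrite !ffunE (negPf neq) !mul0r scale0r.
rewrite addr0 (bigD1 D') //= [X in _ + X]big1 => [|C neq]; last first.
  by rewrite !ffunE (negPf neq) mulr0 scale0r.
by rewrite addr0 !ffunE !eqxx !mul1r scale1r.
Qed.

Lemma brauer_tensDl k l k' l' (a a' : brauer K k l) (b : brauer K k' l') :
  brauer_tens (a + a') b = brauer_tens a b + brauer_tens a' b.
Proof.
rewrite /brauer_tens -big_split; apply: eq_bigr => D _; rewrite -big_split.
by apply: eq_bigr => D' _; rewrite /= -scalerDl ffunE !mulrDl.
Qed.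

Lemma brauer_tensZl k l k' l' c (a : brauer K k l) (b : brauer K k' l') :
  brauer_tens (c *: a) b = c *: brauer_tens a b.
Proof.
rewrite /brauer_tens scaler_sumr; apply: eq_bigr => D _; rewrite scaler_sumr.
by apply: eq_bigr => D' _; rewrite scalerA ffunE /GRing.scale /= !mulrA.
Qed.

Lemma brauer_tens_suml k l k' l' I (s : seq I) (P : pred I)
    (a : I -> brauer K k l) (b : brauer K k' l') :
  brauer_tens (\sum_(i <- s | P i) a i) b
    = \sum_(i <- s | P i) brauer_tens (a i) b.
Proof.
apply: (big_morph (fun x => brauer_tens x b)) => [x y|].
  exact: brauer_tensDl.
by rewrite -(scale0r 0) brauer_tensZl scale0r.
Qed.

Definition castn k l k' l' (ek : k = k') (el : l = l') (x : node k l) :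
    node k' l' :=
  match x with inl i => inl (cast_ord ek i) | inr j => inr (cast_ord el j) end.

Definition castd k l k' l' (ek : k = k') (el : l = l') (D : diagram k l) :
    diagram k' l' :=
  ecast i (diagram i l') ek (ecast j (diagram k j) el D).

Lemma castn_surj k l k' l' (ek : k = k') (el : l = l') (y : node k' l') :
  exists x, y = castn ek el x.
Proof.
case: y => i; [exists (inl (cast_ord (esym ek) i))|exists (inr (cast_ord (esym el) i))];
  by rewrite /= cast_ordKV.
Qed.

Lemma dmate_castd k l k' l' (ek : k = k') (el : l = l') (D : diagram k l) x :
  dmate (castd ek el D) (castn ek el x) = castn ek el (dmate D x).
Proof.
have cid (y : node k l) : castn erefl erefl y = y.
  by case: y => i /=; rewrite cast_ord_id.
by case: k' / ek; case: l' / el; rewrite !cid.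
Qed.

Lemma brauer_cast_basis k l k' l' (ek : k = k') (el : l = l') (D : diagram k l) :
  brauer_cast k' l' (basis_elt K D) = basis_elt K (castd ek el D).
Proof.
rewrite /brauer_cast; case: eqP => // ek'; case: eqP => // el'.
rewrite (eq_irrelevance ek' ek) (eq_irrelevance el' el).
by case: k' / {ek'} ek; case: l' / {el'} el.
Qed.

Lemma brauer_cast_linear k l k' l' c (a b : brauer K k l) :
  brauer_cast k' l' (c *: a + b) = c *: brauer_cast k' l' a + brauer_cast k' l' b.
Proof.
rewrite /brauer_cast; case: eqP => [ek|_]; last by rewrite scaler0 addr0.
case: eqP => [el|_]; last by rewrite scaler0 addr0.
by case: k' / ek; case: l' / el.
Qed.

Lemma brauer_castD k l k' l' (a b : brauer K k l) :
  brauer_cast k' l' (a + b) = brauer_cast k' l' a + brauer_cast k' l' b.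
Proof. by have := brauer_cast_linear k' l' 1 a b; rewrite !scale1r. Qed.

Lemma brauer_cast0 k l k' l' : brauer_cast k' l' (0 : brauer K k l) = 0.
Proof.
by apply: (addrI (brauer_cast k' l' (0 : brauer K k l))); rewrite -brauer_castD !addr0.
Qed.

Lemma brauer_castZ k l k' l' c (a : brauer K k l) :
  brauer_cast k' l' (c *: a) = c *: brauer_cast k' l' a.
Proof.
by have := brauer_cast_linear k' l' c a 0; rewrite brauer_cast0 !addr0.
Qed.

Lemma brauer_cast_sum k l k' l' I (s : seq I) (P : pred I) (a : I -> brauer K k l) :
  brauer_cast k' l' (\sum_(i <- s | P i) a i)
    = \sum_(i <- s | P i) brauer_cast k' l' (a i).
Proof.
apply: (big_morph (@brauer_cast K k' l' k l)) => [x y|]; last exact: brauer_cast0.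
exact: brauer_castD.
Qed.

End JuxtCast.

(** * The generators *)

Section Generators.
Variable K : fieldType.

Definition at_node r (i j : 'I_r) (x : node 2 2) : node r r :=
  match x with
  | inl a => inl (if val a == 0%N then i else j)
  | inr a => inr (if val a == 0%N then i else j)
  end.

(** It suffices to compare partners: of the nodes i and j, on which the
    diagram is given by C, and of the others, where it is the identity. *)
Lemma brauer_at_basis r (i j : 'I_r) (C : diagram 2 2) (D : diagram r r) :
  j = i.+1 :> nat ->
  (forall x, dmate D (at_node i j x) = at_node i j (dmate C x)) ->
  (forall a, a != i -> a != j -> dmate D (inl a) = inr a) ->
  brauer_at r i.+1 (basis_elt K C) = basis_elt K D.
Proof.
move=> ji hC hid; have e : (i.+1.-1 + 2 + (r - i.+2) = r)%N.
  by have := ltn_ord j; lia.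
rewrite /brauer_at /brauer_id !brauer_tens_basis (brauer_cast_basis _ e e).
congr basis_elt; apply: diagram_ext => y; have [x ->] := castn_surj e e y.
rewrite dmate_castd.
have h (a : 'I_r) (z : nat) : a = z :> nat -> (z < i)%N \/ (i.+1 < z)%N ->
    (dmate D (inl a) = inr a) * (dmate D (inr a) = inl a).
  move=> az hz; have E : dmate D (inl a) = inr a.
    by apply: hid; apply/eqP => /(congr1 val) /=; lia.
  by split=> //; rewrite -E dmateK.
move: x; apply: nodeP => x.
  rewrite dmate_juxt_left; move: x; apply: nodeP => x.
    rewrite dmate_juxt_left dmate_id.
    case: x => a /=; have la : (a < i)%N by exact: ltn_ord.
      by rewrite (h (cast_ord e (lshift _ (lshift 2 a))) a erefl (or_introl la)).1.
    by rewrite (h (cast_ord e (lshift _ (lshift 2 a))) a erefl (or_introl la)).2.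
  rewrite dmate_juxt_right.
  have E z : castn e e (node_left (r - i.+2) (r - i.+2) (node_right i.+1.-1 i.+1.-1 z))
    = at_node i j z.
    by case: z => -[[|[|//]] ?]; rewrite /=; congr (_ _); apply: val_inj => /=; lia.
  by rewrite !E hC.
rewrite dmate_juxt_right dmate_id.
have bE (a : 'I_(r - i.+2)) : cast_ord e (rshift (i.+1.-1 + 2) a) = (i.+2 + a)%N :> nat.
  by rewrite /=; lia.
have lb (a : 'I_(r - i.+2)) := or_intror (i.+2 + a < i)%N (leq_addr a i.+2).
by case: x => a /=; rewrite ((h _ _ (bE a) (lb a)).1, (h _ _ (bE a) (lb a)).2).
Qed.

Lemma ord2P (P : 'I_2 -> Prop) : P ord0 -> P ord_max -> forall a, P a.
Proof. by move=> h0 h1 [[|[|//]] ?]; [move: h0|move: h1]; congr P; apply: val_inj. Qed.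

Lemma brauer_sE r (i j : 'I_r) : j = i.+1 :> nat ->
  brauer_s K r i.+1 = basis_elt K (perm_diag (tperm i j)).
Proof.
move=> ji; apply: (brauer_at_basis ji) => [[] a|a ai aj].
- rewrite dmate_perm [dmate _ _]dmate_of_inv /=.
  by move: a; apply: ord2P; case: splitP => b; rewrite (ord1 b) //= => _;
    rewrite ?tpermL ?tpermR.
- rewrite dmate_perm [dmate _ _]dmate_of_inv /= tpermV.
  by move: a; apply: ord2P; case: splitP => b; rewrite (ord1 b) //= => _;
    rewrite ?tpermL ?tpermR.
- by rewrite dmate_perm /= tpermD // eq_sym.
Qed.

Lemma brauer_eE delta r (i j : 'I_r) : j = i.+1 :> nat ->
  brauer_e delta r i.+1 = basis_elt K (e_diag i j).
Proof.
move=> ji; have ij : i != j by apply/eqP => /(congr1 val) /=; lia.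
rewrite /brauer_e; have -> : brauer_comp delta (brauer_U K 1) (brauer_A K 1)
    = basis_elt K (e_diag (ord0 : 'I_2) ord_max).
  apply: comp_basis => [x|[]//]; rewrite dmate_e //.
  move: x => [] a /=.
    have := connect1 (glued_bot (cup_diag 1) (cap_diag 1) (inl a)).
    rewrite [dmate _ _]dmate_of_inv /= => h.
    by move: a h; apply: ord2P => h; congr connect: h; congr inl; apply: val_inj.
  have := connect1 (glued_top (cup_diag 1) (cap_diag 1) (inr a)).
  rewrite [dmate _ _]dmate_of_inv /= => h.
  by move: a h; apply: ord2P => h; congr connect: h; congr (inr (inr _)); apply: val_inj.
apply: (brauer_at_basis ji) => [x|a ai aj].
  have E0 : (if val (ord0 : 'I_2) == 0%N then i else j) = i by [].
  have E1 : (if val (ord_max : 'I_2) == 0%N then i else j) = j by [].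
  have ji' : (j == i) = false by rewrite eq_sym (negPf ij).
  by case: x; apply: ord2P; rewrite !dmate_e //= ?eqxx //
    ?(inj_eq inl_inj) ?(inj_eq inr_inj) ?ji' ?eqxx.
rewrite dmate_e // !(inj_eq inl_inj) (negPf ai) (negPf aj) /=.
exact: dmate_id.
Qed.

End Generators.

(** * The embedding of Brauer algebras *)

Section Embed.
Variables (s r : nat).
Hypothesis le_sr : (s <= r)%N.

Definition emb_node (x : node s s) : node r r :=
  match x with
  | inl i => inl (widen_ord le_sr i) | inr i => inr (widen_ord le_sr i)
  end.

Lemma emb_node_inj : injective emb_node.
Proof.
by case=> i [] j //= [E]; congr (_ _); apply: ord_inj; exact: E.
Qed.

Definition embd (D : diagram s s) : diagram r r :=
  castd (subnKC le_sr) (subnKC le_sr) (juxt_diag D (id_diag (r - s))).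

Lemma brauer_embed_basis (K : fieldType) (D : diagram s s) :
  brauer_embed r (basis_elt K D) = basis_elt K (embd D).
Proof.
by rewrite /brauer_embed /brauer_id brauer_tens_basis (brauer_cast_basis _ (subnKC le_sr) (subnKC le_sr)).
Qed.

Lemma brauer_embed_sum (K : fieldType) I (t : seq I) (P : pred I)
    (c : I -> K) (D : I -> diagram s s) :
  brauer_embed r (\sum_(i <- t | P i) c i *: basis_elt K (D i))
    = \sum_(i <- t | P i) c i *: basis_elt K (embd (D i)).
Proof.
rewrite /brauer_embed brauer_tens_suml brauer_cast_sum; apply: eq_bigr => i _.
rewrite brauer_tensZl brauer_castZ -brauer_embed_basis //.
Qed.

Lemma dmate_embd D x : dmate (embd D) (emb_node x) = emb_node (dmate D x).
Proof.
have E z : emb_node z =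
    castn (subnKC le_sr) (subnKC le_sr) (node_left (r - s) (r - s) z).
  by case: z => i /=; congr (_ _); exact: val_inj.
by rewrite !E dmate_castd dmate_juxt_left.
Qed.

Lemma dmate_embd_out D z : z \notin codom emb_node ->
  dmate (embd D) z = dmate (id_diag r) z.
Proof.
have [x ->] := castn_surj (subnKC le_sr) (subnKC le_sr) z.
rewrite dmate_castd; move: x; apply: nodeP => x.
  case/negP; apply/codomP; exists x.
  by case: x => i /=; congr (_ _); exact: val_inj.
rewrite dmate_juxt_right !dmate_id => _.
by case: x => i /=; congr (_ _); exact: val_inj.
Qed.

Lemma embd_relabel (p : {perm node s s}) D :
  embd (relabel p D) = relabel (extp emb_node_inj p) (embd D).
Proof.
apply/esym/relabel_eqP => z.
have [/codomP[x ->]|zc] := boolP (z \in codom emb_node).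
  by rewrite dmate_embd !extpE dmate_embd dmate_relabelE.
have zc' : dmate (id_diag r) z \notin codom emb_node.
  apply: contra zc => /codomP[x E]; apply/codomP; exists (dmate (id_diag s) x).
  move: E; rewrite !dmate_id; case: z => i; case: x => j //= [->] //.
by rewrite extp_id // !dmate_embd_out // extp_id.
Qed.

End Embed.

(** * The symmetric group of the nodes *)

Section Action.
Variables (K : fieldType) (r : nat).
Local Notation T := (node r r).
Local Notation "[b D ]" := (basis_elt K D) (at level 0, format "[b  D ]").
Implicit Types (D : diagram r r) (p q : {perm T}) (x y : brauer K r r).

(** The symmetric group of all nodes acts on the Brauer algebra; only the
    permutations that preserve the rows act through multiplication. *)
Definition nact p x : brauer K r r := [ffun D => x (relabel p^-1 D)].

Lemma nactE p x D : nact p x D = x (relabel p^-1 D).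
Proof. by rewrite ffunE. Qed.

Lemma nactD p x y : nact p (x + y) = nact p x + nact p y.
Proof. by apply/ffunP => D; rewrite !ffunE. Qed.

Lemma nactZ p c x : nact p (c *: x) = c *: nact p x.
Proof. by apply/ffunP => D; rewrite !ffunE. Qed.

Lemma nact0 p : nact p 0 = 0.
Proof. by apply/ffunP => D; rewrite !ffunE. Qed.

Lemma nact_sum p I (s : seq I) (P : pred I) (F : I -> brauer K r r) :
  nact p (\sum_(i <- s | P i) F i) = \sum_(i <- s | P i) nact p (F i).
Proof. by apply: (big_morph (nact p)) => [x y|]; rewrite ?nactD ?nact0. Qed.

Lemma nact_basis p D : nact p [b D] = [b relabel p D].
Proof.
apply/ffunP => C; rewrite nactE [LHS]basis_eltE [RHS]basis_eltE.
suff -> : (relabel p^-1 C == D) = (C == relabel p D) by [].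
by apply/eqP/eqP => [<-|->]; rewrite ?relabelKV ?relabelK.
Qed.

Lemma nact1 x : nact 1 x = x.
Proof. by apply/ffunP => D; rewrite ffunE invg1 relabel1. Qed.

Lemma nactM p q x : nact (p * q)%g x = nact q (nact p x).
Proof. by apply/ffunP => D; rewrite !ffunE invMg relabelM. Qed.

Variables (delta : K) (J : brauer K r r -> Prop).
Hypothesis hJ : two_sided_ideal delta J.

Lemma ideal0 : J 0. Proof. by case: hJ. Qed.

Lemma idealD x y : J x -> J y -> J (x + y).
Proof. by case: hJ => _ h _; apply: h. Qed.

Lemma idealZ c x : J x -> J (c *: x).
Proof.
case: hJ => _ _ h Jx; rewrite -(comp_id_l delta x) -brauer_compZl.
by have [] := h (c *: brauer_id K r) x Jx.
Qed.

Lemma idealN x : J x -> J (- x).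
Proof. by rewrite -scaleN1r; apply: idealZ. Qed.

Lemma idealB x y : J x -> J y -> J (x - y).
Proof. by move=> hx hy; apply: idealD => //; apply: idealN. Qed.

Lemma ideal_sum I (s : seq I) (P : pred I) (F : I -> brauer K r r) :
  (forall i, P i -> J (F i)) -> J (\sum_(i <- s | P i) F i).
Proof. by move=> h; apply: (big_ind J); [exact: ideal0|exact: idealD|]. Qed.

Lemma idealZ_inv c x : c != 0 -> J (c *: x) -> J x.
Proof. by move=> c0 /(idealZ c^-1); rewrite scalerA mulVf // scale1r. Qed.

Lemma ideal_lowp s x : J x -> J (nact (lowp s) x).
Proof.
case: hJ => _ _ h /(h (basis_elt K (perm_diag s^-1)))[_].
rewrite [x in brauer_comp _ x]brauer_sum brauer_comp_suml {2}[x]brauer_sum nact_sum.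
congr J; apply: eq_bigr => D _.
by rewrite brauer_compZl comp_perm_r invgK nactZ nact_basis.
Qed.

Lemma ideal_upp s x : J x -> J (nact (upp s) x).
Proof.
case: hJ => _ _ h /(h (basis_elt K (perm_diag s)))[+ _].
rewrite [x in brauer_comp _ _ x]brauer_sum brauer_comp_sumr {2}[x]brauer_sum nact_sum.
congr J; apply: eq_bigr => D _.
by rewrite brauer_compZr comp_perm_l nactZ nact_basis.
Qed.

(** True on the lower row. *)
Definition side (z : T) : bool := if z is inl _ then true else false.

Lemma side_permP p : (forall z, side (p z) = side z) ->
  exists s t, p = (lowp s * upp t)%g.
Proof.
move=> ps.
have el i : {j | p (inl i) == inl j}.
  by have := ps (inl i); case: (p _) => // j _; exists j.
have er i : {j | p (inr i) == inr j}.
  by have := ps (inr i); case: (p _) => // j _; exists j.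
have sl : injective (fun i => sval (el i)).
  move=> i j E; apply: (@inl_inj 'I_r 'I_r); apply: (@perm_inj _ p).
  by rewrite (eqP (svalP (el i))) (eqP (svalP (el j))) E.
have sr : injective (fun i => sval (er i)).
  move=> i j E; apply: (@inr_inj 'I_r 'I_r); apply: (@perm_inj _ p).
  by rewrite (eqP (svalP (er i))) (eqP (svalP (er j))) E.
exists (perm sl), (perm sr).
apply/permP => -[] i; rewrite permM !luE permE.
  exact: (eqP (svalP (el i))).
exact: (eqP (svalP (er i))).
Qed.

Lemma ideal_side p x : (forall z, side (p z) = side z) -> J x -> J (nact p x).
Proof.
move=> /side_permP[s [t ->]] Jx; rewrite nactM.
exact/ideal_upp/ideal_lowp.
Qed.

End Action.

Lemma no_cap_perm r (D : diagram r r) : (forall i, ~~ side (dmate D (inl i))) ->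
  exists s, D = perm_diag s.
Proof.
move=> h; have ex i : {j | dmate D (inl i) == inr j}.
  by have := h i; case: (dmate D _) => // j _; exists j.
have s_inj : injective (fun i => sval (ex i)).
  move=> i j E; apply: (@inl_inj 'I_r 'I_r); apply: (@dmate_inj _ _ D).
  by rewrite (eqP (svalP (ex i))) (eqP (svalP (ex j))) E.
exists (perm s_inj); apply: diagram_ext => z; rewrite dmate_perm.
have El i : dmate D (inl i) = inr (perm s_inj i).
  by rewrite permE; exact: (eqP (svalP (ex i))).
case: z => i /=; first exact: El.
by rewrite -{1}[i](permKV (perm s_inj)) -El dmateK.
Qed.

Lemma card_node_side r b : #|[set z : node r r | side z == b]| = r.
Proof.
rewrite -[RHS]card_ord -cardsT; case: b.
  rewrite -(card_imset _ (@inl_inj 'I_r 'I_r)); apply: eq_card => -[] i.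
    by rewrite inE imset_f ?inE.
  by rewrite inE; apply/esym/negbTE/imsetP => -[].
rewrite -(card_imset _ (@inr_inj 'I_r 'I_r)); apply: eq_card => -[] i.
  by rewrite inE; apply/esym/negbTE/imsetP => -[].
by rewrite inE imset_f ?inE.
Qed.

(** * Diagrams that agree outside a set of nodes *)

Section Agree.
Variable r : nat.
Local Notation T := (node r r).
Implicit Types (D : diagram r r) (p q : {perm T}) (S I : {set T}).

Definition agree S D D' := forall z, z \notin S -> dmate D' z = dmate D z.
Definition stable S D := forall z, (dmate D z \in S) = (z \in S).

Lemma agree_sym S D D' : agree S D D' -> agree S D' D.
Proof. by move=> h z /h. Qed.

Lemma agree_trans S D D' D'' : agree S D D' -> agree S D' D'' -> agree S D D''.
Proof. by move=> h h' z zS; rewrite h' ?h. Qed.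

Lemma stableP S D : (forall z, z \in S -> dmate D z \in S) -> stable S D.
Proof.
move=> h z; apply/idP/idP => [|/h//].
by move/h; rewrite dmateK.
Qed.

Lemma stable_agree S D D' : stable S D -> agree S D D' -> stable S D'.
Proof.
move=> st ag z; have [zS|zS] := boolP (z \in S); last first.
  by rewrite ag // st (negPf zS).
apply/negP => /negP wS; move: (st (dmate D' z)); rewrite -ag // dmateK zS.
by rewrite (negPf wS).
Qed.

Lemma perm_on_imset p I z : (z \in p @: I) = ((p^-1)%g z \in I).
Proof.
by rewrite -{1}[z](permKV p) mem_imset //; apply: perm_inj.
Qed.

Lemma agree_relabel p S D D' :
  agree S D D' -> agree (p @: S) (relabel p D) (relabel p D').
Proof.
by move=> h z; rewrite perm_on_imset => /h; rewrite !dmate_relabel => ->.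
Qed.

Arguments agree_relabel p [S D D'] _ _ _.

Lemma stable_relabel p S D : stable S D -> stable (p @: S) (relabel p D).
Proof.
by move=> h z; rewrite !perm_on_imset dmate_relabel permK h.
Qed.

Arguments stable_relabel p [S D] _ _.

(** As long as the diagrams differ, some transposition increases the set on
    which the partners coincide; since a partner can be read from either end
    of its arc, one point of S need not be moved. *)
Lemma conj_on S I D D' : stable S D -> agree S D D' ->
  {in S &, forall a b, a \notin I -> b \notin I -> a = b} ->
  exists2 p, perm_on I p & relabel p D' = D.
Proof.
move=> st ag hI.
pose bad C := [set x | dmate C x != dmate D x].
move en : #|bad D'| => n; elim/ltn_ind: n D' en ag => n IH C en ag.
have [/eqP|] := eqVneq #|bad C| 0%N.
  rewrite cards_eq0 => /eqP b0; exists 1%g; first exact: perm_on1.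
  rewrite relabel1; apply: diagram_ext => x; apply/eqP.
  by move/setP/(_ x): b0; rewrite !inE => /negbFE.
rewrite -lt0n card_gt0 => /set0Pn[x0]; rewrite inE => x0bad.
have stC := stable_agree st ag.
have badS y : dmate C y != dmate D y -> y \in S.
  by apply: contraNT => /ag ->.
have [x [xbad wI wI']] : exists x, [/\ dmate C x != dmate D x,
    dmate C x \in I & dmate D x \in I].
  have x0S := badS _ x0bad.
  have inI a b : a \in S -> b \in S -> a != b -> a \notin I -> b \in I.
    move=> aS bS ab aI; apply: contraNT ab => bI; apply/eqP; exact: hI.
  have [aI|aI] := boolP (dmate C x0 \in I); last first.
    have ne : x0 != dmate D (dmate C x0).
      apply: contra x0bad => /eqP E; apply/eqP.
      by apply: (canRL (dmateK D)); rewrite -E.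
    exists (dmate C x0); split; first by rewrite dmateK.
      rewrite dmateK; apply: (inI (dmate C x0)) => //; last exact: dmateN.
      by rewrite stC.
    apply: (inI (dmate C x0)) => //; rewrite ?st ?stC // eq_sym; exact: dmateN.
  have [bI|bI] := boolP (dmate D x0 \in I); first by exists x0.
  have ne : dmate C (dmate D x0) != x0.
    apply: contra x0bad => /eqP E; apply/eqP.
    by apply: (canLR (dmateK C)); rewrite E.
  exists (dmate D x0); split; first by rewrite dmateK.
    apply: (inI (dmate D x0)) => //; rewrite ?st ?stC ?st // eq_sym; exact: dmateN.
  rewrite dmateK; apply: (inI (dmate D x0)) => //; last exact: dmateN.
  by rewrite st.
pose a := dmate C x; pose b := dmate D x.
pose p1 := tperm a b; pose C1 := relabel p1 C.
have C1E y : dmate C1 y = p1 (dmate C (p1 y)) by rewrite dmate_relabel tpermV.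
have keep y : dmate C y = dmate D y -> dmate C1 y = dmate D y.
  move=> E; have yx : y != x by apply: contra xbad => /eqP <-; rewrite E.
  have ya : a != y.
    apply: contra xbad => /eqP ay; apply/eqP; apply: (canRL (dmateK D)).
    by rewrite -/a ay -E -ay /a dmateK.
  have yb : b != y.
    apply: contra xbad => /eqP ay; apply/eqP; apply: (canLR (dmateK C)).
    by rewrite -/b ay E -ay /b dmateK.
  rewrite C1E /p1 tpermD // tpermD //.
    by rewrite (inj_eq (@dmate_inj _ _ C)) eq_sym.
  by rewrite E (inj_eq (@dmate_inj _ _ D)) eq_sym.
have new : dmate C1 x = dmate D x.
  by rewrite C1E /p1 (tpermD (dmateN _ _) (dmateN _ _)) tpermL.
have [||p pI pE] := IH #|bad C1| _ C1 erefl.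
- rewrite -en; apply: proper_card; rewrite properE; apply/andP; split.
    by apply/subsetP => y; rewrite !inE; apply: contra => /eqP/keep ->.
  by apply/subsetPn; exists x; rewrite inE // new eqxx.
- by move=> y /ag /keep.
exists (p1 * p)%g; last by rewrite relabelM.
by apply: perm_onM => //; apply: perm_on_tperm.
Qed.

End Agree.

Arguments agree_relabel [r] p [S D D'] _ _ _.
Arguments stable_relabel [r] p [S D] _ _.

(** * Reduction to arcs between the two rows *)

Section Reduction.
Variables (K : fieldType) (r : nat) (delta : K) (J : brauer K r r -> Prop).
Hypothesis hJ : two_sided_ideal delta J.
Local Notation T := (node r r).
Implicit Types (D : diagram r r) (p q : {perm T}) (S I : {set T}) (X : brauer K r r).

(** All terms of X share the arcs of D outside S. *)
Definition local X S D := forall D', X D' != 0 -> agree S D D'.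
Definition through S D :=
  forall z, z \notin S -> side (dmate D z) = ~~ side z.

Lemma local_nact p X S D :
  local X S D -> local (nact p X) (p @: S) (relabel p D).
Proof.
move=> h D'; rewrite ffunE => /h /(agree_relabel p).
by rewrite relabelKV.
Qed.

Arguments local_nact p [X S D] _ _ _.

(** An arc within one row is created by multiplication with some e_xy, so it
    can be removed from all terms at once if it is common to them. *)
Lemma ideal_arc X (z u : T) : side u = ~~ side z ->
  (exists2 z', side z' = side z & forall D, X D != 0 -> dmate D z = z') ->
  J (nact (tperm z u) X) -> J X.
Proof.
move=> su [z' sz' hX] JX; case: hJ => _ _ h.
case: z su sz' hX JX => x; case: u => u // _; case: z' => y // _ hX JX.
  have [_] := h [ffun D => (D == e_diag x y)%:R] _ JX; congr J.
  rewrite {1}[X]brauer_sum nact_sum brauer_comp_suml {2}[X]brauer_sum.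
  apply: eq_bigr => D _; have [->|XD] := eqVneq (X D) 0.
    by rewrite !scale0r nact0 brauer_comp0l.
  by rewrite nactZ nact_basis brauer_compZl comp_e_r // hX.
have [+ _] := h [ffun D => (D == e_diag x y)%:R] _ JX; congr J.
rewrite {1}[X]brauer_sum nact_sum brauer_comp_sumr {2}[X]brauer_sum.
apply: eq_bigr => D _; have [->|XD] := eqVneq (X D) 0.
  by rewrite !scale0r nact0 brauer_comp0r.
by rewrite nactZ nact_basis brauer_compZr comp_e_l // hX.
Qed.

(** Otherwise D would map the other row injectively, hence onto, the row of z,
    although z has its partner in its own row. *)
Lemma opposite_node S D z : z \notin S -> side (dmate D z) = side z ->
  exists2 u, side u = ~~ side z & u \in S \/ side (dmate D u) = side u.
Proof.
move=> zS wz.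
have [u /andP[/eqP su /orP[uS|/eqP wu]]|no] := pickP (fun u =>
   (side u == ~~ side z) && ((u \in S) || (side (dmate D u) == side u))).
- by exists u => //; left.
- by exists u => //; right.
have sub : dmate D @: [set t | side t == ~~ side z] \subset
    [set t | side t == side z].
  apply/subsetP => t /imsetP[u]; rewrite !inE => su ->.
  have := no u; rewrite su /= => /norP[_]; move/eqP: su => ->.
  by case: (side (dmate D u)); case: (side z).
have /eqP E : dmate D @: [set t | side t == ~~ side z] ==
    [set t | side t == side z].
  rewrite eqEcard sub (card_imset _ (@dmate_inj _ _ D)) (card_node_side r (side z)).
  by rewrite (card_node_side r (~~ side z)) leqnn.
have : z \in [set t | side t == side z] by rewrite inE.
rewrite -E => /imsetP[u]; rewrite inE => /eqP su zu.
by move: wz; rewrite {1}zu dmateK su => /eqP; rewrite eq_sym; case: (side z).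
Qed.

(** An end z of an arc within a row is exchanged with a node u of the other
    row that lies in S or on an arc within that row; this lowers the number of
    nodes on arcs within a row. *)
Lemma reduce X S D : stable S D -> local X S D ->
  exists p, through (p @: S) (relabel p D) /\ (J (nact p X) -> J X).
Proof.
pose bad S D := [set z : T | (z \notin S) && (side (dmate D z) == side z)].
move en : #|bad S D| => n; elim/ltn_ind: n X S D en => n IH X S D en st loc.
have [b0|[z]] := set_0Vmem (bad S D).
  exists 1%g; rewrite nact1 relabel1; split=> // z.
  rewrite perm_on_imset invg1 perm1 => zS.
  move/setP/(_ z): b0; rewrite !inE zS /=.
  by case: (side (dmate D z)); case: (side z).
rewrite inE => /andP[zS /eqP wz]; have [u su hu] := opposite_node zS wz.
pose p1 := tperm z u; pose D1 := relabel p1 D; pose S1 := p1 @: S.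
have uz : u != z by apply/eqP => E; move: su; rewrite E; case: (side z).
have D1E y : dmate D1 y = p1 (dmate D (p1 y)) by rewrite dmate_relabel tpermV.
have S1E y : (y \in S1) = (p1 y \in S) by rewrite perm_on_imset tpermV.
have [|p [pt pJ]] := IH #|bad S1 D1| _ (nact p1 X) S1 D1 erefl (stable_relabel p1 st)
    (local_nact p1 loc).
  rewrite -en; apply: proper_card; rewrite properE.
  have nz : z \notin bad S1 D1.
    rewrite inE S1E D1E /p1 tpermL negb_and negbK; case: hu => [->//|wu].
    apply/orP; right; rewrite tpermD.
    + by rewrite wu su; case: (side z).
    + by apply/eqP => E; move: wu; rewrite -E su; case: (side z).
    + by rewrite eq_sym dmateN.
  have nu : u \notin bad S1 D1.
    rewrite inE S1E D1E /p1 tpermR negb_and negbK; apply/orP; right.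
    rewrite tpermD 1?eq_sym ?dmateN //.
      by rewrite wz su; case: (side z).
    by apply/eqP => E; move: wz; rewrite E su; case: (side z).
  apply/andP; split; last by apply/subsetPn; exists z; rewrite // inE zS wz eqxx.
  apply/subsetP => t tb; have tz : t != z by apply: contraNneq nz => <-.
  have tu : t != u by apply: contraNneq nu => <-.
  move: tb; rewrite !inE S1E D1E /p1 (tpermD (z := t)) 1?eq_sym //.
  case/andP=> tS; rewrite tS /=; case: tpermP => [wt|wt|_ _].
  - move/eqP=> stu; have stz : side t = side z by rewrite -wz -[in RHS]wt dmateK.
    by move: su; rewrite -stu stz; case: (side z).
  - move/eqP=> stz; case: hu => [uS|wu].
      by move: (st t); rewrite wt uS (negPf tS).
    by move: wu; rewrite -wt dmateK wt su -stz; case: (side t).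
  by rewrite eq_sym.
exists (p1 * p)%g; rewrite relabelM nactM; split.
  move: pt; congr through; apply/setP => y; by rewrite !perm_on_imset invMg permM.
move=> /pJ; apply: ideal_arc => //; exists (dmate D z) => // D' /loc; exact.
Qed.

End Reduction.

(** * The multilinear functions attached to diagrams *)

Section Phi.
Variables (K : fieldType) (r m : nat) (eps : bool).
Local Notation V := 'rV[K]_m.
Local Notation T := (node r r).
Variable bf : V -> V -> K.
Hypothesis bf_linear : forall c x y z, bf (c *: x + y) z = c * bf x z + bf y z.
Hypothesis bfC : forall x y, bf x y = (-1) ^+ eps * bf y x.
Implicit Types (D : diagram r r) (p q : {perm T}) (v : T -> V).
Local Notation id_r := (id_diag r).

Definition sg p : K := (-1) ^+ (eps && odd_perm p).

Lemma sgM p q : sg (p * q)%g = sg p * sg q.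
Proof. by rewrite /sg odd_permM; case: eps => //=; rewrite ?mulr1 // signr_addb. Qed.

Lemma sg_sq p : sg p * sg p = 1.
Proof. by rewrite /sg -expr2 sqrr_sign. Qed.

Lemma sg_tperm x y : x != y -> sg (tperm x y) = (-1) ^+ eps.
Proof. by move=> xy; rewrite /sg odd_tperm xy andbT. Qed.

Definition base v := \prod_(j < r) bf (v (inl j)) (v (inr j)).

Lemma eq_base v v' : v =1 v' -> base v = base v'.
Proof. by move=> E; apply: eq_bigr => j _; rewrite !E. Qed.

Lemma base_flip v j :
  base (v \o tperm (inl j) (inr j)) = (-1) ^+ eps * base v.
Proof.
rewrite /base (bigD1 j) //= [X in _ = _ * X](bigD1 j) //= mulrA; congr (_ * _).
  by rewrite tpermL tpermR bfC.
apply: eq_bigr => i ij.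
by rewrite !tpermD // ?(inj_eq inl_inj) ?(inj_eq inr_inj) // eq_sym.
Qed.

(** The stabilizer of the identity diagram is generated by the flips of its
    arcs, on which the claim is the symmetry of the form, and by the parallel
    permutations of the two rows, which are even and only reorder the factors. *)
Lemma base_stab p v : relabel p id_r = id_r -> base (v \o p) = sg p * base v.
Proof.
pose w := dmate id_r.
have wl j : w (inl j) = inr j by rewrite /w dmate_id.
have comm p' : relabel p' id_r = id_r -> forall z, p' (w z) = w (p' z).
  by move=> h z; rewrite /w -dmate_relabelE h.
have fixed p' v' : (forall j, (p' (inl j) == inl j) || (p' (inl j) == inr j)) ->
    relabel p' id_r = id_r -> base (v' \o p') = sg p' * base v'.
  move en : #|[set j | p' (inl j) == inr j]| => n.
  elim/ltn_ind: n p' en => n IH p' en hp st.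
  have [F0|[j]] := set_0Vmem [set j | p' (inl j) == inr j].
    have E j : p' (inl j) = inl j.
      move/setP/(_ j): F0; rewrite !inE => /negbT h.
      by move: (hp j); rewrite (negPf h) orbF => /eqP.
    have -> : p' = 1%g.
      by apply/permP => -[] j; rewrite perm1 // -wl (comm _ st) E.
    by rewrite /sg odd_perm1 andbF mul1r; apply: eq_base => z /=; rewrite perm1.
  rewrite inE => /eqP pj; pose t : {perm T} := tperm (inl j) (inr j).
  have pj' : p' (inr j) = inl j by rewrite -wl (comm _ st) pj /w dmate_id.
  have tj : relabel t id_r = id_r by have := relabel_arc id_r (inl j); rewrite -/w wl.
  have tE i : i != j -> t (inl i) = inl i.
    by move=> ij; rewrite /t tpermD // ?(inj_eq inl_inj) 1?eq_sym.
  have IHt : base (v' \o (t * p')%g) = sg (t * p')%g * base v'.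
    apply: (IH _ _ (t * p')%g erefl).
    - rewrite -en; apply: proper_card; rewrite properE; apply/andP; split.
        apply/subsetP => i; rewrite !inE permM; have [->|ij] := eqVneq i j.
          by rewrite /t tpermL pj'.
        by rewrite tE.
      apply/subsetPn; exists j; rewrite inE ?pj ?eqxx //.
      by rewrite permM /t tpermL pj'.
    - move=> i; rewrite permM; have [->|ij] := eqVneq i j.
        by rewrite /t tpermL pj' eqxx.
      by rewrite tE.
    - by rewrite relabelM tj.
  have -> : base (v' \o p') = base ((v' \o (t * p')%g) \o t).
    by apply: eq_base => z /=; rewrite permM tpermK.
  rewrite base_flip IHt sgM sg_tperm // mulrA mulrA.
  by rewrite -expr2 sqrr_sign mul1r.
move=> st; pose col (z : T) := match z with inl i => i | inr i => i end.
have colw z : col (w z) = col z by rewrite /w dmate_id; case: z.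
have colP z : z = inl (col z) \/ z = inr (col z) by case: z; [left|right].
have s_inj : injective (fun j => col (p (inl j))).
  move=> i j E; have [h|h] : p (inl i) = p (inl j) \/ p (inl i) = p (inr j).
    rewrite -[inr j]wl (comm _ st) /w dmate_id.
    by move: E; case: (p (inl i)) => a; case: (p (inl j)) => b /= ->; [left|right|right|left].
  - by case: (perm_inj h).
  - by have := perm_inj h.
pose s := perm s_inj; pose q := (lowp s * upp s)%g.
have ql j : q (inl j) = inl (s j) by rewrite permM !luE.
have qr j : q (inr j) = inr (s j) by rewrite permM !luE.
have qw z : q (w z) = w (q z).
  by case: z => j; rewrite /w !dmate_id ?ql ?qr.
have qst : relabel q id_r = id_r by apply: relabel_eqP => z; rewrite -/w qw.
have -> : base (v \o p) = base ((v \o (q^-1 * p)%g) \o q).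
  by apply: eq_base => z /=; rewrite permM permK.
have base_q u : base (u \o q) = base u.
  rewrite /base [RHS](reindex_inj (@perm_inj _ s)) /=.
  by apply: eq_bigr => j _; rewrite ql qr.
have sgq : sg q = 1 by rewrite /sg odd_permM odd_lowp odd_upp addbb andbF.
have sgqV : sg (q^-1)%g = 1.
  by rewrite -[LHS]mulr1 -sgq -sgM mulVg /sg odd_perm1 andbF.
have qVst : relabel q^-1 id_r = id_r by rewrite -{1}qst relabelK.
rewrite base_q fixed ?relabelM ?qVst // ?sgM ?sgqV ?mul1r // => j.
have -> : j = s ((s^-1)%g j) by rewrite permKV.
rewrite -ql permM permK; move: (s^-1 j)%g => i.
rewrite ql [s i]permE; case: (colP (p (inl i))) => E.
  by rewrite -E eqxx.
by rewrite -E eqxx orbT.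
Qed.

(** Carrying the identity diagram to D amounts to numbering and orienting the
    arcs of D. *)
Definition frame D : {perm T} := odflt 1%g [pick p | relabel p id_r == D].

Lemma frameP D : relabel (frame D) id_r = D.
Proof.
rewrite /frame; case: pickP => [p /eqP //|no] /=.
have [|||p _ pE] := @conj_on r [set: T] [set: T] D id_r.
- by move=> z; rewrite !inE.
- by move=> z; rewrite inE.
- by move=> a b; rewrite inE.
by have := no p; rewrite pE eqxx.
Qed.

(** Up to sign, the product of the values of the form on the arcs; the sign
    makes this equivariant under all permutations of the nodes, twisted by the
    sign character in the skew case. *)
Definition phi D v := sg (frame D) * base (v \o frame D).

Lemma eq_phi D v v' : v =1 v' -> phi D v = phi D v'.
Proof. by move=> E; rewrite /phi (eq_base (v' := v' \o frame D)) // => z /=. Qed.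

Lemma phiE p D v : relabel p id_r = D -> phi D v = sg p * base (v \o p).
Proof.
move=> pD; pose q := frame D; pose s := (p * q^-1)%g.
have sst : relabel s id_r = id_r by rewrite relabelM pD -{1}(frameP D) relabelK.
have -> : base (v \o p) = base ((v \o q) \o s).
  by apply: eq_base => z /=; rewrite permM permKV.
rewrite (base_stab _ sst).
have -> : sg p = sg s * sg q by rewrite -sgM mulgKV.
by rewrite mulrACA sg_sq mul1r.
Qed.

Lemma phi_relabel p D v : phi (relabel p D) v = sg p * phi D (v \o p).
Proof.
rewrite (@phiE (frame D * p)%g); last by rewrite relabelM frameP.
rewrite sgM /phi (mulrC (sg (frame D))) -!mulrA; congr (_ * (_ * _)).
by apply: eq_base => z /=; rewrite permM.
Qed.

Lemma phi_id v : phi id_r v = base v.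
Proof.
rewrite (@phiE 1%g) ?relabel1 // /sg odd_perm1 andbF mul1r.
by apply: eq_base => z /=; rewrite perm1.
Qed.

(** Every arc can be split off, whatever its orientation in the frame. *)
Lemma phi_factor D x : exists psi : (T -> V) -> K,
  (forall v, phi D v = bf (v x) (v (dmate D x)) * psi v) /\
  (forall v v', (forall z, z != x -> z != dmate D x -> v z = v' z) ->
     psi v = psi v').
Proof.
pose p := frame D.
have pm z : dmate D (p z) = p (dmate id_r z) by rewrite -{1}(frameP D) dmate_relabelE.
have [j hj] : exists j, (x = p (inl j) /\ dmate D x = p (inr j)) \/
    (x = p (inr j) /\ dmate D x = p (inl j)).
  case E : ((p^-1)%g x) => [j|j]; exists j.
    have xE : x = p (inl j) by rewrite -E permKV.
    by left; split=> //; rewrite xE pm dmate_id.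
  have xE : x = p (inr j) by rewrite -E permKV.
  by right; split=> //; rewrite xE pm dmate_id.
pose rest v := \prod_(i < r | i != j) bf (v (p (inl i))) (v (p (inr i))).
have rest_ext v v' : (forall z, z != x -> z != dmate D x -> v z = v' z) ->
    rest v = rest v'.
  move=> E; apply: eq_bigr => i ij.
  have ne (z : T) : z != inl j -> z != inr j -> v (p z) = v' (p z).
    move=> zl zr; by apply: E; case: hj => -[xE wE]; rewrite ?wE ?xE (inj_eq perm_inj).
  by rewrite !ne // ?(inj_eq inl_inj) ?(inj_eq inr_inj).
have phiD v : phi D v = sg p * (bf (v (p (inl j))) (v (p (inr j))) * rest v).
  by rewrite /phi /base (bigD1 j).
case: hj => -[xE wE]; rewrite -?xE -?wE in phiD.
  exists (fun v => sg p * rest v); split=> [v|v v' E]; last by rewrite (rest_ext v v').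
  by rewrite phiD mulrCA.
exists (fun v => (-1) ^+ eps * (sg p * rest v)); split=> [v|v v' E]; last first.
  by rewrite (rest_ext v v').
by rewrite phiD bfC !mulrA; congr (_ * _); rewrite mulrC -!mulrA; congr (_ * _);
  rewrite mulrC.
Qed.

Lemma phi_neq0 D v : (forall x, bf (v x) (v (dmate D x)) != 0) -> phi D v != 0.
Proof.
move=> h; rewrite /phi mulf_neq0 ?signr_eq0 //; apply/prodf_neq0 => j _ /=.
set p := frame D; have := h (p (inl j)).
by rewrite -{1}(frameP D) dmate_relabelE dmate_id.
Qed.

Lemma phi_neq0_arc D v x : phi D v != 0 -> bf (v x) (v (dmate D x)) != 0.
Proof.
have [psi [-> _]] := phi_factor D x.
by rewrite mulf_eq0 negb_or => /andP[].
Qed.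

Definition upd v x a : T -> V := fun z => if z == x then a else v z.

Lemma phi_linear D v x c a b :
  phi D (upd v x (c *: a + b)) = c * phi D (upd v x a) + phi D (upd v x b).
Proof.
have [psi [h1 h2]] := phi_factor D x; rewrite !h1.
have ps a' : psi (upd v x a') = psi v.
  by apply: h2 => z zx _; rewrite /upd (negPf zx).
rewrite !ps /upd eqxx (negPf (dmateN D x)) bf_linear mulrDl mulrA //.
Qed.

Lemma phi_sum D v x I (s : seq I) (P : pred I) (c : I -> K) (a : I -> V) :
  phi D (upd v x (\sum_(i <- s | P i) c i *: a i))
    = \sum_(i <- s | P i) c i * phi D (upd v x (a i)).
Proof.
have h0 : phi D (upd v x 0) = 0.
  have := phi_linear D v x 1 0 0; rewrite scaler0 add0r mul1r => E.
  by apply: (addrI (phi D (upd v x 0))); rewrite addr0 -E.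
elim: s => [|i s IH]; first by rewrite !big_nil.
by rewrite !big_cons; case: (P i); rewrite // phi_linear IH.
Qed.

Lemma upd_comp v x a p : upd v x a \o p =1 upd (v \o p) ((p^-1)%g x) a.
Proof.
move=> z; rewrite /upd /=; congr (if _ then _ else _).
by rewrite -[z in RHS](permK p) (inj_eq perm_inj).
Qed.

(** By a linear relation between the vectors one of them may be replaced by a
    combination of the others, and the alternating sum vanishes if two
    arguments coincide. *)
Lemma phi_alternate D v (I : {set T}) : (2%:R != 0 :> K) -> (m < #|I|)%N ->
  \sum_(p | perm_on I p) (-1) ^+ odd_perm p * phi D (v \o p) = 0.
Proof.
move=> two mI.
pose g u := \sum_(p | perm_on I p) (-1) ^+ odd_perm p * phi D (u \o p).
have gE u u' : u =1 u' -> g u = g u'.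
  move=> E; apply: eq_bigr => p _; congr (_ * _); apply: eq_phi => z /=.
  exact: E.
have galt u x y : x \in I -> y \in I -> x != y -> u x = u y -> g u = 0.
  move=> xI yI xy uxy; pose t : {perm T} := tperm x y.
  have tI : perm_on I t.
    exact: perm_on_tperm.
  have : g u = - g u.
    rewrite {1}/g (reindex_inj (mulIg t)) /= -sumrN; apply: eq_big => p.
      apply/idP/idP => [h|h]; last exact: perm_onM.
      by rewrite -[p](mulgK t) perm_onM // tpermV.
    move=> _; rewrite odd_permM odd_tperm xy addbT signrN mulNr; congr (- (_ * _)).
    apply: eq_phi => z /=; rewrite permM; by case: tpermP => // ->; rewrite uxy.
  move/eqP; rewrite -subr_eq0 opprK -mulr2n -mulr_natl mulf_eq0 (negPf two) /=.
  by move/eqP.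
pose A := \matrix_(i < #|I|) v (enum_val i).
have /rowV0Pn[c cA c0] : kermx A != 0.
  rewrite kermx_eq0 /row_free eqn_leq negb_and -[X in _ || X]ltnNge; apply/orP; right.
  exact: leq_ltn_trans (rank_leq_col _) mI.
have [i0 ci0] : exists i, c 0 i != 0.
  by case/rV0Pn: c0 => i ci; exists i.
have cE : \sum_i c 0 i *: v (enum_val i) = 0.
  have /sub_kermxP E := cA; rewrite -[RHS]E mulmx_sum_row.
  by apply: eq_bigr => i _; rewrite rowK.
pose x0 := enum_val i0.
have vx0 : v x0 = \sum_(i | i != i0) (- (c 0 i0)^-1 * c 0 i) *: v (enum_val i).
  move: cE; rewrite (bigD1 i0) //= => /eqP; rewrite addr_eq0 => /eqP E.
  rewrite -[LHS]scale1r -(mulVf ci0) -scalerA E scalerN -scaleNr scaler_sumr.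
  by apply: eq_bigr => i _; rewrite scalerA.
transitivity (g (upd v x0 (v x0))).
  by apply: gE => z; rewrite /upd; case: eqP => [->|].
rewrite vx0 /g.
transitivity (\sum_(i | i != i0) (- (c 0 i0)^-1 * c 0 i) *
    g (upd v x0 (v (enum_val i)))).
  under eq_bigr => p _ do rewrite (eq_phi _ (upd_comp _ _ _ _)) phi_sum mulr_sumr.
  rewrite exchange_big /=; apply: eq_bigr => i _; rewrite /g mulr_sumr.
  apply: eq_bigr => p _; rewrite mulrCA; congr (_ * (_ * _)).
  by apply: eq_phi => z; rewrite upd_comp.
apply: big1 => i ii0; rewrite (galt _ x0 (enum_val i)) ?mulr0 //.
- exact: enum_valP.
- exact: enum_valP.
- by rewrite /x0 (inj_eq enum_val_inj) eq_sym.
by rewrite /upd eqxx; case: eqP.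
Qed.

Definition phix (x : brauer K r r) v := \sum_D x D * phi D v.

Lemma phix_basis D v : phix (basis_elt K D) v = phi D v.
Proof.
rewrite /phix (bigD1 D) //= big1 => [|D' neq]; rewrite basis_eltE.
  by rewrite eqxx mul1r addr0.
by rewrite (negPf neq) mul0r.
Qed.

Lemma phixD x y v : phix (x + y) v = phix x v + phix y v.
Proof. by rewrite /phix -big_split; apply: eq_bigr => D _; rewrite ffunE mulrDl. Qed.

Lemma phixZ c x v : phix (c *: x) v = c * phix x v.
Proof.
rewrite /phix mulr_sumr; apply: eq_bigr => D _.
have -> : (c *: x) D = c * x D by rewrite ffunE.
exact/esym/mulrA.
Qed.

Lemma phix_sum I (s : seq I) (P : pred I) (F : I -> brauer K r r) v :
  phix (\sum_(i <- s | P i) F i) v = \sum_(i <- s | P i) phix (F i) v.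
Proof.
apply: (big_morph (phix^~ v)) => [x y|]; first exact: phixD.
by rewrite -(scale0r (0 : brauer K r r)) phixZ mul0r.
Qed.

End Phi.

(** * Rearrangement *)

Section Rearrangement.
Variables (T : finType) (L : eqType) (h : T -> nat) (lab : T -> L).
Hypothesis h_inj : injective h.
Implicit Types (g : T -> nat) (p : {perm T}).
Local Open Scope nat_scope.

(** The rearrangement inequality within the classes of a labelling: if x is
    the lowest point that p moves, then mapping x to itself increases the sum
    and leaves fewer points that are moved. *)
Lemma rearrangement g p :
  (forall x y, lab x = lab y -> h x < h y -> g x < g y) ->
  (forall x, lab (p x) = lab x) -> p != 1%g ->
  \sum_x h x * g (p x) < \sum_x h x * g x.
Proof.
move=> hg; move en : #|[set x | p x != x]| => n.
elim/ltn_ind: n p en => n IH p en hp p1.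
have [x0 x0p] : exists x, p x != x.
  apply/existsP; rewrite -negb_forall; apply: contra p1 => /forallP hx.
  by apply/eqP/permP => x; rewrite perm1; apply/eqP.
case: (@arg_minnP _ x0 (fun x => p x != x) h x0p) => x px hmin.
have hx1 : h x < h (p x).
  rewrite ltn_neqAle (inj_eq h_inj) eq_sym px /=; apply: hmin.
  by apply: contra px => /eqP/perm_inj ->.
pose z := (p^-1)%g x; have pz : p z = x by rewrite /z permKV.
have zx : z != x by apply: contra px => /eqP zx; rewrite -{1}zx pz.
have hx2 : h x < h z.
  rewrite ltn_neqAle (inj_eq h_inj) eq_sym zx /=; apply: hmin.
  by rewrite pz eq_sym.
have labz : lab z = lab x by rewrite -(hp z) pz.
pose t := tperm x z; pose p' := (t * p)%g.
have p'E y : y != x -> y != z -> p' y = p y.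
  by move=> yx yz; rewrite permM tpermD // eq_sym.
have p'x : p' x = x by rewrite permM tpermL pz.
have p'z : p' z = p x by rewrite permM tpermR.
have lt1 : \sum_y h y * g (p y) < \sum_y h y * g (p' y).
  rewrite (bigD1 x) // [X in _ < X](bigD1 x) //=.
  rewrite (bigD1 z) // [X in _ < _ + X](bigD1 z) //=.
  rewrite p'x p'z pz !addnA (eq_bigr (fun y => h y * g (p' y))); last first.
    by move=> y /andP[yx yz]; rewrite p'E.
  by rewrite ltn_add2r; have := hg x (p x) (esym (hp x)) hx1; nia.
have [p'1|p'1] := eqVneq p' 1%g.
  by move: lt1; rewrite p'1; under [X in _ < X]eq_bigr do rewrite perm1.
apply: ltn_trans lt1 _; apply: (IH _ _ p' erefl) => //.
  rewrite -en; apply: proper_card; rewrite properE; apply/andP; split.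
    apply/subsetP => y; rewrite !inE; have [->|yx] := eqVneq y x.
      by rewrite p'x eqxx.
    have [->|yz] := eqVneq y z; first by rewrite pz => _; rewrite eq_sym.
    by rewrite p'E.
  by apply/subsetPn; exists x; rewrite inE ?px ?p'x ?eqxx.
move=> y; have [->|yx] := eqVneq y x; first by rewrite p'x.
have [->|yz] := eqVneq y z; first by rewrite p'z hp.
by rewrite p'E.
Qed.

(** Reflecting g turns a decreasing function into an increasing one. *)
Lemma rearrangement_dec g p :
  (forall x y, lab x = lab y -> h x < h y -> g y < g x) ->
  (forall x, lab (p x) = lab x) -> p != 1%g ->
  \sum_x h x * g x < \sum_x h x * g (p x).
Proof.
move=> hg hp p1; pose C := \sum_x g x.
have gC x : g x <= C by rewrite /C (bigD1 x) //= leq_addr.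
have := @rearrangement (fun x => C - g x) p _ hp p1.
have E (f : T -> T) : \sum_x h x * (C - g (f x)) + \sum_x h x * g (f x)
    = \sum_x h x * C.
  rewrite -big_split; apply: eq_bigr => x _ /=.
  by rewrite -mulnDr subnK.
have := E p; have := E id => /= E1 E2.
have lt x y : lab x = lab y -> h x < h y -> C - g x < C - g y.
  by move=> lxy hxy; have := hg x y lxy hxy; have := gC x; lia.
move/(_ lt); lia.
Qed.

End Rearrangement.

(** * Chains of arcs *)

Section Chains.
Variables (r : nat) (eps : bool).
Local Notation T := (node r r).
Implicit Types (D : diagram r r) (x y : T).
Local Open Scope nat_scope.

Definition height (x : T) : nat :=
  match x with inl i => i | inr i => r + i end.
Local Notation h := height.

Lemma height_inj : injective h.
Proof.
by case=> i [] j /= E; (have := ltn_ord i; have := ltn_ord j; try lia) => _ _;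
  congr (_ _); apply: val_inj => /=; lia.
Qed.

Lemma height_lt x : h x < r + r.
Proof. by case: x => i /=; have := ltn_ord i; lia. Qed.

(** With this choice a chain of arcs is increasing in the symmetric case and
    nested in the skew case. *)
Definition coheight x : nat := if eps then h x else r + r - h x.
Local Notation k := coheight.

Lemma coheight_inj : injective k.
Proof.
move=> x y; rewrite /coheight; case: eps => [/height_inj //|E].
by apply: height_inj; have := height_lt x; have := height_lt y; lia.
Qed.

Definition weight D := \sum_x h x * k (dmate D x).

(** In the skew case an arc counts only from its end of smaller height. *)
Definition opener D x := eps ==> (h x < h (dmate D x)).

Definition pre D x y :=
  [&& h x < h y, k (dmate D y) < k (dmate D x), opener D x & opener D y].

Lemma pre_trans D : transitive (pre D).
Proof.
move=> y x z /and4P[h1 h2 h3 _] /and4P[h4 h5 _ h6]; apply/and4P; split=> //.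
  exact: ltn_trans h1 h4.
exact: ltn_trans h5 h2.
Qed.

Lemma pre_irr D : irreflexive (pre D).
Proof. by move=> x; rewrite /pre ltnn. Qed.

(** These are the diagrams that a relation of size n rewrites in terms of
    diagrams of larger weight. *)
Definition bad_chain n D :=
  [exists s : n.-tuple T, sorted (pre D) s && all (opener D) s].

Lemma chain_cmp D (s : seq T) : sorted (pre D) s ->
  {in s &, forall x y, h x < h y -> pre D x y}.
Proof.
elim: s => // a s IH /= hs x y.
have ha : all (pre D a) s by apply: order_path_min hs; apply: pre_trans.
rewrite !inE => /orP[/eqP->|xs] /orP[/eqP->|ys].
- by rewrite ltnn.
- by move=> _; move/allP: ha => /(_ y ys).
- by move/allP: ha => /(_ x xs) /and4P[h1 _ _ _] h2; move: (ltn_trans h1 h2); rewrite ltnn.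
by apply: IH => //; apply: path_sorted hs.
Qed.

Lemma chain_uniq D (s : seq T) : sorted (pre D) s -> uniq s.
Proof. by apply: sorted_uniq; [exact: pre_trans|exact: pre_irr]. Qed.

(** There is a chain of j + 1 nodes that ends at x. *)
Fixpoint deep D j x : bool :=
  if j is j'.+1 then [exists y, pre D y x && deep D j' y] else opener D x.

Lemma deep_chain D j x : deep D j x ->
  exists s : seq T, [/\ size s = j, sorted (pre D) (rcons s x) &
    all (opener D) (rcons s x)].
Proof.
elim: j x => [|j IH] x /=; first by move=> qx; exists [::]; rewrite /= qx.
case/existsP => y /andP[yx /IH[s [sz hs qs]]].
exists (rcons s y); rewrite size_rcons sz; split=> //.
  case: s hs {sz qs} => [|a s] /=; first by rewrite yx.
  by rewrite !rcons_path last_rcons => ->.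
by rewrite all_rcons qs andbT; case/and4P: yx.
Qed.

Variable n : nat.

Lemma deep_good D x : ~~ bad_chain n.+1 D -> ~~ deep D n x.
Proof.
apply: contra => /deep_chain[s [sz hs qs]]; apply/existsP.
have sz' : size (rcons s x) == n.+1 by rewrite size_rcons sz.
by exists (Tuple sz'); rewrite /= hs.
Qed.

(** The number of nodes before x in a longest chain that ends at x, cut off at
    n. *)
Definition depth D x := \sum_(j < n) deep D j.+1 x.

Lemma depth_lt D x : ~~ bad_chain n.+1 D -> opener D x -> depth D x < n.
Proof.
move=> good qx; have := deep_good x good; rewrite /depth.
case: n => [|n'] dx; first by move: dx; rewrite /= qx.
rewrite big_ord_recr /=; move: dx => /= /negPf ->; rewrite addn0 ltnS.
rewrite -[X in _ <= X]card_ord -sum1_card leq_sum // => j _.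
by case: [exists y, _].
Qed.

Lemma depth_pre D x y : ~~ bad_chain n.+1 D -> pre D x y -> depth D x < depth D y.
Proof.
move=> good xy; have := deep_good x good; rewrite /depth.
have step j : deep D j x <= deep D j.+1 y.
  case dx: (deep D j x) => //=; rewrite lt0b.
  by apply/existsP; exists x; rewrite xy.
case: n => [|n'] dx; first by move: dx; case/and4P: xy => _ _ /= ->.
apply: leq_trans (leq_sum _ (fun (j : 'I_n'.+1) _ => step j)).
rewrite big_ord_recr [X in _ <= X]big_ord_recl /=.
move: dx => /= /negPf ->; rewrite addn0.
have -> : opener D x by case/and4P: xy.
by rewrite add1n.
Qed.

(** The depth of an arc and, in the skew case, which of its ends is meant. *)
Definition label D x : nat * bool :=
  if opener D x then (depth D x, true) else (depth D (dmate D x), false).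

Definition colabel (l : nat * bool) : nat * bool := (l.1, l.2 (+) eps).

Lemma opener_mate D x : opener D (dmate D x) = (eps ==> ~~ opener D x).
Proof.
rewrite /opener dmateK; case: eps => //=; rewrite -leqNgt [RHS]leq_eqVlt.
by rewrite (inj_eq height_inj) (negPf (dmateN D x)).
Qed.

Lemma opener_false D x : ~~ opener D x -> eps.
Proof. by rewrite /opener; case: eps. Qed.

Lemma deep_mate D j x : ~~ eps -> deep D j (dmate D x) = deep D j x.
Proof.
move=> e0; have qT y : opener D y by rewrite /opener (negPf e0).
have kE y z : (k y < k z) = (h z < h y).
  rewrite /coheight (negPf e0); have := height_lt y; have := height_lt z; lia.
have pm y z : pre D (dmate D y) (dmate D z) = pre D y z.
  by rewrite /pre !qT !andbT !dmateK !kE andbC.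
elim: j x => [|j IH] x /=; first by rewrite !qT.
apply/existsP/existsP => -[y /andP[yx dy]]; exists (dmate D y).
  by rewrite -pm dmateK yx IH.
by rewrite pm yx IH.
Qed.

Lemma label_mate D x : label D (dmate D x) = colabel (label D x).
Proof.
rewrite /label opener_mate dmateK /colabel.
have [e1|e0] := boolP eps; first by rewrite /=; case: (opener D x).
rewrite /=; have -> : opener D x by rewrite /opener (negPf e0).
by congr (_, _); apply: eq_bigr => j _; rewrite deep_mate.
Qed.

Lemma label_valid D x : ~~ bad_chain n.+1 D ->
  ((label D x).1 < n) && (eps || (label D x).2).
Proof.
move=> good; rewrite /label; case: ifP => [qx|/negbT qx] /=.
  by rewrite depth_lt // orbT.
have e1 := opener_false qx; rewrite e1 depth_lt //.
by rewrite opener_mate qx implybT.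
Qed.

Lemma label_inc D x y : ~~ bad_chain n.+1 D -> label D x = label D y ->
  h x < h y -> k (dmate D x) < k (dmate D y).
Proof.
move=> good; rewrite /label.
have main a b : opener D a -> opener D b -> depth D a = depth D b -> h a < h b ->
    k (dmate D a) < k (dmate D b).
  move=> qa qb dab hab; rewrite ltn_neqAle (inj_eq coheight_inj).
  rewrite (inj_eq (@dmate_inj _ _ D)); apply/andP; split.
    by apply: contraTneq hab => ->; rewrite ltnn.
  rewrite leqNgt; apply/negP => hk.
  have ab : pre D a b by rewrite /pre hab hk qa qb.
  by have := depth_pre good ab; rewrite dab ltnn.
case: ifP => [qx|/negbT qx]; case: ifP => [qy|/negbT qy] // [dxy] hxy.
  exact: main.
have e1 := opener_false qx; have kh z : k z = h z by rewrite /coheight e1.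
rewrite !kh ltnNge; apply/negP; rewrite leq_eqVlt (inj_eq height_inj).
rewrite (inj_eq (@dmate_inj _ _ D)) => /orP[/eqP E|hw].
  by move: hxy; rewrite E ltnn.
have := main _ _ _ _ (esym dxy) hw; rewrite !dmateK !kh !opener_mate qx qy !implybT.
by move=> /(_ isT isT) /(ltn_trans hxy); rewrite ltnn.
Qed.

(** The coheight of the partner increases with the height within each label
    class of D, so D has maximal weight among the diagrams that respect its
    labels. *)
Lemma label_weight D D' : ~~ bad_chain n.+1 D ->
  (forall x, label D (dmate D' x) = colabel (label D x)) ->
  D' = D \/ weight D' < weight D.
Proof.
move=> good hD'.
have p_inj : injective (dmate D \o dmate D').
  by apply: inj_comp; apply: dmate_inj.
pose p := perm p_inj; have pE x : p x = dmate D (dmate D' x) by rewrite permE.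
have [p1|p1] := eqVneq p 1%g.
  left; apply: diagram_ext => x; apply: (@dmate_inj _ _ D).
  by rewrite -pE p1 perm1 dmateK.
right; have := @rearrangement T _ h (label D) height_inj (fun x => k (dmate D x)) p.
have lp x : label D (p x) = label D x.
  rewrite pE label_mate hD'; case: (label D x) => a b.
  by rewrite /colabel /= -addbA addbb addbF.
move=> /(_ (fun x y => @label_inc D x y good) lp p1).
by under eq_bigr do rewrite pE dmateK.
Qed.

End Chains.

(** * Leading terms of the relations *)

Section Leading.
Variable r : nat.
Local Notation T := (node r r).
Implicit Types (D : diagram r r) (x y : T).
Local Open Scope nat_scope.
Local Notation h := (@height r).

Lemma mate_perm D D' : exists p : {perm T}, forall x, p x = dmate D (dmate D' x).
Proof.
have p_inj : injective (dmate D \o dmate D').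
  by apply: inj_comp; apply: dmate_inj.
by exists (perm p_inj) => x; rewrite permE.
Qed.

(** Rearrangement for the permutation that leads from the partners in D to the
    partners in another diagram. *)
Lemma weight_gt eps (L : eqType) (lab : T -> L) D D' :
  (forall x y, lab x = lab y -> h x < h y ->
     coheight eps (dmate D y) < coheight eps (dmate D x)) ->
  (forall x, lab (dmate D (dmate D' x)) = lab x) -> D' != D ->
  weight eps D < weight eps D'.
Proof.
move=> hD hD' neq; have [p pE] := mate_perm D D'.
have := @rearrangement_dec T _ h lab (@height_inj r)
  (fun x => coheight eps (dmate D x)) p hD.
under [X in (_ -> _ -> _ < X) -> _]eq_bigr do rewrite pE dmateK.
apply=> [x|]; first by rewrite pE.
apply: contraNneq neq => p1; apply/eqP/diagram_ext => x.
by apply: (@dmate_inj _ _ D); rewrite -pE p1 perm1 dmateK.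
Qed.

(** The ends of the arcs of a chain form two disjoint sets, on both of which
    the diagram is increasing; every permutation of one of the sets therefore
    increases the weight. *)
Lemma chain_orth n D : bad_chain false n D ->
  exists I : {set T}, [/\ #|I| = n, forall x, x \in I -> dmate D x \notin I &
    forall p, perm_on I p -> p != 1%g ->
      weight false D < weight false (relabel p D)].
Proof.
case/existsP => s /andP[hs _]; pose I := [set x in (s : seq T)].
have cmp x y : x \in I -> y \in I -> h x < h y -> h (dmate D x) < h (dmate D y).
  rewrite !inE => xs ys hxy; case/and4P: (chain_cmp hs xs ys hxy) => _ + _ _.
  rewrite /coheight; have := height_lt (dmate D x); lia.
have dis x : x \in I -> dmate D x \notin I.
  move=> xI; apply/negP => wI; case: (ltngtP (h x) (h (dmate D x))) => hx.
  - by have := cmp _ _ xI wI hx; rewrite dmateK ltnNge ltnW.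
  - by have := cmp _ _ wI xI hx; rewrite dmateK ltnNge ltnW.
  by move/height_inj: hx => /esym/eqP; rewrite (negPf (dmateN D x)).
exists I; split=> //.
  by rewrite cardsE (card_uniqP (chain_uniq hs)) size_tuple.
move=> p pI p1; pose J := [set x | dmate D x \in I].
have pIE x : (p x \in I) = (x \in I) := perm_closed x pI.
have pV : perm_on I (p^-1)%g by apply: perm_onV.
have pVE x : ((p^-1)%g x \in I) = (x \in I) := perm_closed x pV.
have pout x : x \notin I -> (p^-1)%g x = x := out_perm pV.
have pout' x : x \notin I -> p x = x := out_perm pI.
pose lab x : T + bool := if x \in I then inr true else
  if x \in J then inr false else inl x.
apply: (@weight_gt false _ lab) => [x y|x|].
- rewrite /lab /coheight => lxy hxy.
  suff : h (dmate D x) < h (dmate D y).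
    by have := height_lt (dmate D x); have := height_lt (dmate D y); lia.
  move: lxy; case: ifP => xI.
    by case: ifP => yI; [move=> _; apply: cmp|case: ifP].
  case: ifP => xJ; case: ifP => // yI; case: ifP => // yJ.
    move=> _; rewrite /J inE in xJ; rewrite /J inE in yJ.
    rewrite ltnNge leq_eqVlt (inj_eq (@height_inj r)) (inj_eq (@dmate_inj _ _ D)).
    apply/negP => /orP[/eqP yx|hw]; first by move: hxy; rewrite yx ltnn.
    by have := cmp _ _ yJ xJ hw; rewrite !dmateK => /(ltn_trans hxy); rewrite ltnn.
  by case=> xy; move: hxy; rewrite xy ltnn.
- rewrite dmate_relabel; have [xI|xI] := boolP (x \in I).
    have wI : dmate D ((p^-1)%g x) \notin I by apply: dis; rewrite pVE.
    by rewrite pout' // dmateK /lab pVE xI.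
  rewrite (pout x xI).
  have [wI|wI] := boolP (dmate D x \in I).
    have pwI : p (dmate D x) \in I by rewrite pIE.
    by rewrite /lab (negPf xI) (negPf (dis _ pwI)) ![_ \in J]inE dmateK pwI wI.
  by rewrite pout' // dmateK.
apply: contraNneq p1 => E; apply/eqP/permP => x; rewrite perm1.
have [xI|xI] := boolP (x \in I); last exact: pout'.
apply: (@dmate_inj _ _ D); rewrite -{1}E dmate_relabelE pout' //.
exact: dis.
Qed.

(** The arcs of a chain are nested, so the partners decrease on the set of all
    their ends, and every other matching of these ends has larger weight. *)
Lemma chain_symp n D : bad_chain true n D ->
  exists S : {set T}, [/\ #|S| = n.*2, stable S D &
    forall D', agree S D D' -> D' != D -> weight true D < weight true D'].
Proof.
case/existsP => s /andP[hs qs]; pose I := [set x in (s : seq T)].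
have cmp x y : x \in I -> y \in I -> h x < h y -> h (dmate D y) < h (dmate D x).
  by rewrite !inE => xs ys hxy; case/and4P: (chain_cmp hs xs ys hxy).
have op x : x \in I -> h x < h (dmate D x).
  by rewrite inE => xs; move/allP: qs => /(_ x xs).
have sep x y : x \in I -> y \in I -> h x < h (dmate D y).
  move=> xI yI; case: (ltngtP (h x) (h y)) => hxy.
  - exact: ltn_trans hxy (op y yI).
  - exact: ltn_trans (op x xI) (cmp _ _ yI xI hxy).
  - by move/height_inj: hxy => ->; apply: op.
pose J := [set x | dmate D x \in I].
have JE : J = dmate D @: I.
  apply/setP => x; rewrite inE; apply/idP/imsetP => [wI|[y yI ->]].
    by exists (dmate D x); rewrite ?dmateK.
  by rewrite dmateK.
have st : stable (I :|: J) D.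
  by move=> x; rewrite !inE dmateK orbC.
exists (I :|: J); split=> //.
  rewrite cardsU JE (card_imset _ (@dmate_inj _ _ D)) -JE.
  have -> : I :&: J = set0.
    apply/setP => x; rewrite !inE; apply/negP => /andP[xI wI].
    have := op x; rewrite inE => /(_ xI); rewrite ltnNge ltnW //.
    by have := op (dmate D x); rewrite inE dmateK => ->.
  rewrite cards0 subn0 -addnn cardsE (card_uniqP (chain_uniq hs)).
  by rewrite size_tuple.
move=> D' ag; apply: (@weight_gt true _ (fun x => if x \in I :|: J then None else Some x)).
  move=> x y; rewrite /coheight; case: ifP; case: ifP => //; last first.
    by move=> _ _ [->]; rewrite ltnn.
  rewrite ![_ \in _ :|: _]inE => yS xS _ hxy.
  case/orP: xS => xI; case/orP: yS => yI.
  - exact: cmp.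
  - rewrite inE in yI; have := sep _ _ yI xI.
    exact.
  - rewrite inE in xI; have := sep _ _ yI xI; rewrite dmateK.
    by move/(ltn_trans hxy); rewrite ltnn.
  rewrite /J inE in xI; rewrite /J inE in yI; rewrite ltnNge leq_eqVlt (inj_eq (@height_inj r)).
  rewrite (inj_eq (@dmate_inj _ _ D)); apply/negP => /orP[/eqP xy|hw].
    by move: hxy; rewrite xy ltnn.
  have := cmp _ _ xI yI hw; rewrite !dmateK => /(ltn_trans hxy).
  by rewrite ltnn.
move=> x; have [xS|xS] := boolP (x \in I :|: J).
  by rewrite st (stable_agree st ag) xS.
by rewrite ag // dmateK (negPf xS).
Qed.

End Leading.

(** * Straightening *)

Section Straightening.
Variables (K : fieldType) (r m : nat) (eps : bool).
Local Notation V := 'rV[K]_m.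
Local Notation T := (node r r).
Variable bf : V -> V -> K.
Implicit Types (D : diagram r r) (x : brauer K r r).
Variables (delta : K) (J : brauer K r r -> Prop).
Hypothesis hJ : two_sided_ideal delta J.
Hypothesis J_phi : forall x, J x -> forall v, phix eps bf x v = 0.
Variable (good : pred (diagram r r)).
Local Notation wt := (@weight r eps).
Hypothesis rel : forall D, ~~ good D -> exists x,
  [/\ J x, x D != 0 & forall D', D' != D -> x D' != 0 -> (wt D < wt D')%N].
Hypothesis word : forall D, good D -> exists2 v : T -> V, phi eps bf D v != 0 &
  forall D', phi eps bf D' v != 0 -> D' = D \/ (wt D' < wt D)%N.

(** Congruent to a combination of good diagrams. *)
Definition reducible x := exists2 g : brauer K r r,
  (forall D, g D != 0 -> good D) & J (x - g).

Lemma reducibleD x y : reducible x -> reducible y -> reducible (x + y).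
Proof.
move=> [g hg Jg] [g' hg' Jg']; exists (g + g').
  move=> D; rewrite ffunE; have [->|/hg //] := eqVneq (g D) 0.
  by rewrite add0r; apply: hg'.
by rewrite opprD addrACA; apply: idealD hJ _ _ Jg Jg'.
Qed.

Lemma reducibleZ c x : reducible x -> reducible (c *: x).
Proof.
move=> [g hg Jg]; exists (c *: g).
  move=> D; rewrite ffunE; have [->|/hg //] := eqVneq (g D) 0.
  by rewrite scaler0 eqxx.
by rewrite -scalerBr; apply: idealZ hJ _ _ Jg.
Qed.

Lemma reducible_J x : J x -> reducible x.
Proof.
move=> Jx; exists 0; last by rewrite subr0.
by move=> D; rewrite ffunE eqxx.
Qed.

(** A relation with leading term D replaces D by diagrams of larger weight. *)
Lemma reducible_basis D : reducible (basis_elt K D).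
Proof.
move en : #|[set D' : diagram r r | (wt D < wt D')%N]| => n.
elim/ltn_ind: n D en => n IH D en.
have [gD|bD] := boolP (good D).
  exists (basis_elt K D); last by rewrite subrr; apply: ideal0 hJ.
  by move=> D'; rewrite basis_eltE; have [->|] := eqVneq D' D; rewrite ?eqxx.
have [x [Jx xD hx]] := rel bD.
have -> : basis_elt K D = (x D)^-1 *:
    (x + \sum_(D' | D' != D) (- x D') *: basis_elt K D').
  rewrite {2}[x]brauer_sum (bigD1 D) //= -addrA -big_split /= big1 => [|D' _].
    by rewrite addr0 scalerA mulVf // scale1r.
  by rewrite scaleNr subrr.
apply/reducibleZ/reducibleD; first exact: reducible_J.
apply: (big_ind reducible); [|exact: reducibleD|].
  exact/reducible_J/(ideal0 hJ).
move=> D' neq; have [->|xD'] := eqVneq (x D') 0.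
  by rewrite oppr0 scale0r; apply/reducible_J/(ideal0 hJ).
apply/reducibleZ/(IH _ _ D' erefl); rewrite -en; apply: proper_card.
have lt := hx _ neq xD'; rewrite properE; apply/andP; split.
  by apply/subsetP => D''; rewrite !inE; apply: ltn_trans.
by apply/subsetPn; exists D'; rewrite inE ?ltnn.
Qed.

(** At the word of a diagram of least weight in g no other term of g survives. *)
Lemma good_independent (g : brauer K r r) :
  (forall D, g D != 0 -> good D) -> (forall v, phix eps bf g v = 0) -> g = 0.
Proof.
move=> hg g0; apply/eqP; apply: contraT => gn0.
have [D0 gD0] := ffun_neq gn0; rewrite ffunE in gD0.
case: (@arg_minnP _ D0 (fun D => g D != 0) wt gD0) => D gD hmin.
have [v vD hv] := word (hg D gD).
have := g0 v; rewrite /phix (bigD1 D) //= big1 => [|D' neq].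
  by rewrite addr0 => /eqP; rewrite mulf_eq0 (negPf gD) (negPf vD).
have [->|gD'] := eqVneq (g D') 0; first by rewrite mul0r.
have [->|pD'] := eqVneq (phi eps bf D' v) 0; first by rewrite mulr0.
case: (hv _ pD') => [E|]; first by rewrite E eqxx in neq.
by rewrite ltnNge hmin.
Qed.

(** Modulo the relations every element is a combination of good diagrams, and
    these are linearly independent as functions. *)
Lemma straightening x : (forall v, phix eps bf x v = 0) -> J x.
Proof.
have [g hg Jg] : reducible x.
  apply: (brauer_ind (P := reducible)).
  - exact/reducible_J/(ideal0 hJ).
  - exact: reducibleD.
  by move=> c D; apply/reducibleZ/reducible_basis.
move=> x0; suff g0 : g = 0 by move: Jg; rewrite g0 subr0.
apply: good_independent => // v.
have := J_phi Jg v; rewrite phixD x0 add0r -scaleN1r phixZ mulN1r.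
by move/eqP; rewrite oppr_eq0 => /eqP.
Qed.

End Straightening.

(** * Generation by adjacent transpositions *)

(** A transposition is conjugate by an adjacent one to a transposition of
    closer points. *)
Lemma perm_adjacent_ind r (P : 'S_r -> Prop) :
  P 1%g -> (forall s t, P s -> P t -> P (s * t)%g) ->
  (forall i j : 'I_r, j = i.+1 :> nat -> P (tperm i j)) -> forall s, P s.
Proof.
move=> P1 PM Padj.
have Plt n (i j : 'I_r) : j = (i + n.+1)%N :> nat -> P (tperm i j).
  elim: n i j => [|n IH] i j hij; first by apply: Padj; rewrite hij addn1.
  have hj : (i + n.+1 < r)%N by have := ltn_ord j; lia.
  pose j' := Ordinal hj; have j'j : j = j'.+1 :> nat by rewrite hij /= addnS.
  have -> : tperm i j = (tperm j' j * (tperm i j' * tperm j' j))%g.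
    transitivity (tperm i j' ^ tperm j' j)%g; last by rewrite /conjg tpermV.
    by rewrite tpermJ tpermL tpermD //; apply/eqP => /(congr1 val) /=; lia.
  by apply: (PM _ _ (Padj _ _ j'j)); apply: PM (Padj _ _ j'j); apply: IH.
have Pt i j : P (tperm i j).
  case: (ltngtP i j) => [ij|ij|/val_inj ->].
  - by apply: (Plt (j - i.+1)%N); lia.
  - by rewrite tpermC; apply: (Plt (i - j.+1)%N); lia.
  - by rewrite tperm1.
move=> s; have [ts -> _] := prod_tpermP s.
by elim: ts => [|t ts IH]; rewrite ?big_nil // big_cons; apply: PM.
Qed.

(** * The representation in terms of arcs *)

Section Representation.
Variables (K : fieldType) (r m : nat) (eps : bool).
Local Notation V := 'rV[K]_m.
Local Notation T := (node r r).
Variable form : {hermitian V for eps & idfun}.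
Definition bform (x y : V) : K := form x y.
Local Notation bf := bform.
Variables (b b' : m.-tuple V).
Variable F : {linear brauer K r r -> 'End(tensor_space K m r)}.
Hypothesis b_basis : basis_of fullv b.
Hypothesis b_dual : forall i j, bform (tnth b' i) (tnth b j) = (i == j)%:R.
Hypothesis hF : brauer_rep form b b' F.
Local Notation delta := ((-1) ^+ eps * m%:R : K).
Local Notation "[b D ]" := (basis_elt K D) (at level 0, format "[b  D ]").
Implicit Types (D : diagram r r) (s : 'S_r) (v u : 'I_r -> V).

Lemma bform_linear c x y z : bf (c *: x + y) z = c * bf x z + bf y z.
Proof. by rewrite /bform linearPl. Qed.

Lemma bformC x y : bf x y = (-1) ^+ eps * bf y x.
Proof. by rewrite /bform hermC. Qed.

Lemma bform_suml I (l : seq I) (P : pred I) (c : I -> K) (a : I -> V) z :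
  bf (\sum_(i <- l | P i) c i *: a i) z = \sum_(i <- l | P i) c i * bf (a i) z.
Proof.
have h0 : bf 0 z = 0.
  by have := bform_linear (-1) z z z; rewrite scaleN1r addNr mulN1r addNr.
elim: l => [|i l IH]; first by rewrite !big_nil.
by rewrite !big_cons; case: (P i); rewrite // bform_linear IH.
Qed.

Lemma basis_expand x : x = \sum_a bf (tnth b' a) x *: tnth b a.
Proof.
have E : x = \sum_a coord b a x *: tnth b a.
  rewrite {1}(coord_basis b_basis (memvf x)).
  by apply: eq_bigr => a _; rewrite (tnth_nth 0).
rewrite {1}E; apply: eq_bigr => a _; congr (_ *: _).
rewrite bformC [x in RHS]E bform_suml mulr_sumr (bigD1 a) //= big1 => [|c ca].
  by rewrite addr0 bformC b_dual eqxx mulr1 mulrCA -expr2 sqrr_sign mulr1.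
by rewrite bformC b_dual eq_sym (negPf ca) !mulr0.
Qed.

Lemma pure_ext v v' : v =1 v' -> pure_tensor v = pure_tensor v'.
Proof.
by move=> E; apply/ffunP => w; rewrite !ffunE; apply: eq_bigr => i _; rewrite E.
Qed.

(** The form extended to the tensor power, with a pure tensor in the second
    argument. *)
Definition bil (t : tensor_space K m r) u : K :=
  \sum_(w : {ffun 'I_r -> 'I_m}) t w * \prod_(j < r) bf (delta_mx 0 (w j)) (u j).

Lemma bil_linear c (t t' : tensor_space K m r) u : bil (c *: t + t') u = c * bil t u + bil t' u.
Proof.
rewrite /bil mulr_sumr -big_split; apply: eq_bigr => w _ /=.
have -> : (c *: t + t') w = c * t w + t' w by rewrite !ffunE.
by rewrite mulrDl mulrA.
Qed.

Lemma bilZ c t u : bil (c *: t) u = c * bil t u.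
Proof.
have h0 : bil 0 u = 0 by apply: big1 => w _; rewrite ffunE mul0r.
by have := bil_linear c t 0 u; rewrite h0 !addr0.
Qed.

Lemma bil_sum I (l : seq I) (P : pred I) (t : I -> tensor_space K m r) u :
  bil (\sum_(i <- l | P i) t i) u = \sum_(i <- l | P i) bil (t i) u.
Proof.
apply: (big_morph (bil^~ u)) => [x y|].
  by have := bil_linear 1 x y u; rewrite scale1r mul1r.
by apply: big1 => w _; rewrite ffunE mul0r.
Qed.

Lemma bil_pure v u : bil (pure_tensor v) u = \prod_(j < r) bf (v j) (u j).
Proof.
have E j : bf (v j) (u j) = \sum_k v j 0 k * bf (delta_mx 0 k) (u j).
  by rewrite {1}(row_sum_delta (v j)) bform_suml.
under [RHS]eq_bigr do rewrite E.
rewrite bigA_distr_bigA; apply: eq_bigr => w _ /=.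
by rewrite ffunE -big_split.
Qed.

Lemma pure_delta (w w' : {ffun 'I_r -> 'I_m}) :
  pure_tensor (fun i => delta_mx 0 (w i) : V) w' = (w == w')%:R.
Proof.
rewrite ffunE; have [<-|neq] := eqVneq w w'.
  by apply: big1 => i _; rewrite mxE !eqxx.
have [i wi] := ffun_neq neq.
by rewrite (bigD1 i) //= mxE eqxx eq_sym (negPf wi) mul0r.
Qed.

Lemma tensor_expand (t : tensor_space K m r) :
  t = \sum_w t w *: pure_tensor (fun i => delta_mx 0 (w i) : V).
Proof.
apply/ffunP => w; rewrite sum_ffunE (bigD1 w) //= big1 => [|w' neq].
  have -> : (t w *: pure_tensor (fun i => delta_mx 0 (w i) : V)) w
    = t w * pure_tensor (fun i => delta_mx 0 (w i) : V) w by rewrite ffunE.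
  by rewrite pure_delta eqxx mulr1 addr0.
have -> : (t w' *: pure_tensor (fun i => delta_mx 0 (w' i) : V)) w
  = t w' * pure_tensor (fun i => delta_mx 0 (w' i) : V) w by rewrite ffunE.
by rewrite pure_delta (negPf neq) mulr0.
Qed.

(** The bases b and b' exhibit the matrix of the form as invertible. *)
Lemma dual_standard : exists g : 'I_m -> V,
  forall k l, bf (delta_mx 0 k) (g l) = (k == l)%:R.
Proof.
pose M := \matrix_(a < m, k < m) bf (tnth b' a) (delta_mx 0 k).
have : M^T *m (\matrix_(a < m) tnth b a) = 1%:M.
  apply/row_matrixP => k; rewrite row_mul mulmx_sum_row row1.
  rewrite [RHS]basis_expand; apply: eq_bigr => a _.
  by rewrite rowK !mxE.
case/mulmx1_unit; rewrite unitmx_tr => Mu _.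
exists (fun l => \sum_a ((-1) ^+ eps * invmx M l a) *: tnth b' a) => k l.
rewrite bformC bform_suml.
have <- : (invmx M *m M) l k = (k == l)%:R by rewrite mulVmx // mxE eq_sym.
rewrite mxE mulr_sumr; apply: eq_bigr => a _.
by rewrite !mxE !mulrA -expr2 sqrr_sign mul1r.
Qed.

Lemma bil_sep t : (forall u, bil t u = 0) -> t = 0.
Proof.
move=> t0; have [g hg] := dual_standard.
apply/ffunP => w; rewrite ffunE; have := t0 (fun j => g (w j)).
rewrite /bil (bigD1 w) //= big1 => [|j _]; last by rewrite hg eqxx.
rewrite mulr1 big1 ?addr0 // => w' neq.
have [i wi] := ffun_neq neq.
by rewrite (bigD1 i) //= hg (negPf wi) mul0r mulr0.
Qed.

Lemma F_sep x : (forall v u, bil (F x (pure_tensor v)) u = 0) -> F x = 0.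
Proof.
move=> h; apply/lfunP => t; rewrite zero_lfunE (tensor_expand t) linear_sum.
by apply: big1 => w _; rewrite linearZ /= (bil_sep (h _)) scaler0.
Qed.

Lemma F_comp x y t : F (brauer_comp delta x y) t = F x (F y t).
Proof. by rewrite (brauer_repM hF) comp_lfunE. Qed.

Lemma perm_diagM s (t : 'S_r) : brauer_comp delta [b perm_diag s] [b perm_diag t]
  = [b perm_diag (t * s)%g].
Proof. by rewrite comp_perm_l !perm_diagE -relabelM uppM. Qed.

Lemma F_permM s1 s2 t : F [b perm_diag (s1 * s2)%g] t
  = F [b perm_diag s2] (F [b perm_diag s1] t).
Proof.
exact: etrans (congr1 (fun x => F x t) (esym (perm_diagM s2 s1))) (F_comp _ _ _).
Qed.

Lemma F_perm s v : F [b perm_diag s] (pure_tensor v)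
  = (-1) ^+ (eps && odd_perm s) *: pure_tensor (fun a => v ((s^-1)%g a)).
Proof.
move: s v; apply: perm_adjacent_ind => [v|s1 s2 h1 h2 v|i j ji v].
- rewrite -[[b perm_diag 1]]/(brauer_id K r) (brauer_rep1 hF).
  rewrite id_lfunE odd_perm1 andbF scale1r; apply: pure_ext => a.
  by rewrite invg1 perm1.
- apply: etrans (F_permM _ _ _) _.
  apply: etrans (congr1 (fun x => F [b perm_diag s2] x) (h1 v)) _.
  apply: etrans (linearZ _ _) _; apply: etrans (congr1 (fun x => _ *: x) (h2 _)) _.
  rewrite scalerA; congr (_ *: _).
    by rewrite odd_permM; case: (eps); rewrite //= ?mulr1 // signr_addb.
  by apply: pure_ext => a; rewrite invMg permM.
rewrite -(brauer_sE K ji) (brauer_rep_s hF _ ji).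
have ij : i != j by apply/eqP => /(congr1 val) /=; lia.
by rewrite odd_tperm ij andbT; congr (_ *: _); apply: pure_ext => a; rewrite tpermV.
Qed.

Lemma e_diag_conj s i j :
  relabel (lowp s * upp s)%g (e_diag i j) = e_diag (s i) (s j).
Proof.
set p := (lowp s * upp s)%g.
have pid : relabel p (id_diag r) = id_diag r.
  by apply: relabel_eqP => -[] a; rewrite /p !permM !dmate_id !luE.
rewrite /e_diag -relabelM.
have -> : (tperm (inl j) (inr i) * p = p * (tperm (inl (s j)) (inr (s i))))%g.
  have -> : tperm (inl (s j)) (inr (s i)) = (tperm (inl j) (inr i) ^ p)%g.
    by rewrite tpermJ /p !permM !luE.
  by rewrite /conjg mulKVg.
by rewrite relabelM pid.
Qed.

(** All elements e_xy are conjugate under the permutations. *)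
Lemma F_e (x y : 'I_r) v : x != y -> F [b e_diag x y] (pure_tensor v)
  = bf (v x) (v y) *: \sum_a pure_tensor (fun c =>
      if c == x then tnth b a else if c == y then tnth b' a else v c).
Proof.
move=> xy; have r2 : (1 < r)%N.
  rewrite ltnNge; apply: contra xy => r1.
  by apply/eqP/ord_inj; case: (x) (y) => [a ha] [c hc] /=; lia.
pose i : 'I_r := Ordinal (ltnW r2); pose j : 'I_r := Ordinal r2.
have ij : i != j by [].
pose s1 := tperm i x; pose s := (s1 * tperm (s1 j) y)%g.
have si : s i = x.
  rewrite permM /s1 tpermL tpermD // 1?eq_sym //.
  by rewrite -{1}(tpermL i x) (inj_eq perm_inj).
have sj : s j = y by rewrite permM tpermL.
have eE : brauer_comp delta [b perm_diag s]
    (brauer_comp delta [b e_diag i j] [b perm_diag s^-1]) = [b e_diag x y].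
  apply: etrans (congr1 (brauer_comp delta _) (comp_perm_r delta _ _)) _.
  apply: etrans (comp_perm_l delta _ _) _; congr (basis_elt K _).
  by rewrite -relabelM invgK e_diag_conj si sj.
apply: etrans (congr1 (fun z => F z _) (esym eE)) _.
apply: etrans (F_comp _ _ _) _; apply: etrans (congr1 (fun z => F _ z) (F_comp _ _ _)) _.
have F1 := F_perm s^-1 v; have F2 := fun v' => brauer_rep_e hF (i := i) (j := j) v' erefl.
have eij := brauer_eE delta (i := i) (j := j) erefl.
apply: etrans (congr1 (fun z => F _ (F _ z)) F1) _.
apply: etrans (congr1 (fun z => F _ z) (linearZ _ _)) _.
apply: etrans (linearZ _ _) _.
apply: etrans (congr1 (fun z => _ *: F _ (F z _)) (esym eij)) _.
apply: etrans (congr1 (fun z => _ *: F _ z) (F2 _)) _.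
apply: etrans (congr1 (fun z => _ *: z) (linearZ _ _)) _.
apply: etrans (congr1 (fun z => _ *: (_ *: z)) (linear_sum _ _ _ _)) _.
rewrite scalerA mulrC -scalerA invgK si sj; congr (_ *: _).
rewrite scaler_sumr; apply: eq_bigr => a _.
apply: etrans (congr1 (fun z => _ *: z) (F_perm _ _)) _.
rewrite scalerA odd_permV -expr2 sqrr_sign scale1r.
apply: pure_ext => c; rewrite -[c in RHS](permKV s).
by rewrite -si -sj !(inj_eq perm_inj) permKV.
Qed.

Definition pr v u : T -> V := fun z => match z with inl i => v i | inr j => u j end.

(** Matrix coefficients with respect to the form. By induction on the number
    of arcs in the lower row: such an arc is split off as a right factor e_xy,
    whose image inserts the sum of the tensors of dual basis vectors, and this
    sum is expanded by basis_expand. *)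
Lemma F_phi D v u : bil (F [b D] (pure_tensor v)) u = phi eps bf D (pr v u).
Proof.
move en : #|[set i | side (dmate D (inl i))]| => n.
elim/ltn_ind: n D v en => n IH D v en.
have [c0|[x]] := set_0Vmem [set i | side (dmate D (inl i))].
  have [s ->] : exists s, D = perm_diag s.
    by apply: no_cap_perm => i; move/setP/(_ i): c0; rewrite !inE => ->.
  rewrite F_perm bilZ bil_pure perm_diagE (phi_relabel bformC) phi_id.
    rewrite /sg odd_upp; congr (_ * _).
    rewrite /base (reindex_inj (@perm_inj _ s)) /=.
    by apply: eq_bigr => j _; rewrite permK !luE.
  exact: bformC.
rewrite inE; case Dx: (dmate D (inl x)) => [y|//] _.
have Dy : dmate D (inl y) = inl x by rewrite -Dx dmateK.
have xy : x != y.
  by apply/eqP => E; have := dmateN D (inl x); rewrite Dx E eqxx.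
have [||[u0|u0] // _ []] := @opposite_node r set0 D (inl x); rewrite ?inE ?Dx //.
move=> Du; pose t := tperm (inl x : T) (inr u0).
pose D' := relabel t D.
have DE : brauer_comp delta [b D'] [b e_diag x y] = [b D] := comp_e_r delta u0 Dx.
apply: etrans (congr1 (fun z => bil (F z _) u) (esym DE)) _.
apply: etrans (congr1 (bil^~ u) (F_comp _ _ _)) _.
apply: etrans (congr1 (fun z => bil (F _ z) u) (F_e _ xy)) _.
apply: etrans (congr1 (bil^~ u) (linearZ _ _)) _; rewrite bilZ.
apply: etrans (congr1 (fun z => _ * bil z u) (linear_sum _ _ _ _)) _.
rewrite bil_sum.
have D'E z : dmate D' z = t (dmate D (t z)) by rewrite dmate_relabel tpermV.
have txy : t (inl y) = inl y by rewrite /t tpermD // (inj_eq inl_inj).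
have cap i : side (dmate D' (inl i)) -> side (dmate D (inl i)) && (i != x).
  rewrite D'E; have [->|ix] := eqVneq i x.
    have w1 : dmate D (inr u0) != inl x by apply/eqP => E; move: Du; rewrite E.
    by rewrite /t tpermL tpermD 1?eq_sym ?dmateN // Du.
  rewrite andbT [t (inl i)]tpermD ?(inj_eq inl_inj) 1?eq_sym // /t.
  case: tpermP => [->//|E|//].
  by move: Du; rewrite -E dmateK.
pose va a c := if c == x then tnth b a else if c == y then tnth b' a else v c.
transitivity (bf (v x) (v y) * \sum_a (-1) ^+ eps * phi eps bf D (pr (va a) u \o t)).
  congr (_ * _); apply: eq_bigr => a _.
  apply: etrans (IH _ _ D' (va a) erefl) _.
    rewrite -en; apply: proper_card; rewrite properE; apply/andP; split.
      by apply/subsetP => i; rewrite !inE => /cap /andP[].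
    apply/subsetPn; exists x; rewrite inE ?Dx //.
    by apply/negP => /cap; rewrite eqxx andbF.
  by rewrite (phi_relabel bformC) sg_tperm.
rewrite mulr_sumr.
have [psi [h1 h2]] := phi_factor bformC D (inl x).
pose vv := pr v u.
transitivity (\sum_a ((-1) ^+ eps * bf (u u0) (tnth b' a)) *
    phi eps bf D (upd vv (inr u0) (tnth b a))).
  apply: eq_bigr => a _; rewrite mulrCA -mulrA; congr (_ * _).
  rewrite !h1 Dx /= [t (inl x)]tpermL txy /= /va [(y == x)]eq_sym (negPf xy) eqxx.
  rewrite /upd /= mulrCA; congr (_ * (_ * _)).
  apply: h2 => z zx; rewrite Dx => zy; rewrite /= /t.
  case: tpermP => [E|->|_ zu] /=.
  - by rewrite E eqxx in zx.
  - by rewrite !eqxx.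
  case: z zx zy zu => i //=; rewrite ?(inj_eq inl_inj) ?(inj_eq inr_inj).
    by move=> /negPf -> /negPf ->.
  by move=> _ _ iu; case: eqP => // E; case: iu; rewrite E.
have E : \sum_a ((-1) ^+ eps * bf (u u0) (tnth b' a)) *: tnth b a = u u0.
  rewrite [RHS]basis_expand; apply: eq_bigr => a _.
  by rewrite (bformC (u u0)) mulrA -expr2 sqrr_sign mul1r.
rewrite -(phi_sum bform_linear bformC) E; apply: eq_phi => z.
by rewrite /upd; case: eqP => [->|].
Qed.

Lemma F_phix x v u : bil (F x (pure_tensor v)) u = phix eps bf x (pr v u).
Proof.
rewrite {1}[x]brauer_sum linear_sum sum_lfunE bil_sum; apply: eq_bigr => D _.
by rewrite linearZ /= scale_lfunE bilZ F_phi.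
Qed.

Lemma F_eq0 x : F x = 0 <-> forall z, phix eps bf x z = 0.
Proof.
split=> [Fx z|h]; last by apply: F_sep => v u; rewrite F_phix.
have := F_phix x (fun i => z (inl i)) (fun i => z (inr i)).
rewrite Fx zero_lfunE => E.
transitivity (phix eps bf x (pr (fun i => z (inl i)) (fun i => z (inr i)))).
  by apply: eq_bigr => D _; congr (_ * _); apply: eq_phi => -[].
by rewrite -E; apply: big1 => w _; rewrite ffunE mul0r.
Qed.

End Representation.

(** * Adapted vectors *)

Section Adapted.
Variables (K : fieldType) (m : nat).
Local Notation V := 'rV[K]_m.
Variable bf : V -> V -> K.
Hypothesis bf_linear : forall c x y z, bf (c *: x + y) z = c * bf x z + bf y z.
Hypothesis bf_nondeg : forall x, x != 0 -> exists y, bf x y != 0.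
Hypothesis two : 2%:R != 0 :> K.

Lemma bfDl x y z : bf (x + y) z = bf x z + bf y z.
Proof. by rewrite -[x]scale1r bf_linear mul1r scale1r. Qed.

Lemma bf0l z : bf 0 z = 0.
Proof. by apply: (addrI (bf 0 z)); rewrite -bfDl !addr0. Qed.

Lemma bfZl c x z : bf (c *: x) z = c * bf x z.
Proof. by rewrite -[c *: x]addr0 bf_linear bf0l addr0. Qed.

Lemma bf_suml n (c : nat -> K) (a : nat -> V) z :
  bf (\sum_(i < n) c i *: a i) z = \sum_(i < n) c i * bf (a i) z.
Proof.
elim: n => [|n IH]; first by rewrite !big_ord0 bf0l.
by rewrite !big_ord_recr /= bfDl IH bfZl.
Qed.

Lemma outside_span (s : seq V) : (size s < m)%N -> exists x, x \notin <<s>>%VS.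
Proof.
move=> sm; have [/subvP h|/subvPn[x _ xs]] := boolP (fullv <= <<s>>)%VS.
  have /dimvS : (fullv <= <<s>>)%VS by apply/subvP.
  rewrite dimvf /dim /= mul1n => /leq_trans/(_ (dim_span s)).
  by rewrite leqNgt sm.
by exists x.
Qed.

Section Symmetric.
Hypothesis bfC : forall x y, bf x y = bf y x.

(** Gram-Schmidt: the vectors P x orthogonal to those already found are not
    all isotropic, by polarization. *)
Lemma orthogonal_vectors k : (k <= m)%N -> exists f : nat -> V,
  forall i j, (i < k)%N -> (j < k)%N -> (bf (f i) (f j) != 0) = (i == j).
Proof.
elim: k => [|k IH] km; first by exists (fun=> 0).
have [f hf] := IH (ltnW km).
have f0 i : (i < k)%N -> bf (f i) (f i) != 0 by move=> ik; rewrite hf ?eqxx.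
have f1 i j : (i < k)%N -> (j < k)%N -> i != j -> bf (f i) (f j) = 0.
  by move=> ik jk /negPf ij; apply/eqP/negbFE; rewrite hf.
pose c x i := - (bf x (f i) / bf (f i) (f i)).
pose P x := x + \sum_(i < k) c x i *: f i.
have Pf x j : (j < k)%N -> bf (P x) (f j) = 0.
  move=> jk; rewrite bfDl bf_suml (bigD1 (Ordinal jk)) //= big1 => [|i ij].
    by rewrite addr0 /c mulNr divfK ?f0 // subrr.
  by rewrite f1 ?mulr0 //; apply: contra ij => /eqP ij; apply/eqP/val_inj.
have PD x y : P (x + y) = P x + P y.
  rewrite /P addrACA -big_split; congr (_ + _); apply: eq_bigr => i _ /=.
  by rewrite -scalerDl /c bfDl mulrDl opprD.
have PP x y : bf (P x) (P y) = bf (P x) y.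
  move: (P x) (Pf x) => z zf; rewrite [LHS]bfC [RHS]bfC /P bfDl bf_suml.
  by rewrite big1 ?addr0 // => i _; rewrite bfC zf ?mulr0.
have [x xP] : exists x, bf (P x) (P x) != 0.
  have [x xs] : exists x, x \notin <<mkseq f k>>%VS.
    by apply: outside_span; rewrite size_mkseq.
  have Px : P x != 0.
    apply: contra xs; rewrite /P addr_eq0 => /eqP ->.
    rewrite memvN; apply: memv_suml => i _; apply/memvZ/memv_span.
    by apply/mapP; exists (i : nat); rewrite // mem_iota /=.
  have [y xy] := bf_nondeg Px.
  have [x0|] := eqVneq (bf (P x) (P x)) 0; last by exists x.
  have [y0|] := eqVneq (bf (P y) (P y)) 0; last by exists y.
  exists (x + y); rewrite PD (bfDl (P x)) !(bfC _ (P x + P y)) !(bfDl (P x)) x0 y0 add0r addr0.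
  rewrite (bfC (P y)) -mulr2n -mulr_natl mulf_neq0 //.
  by rewrite PP.
exists (fun i => if i == k then P x else f i) => i j.
rewrite !ltnS leq_eqVlt => /orP[/eqP ->|ik]; rewrite leq_eqVlt => /orP[/eqP ->|jk].
- by rewrite eqxx xP.
- by rewrite eqxx (ltn_eqF jk) Pf // eqxx gtn_eqF.
- by rewrite eqxx (ltn_eqF ik) bfC Pf // eqxx.
by rewrite (ltn_eqF ik) (ltn_eqF jk) hf.
Qed.

End Symmetric.

Section Skew.
Hypothesis bfC : forall x y, bf x y = - bf y x.

Lemma bf_alt x : bf x x = 0.
Proof.
apply/eqP; have : 2%:R * bf x x == 0 by rewrite mulr_natl mulr2n {1}bfC addNr.
by rewrite mulf_eq0 (negPf two).
Qed.

(** The orthogonal complement of the pairs already found is again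
    nondegenerate and contains another pair. *)
Lemma hyperbolic_vectors k : (k.*2 <= m)%N -> exists e f : nat -> V,
  forall i j, (i < k)%N -> (j < k)%N ->
    [/\ bf (e i) (f j) = (i == j)%:R, bf (e i) (e j) = 0 & bf (f i) (f j) = 0].
Proof.
elim: k => [|k IH] km; first by exists (fun=> 0), (fun=> 0).
have [|e [f hef]] := IH; first by lia.
have ef i j : (i < k)%N -> (j < k)%N -> bf (e i) (f j) = (i == j)%:R.
  by move=> ik jk; case: (hef i j ik jk).
have ee i j : (i < k)%N -> (j < k)%N -> bf (e i) (e j) = 0.
  by move=> ik jk; case: (hef i j ik jk).
have ff i j : (i < k)%N -> (j < k)%N -> bf (f i) (f j) = 0.
  by move=> ik jk; case: (hef i j ik jk).
pose ce x i := - bf x (f i); pose cf x i := bf x (e i).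
pose P x := x + (\sum_(i < k) ce x i *: e i + \sum_(i < k) cf x i *: f i).
have sum1 (c : nat -> K) (a : nat -> V) j z : (j < k)%N ->
    (forall i, (i < k)%N -> bf (a i) z = (i == j)%:R) ->
    \sum_(i < k) c i * bf (a i) z = c j.
  move=> jk hz; rewrite (bigD1 (Ordinal jk)) //= big1 => [|i ij].
    by rewrite addr0 hz // eqxx mulr1.
  rewrite hz //; case: eqP => [E|]; last by rewrite mulr0.
  by case/negP: ij; apply/eqP/val_inj.
have Pf x j : (j < k)%N -> bf (P x) (f j) = 0.
  move=> jk; rewrite !bfDl !bf_suml [X in _ + (_ + X)]big1 => [|i _].
    rewrite addr0 (sum1 (ce x) e j) ?subrr // => i ik.
    exact: ef.
  by rewrite ff ?mulr0.
have Pe x j : (j < k)%N -> bf (P x) (e j) = 0.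
  move=> jk; rewrite !bfDl !bf_suml [X in _ + (X + _)]big1 => [|i _].
    rewrite add0r.
    under [X in _ + X]eq_bigr => i _ do rewrite bfC mulrN -mulNr.
    rewrite (eq_bigr (fun i : 'I_k => - cf x i * (i == j :> nat)%:R)) => [|i _].
      rewrite (bigD1 (Ordinal jk)) //= big1 => [|i ij].
        by rewrite addr0 eqxx mulr1 subrr.
      case: eqP => [E|]; last by rewrite mulr0.
      by case/negP: ij; apply/eqP/val_inj.
    by rewrite ef // eq_sym.
  by rewrite ee ?mulr0.
have PP x y : bf (P x) (P y) = bf (P x) y.
  move: (P x) (Pf x) (Pe x) => z zf ze; rewrite [LHS]bfC [RHS]bfC /P !bfDl !bf_suml.
  rewrite !big1 ?addr0 // => i _; first by rewrite bfC zf ?oppr0 ?mulr0.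
  by rewrite bfC ze ?oppr0 ?mulr0.
have [x xs] : exists x, x \notin <<mkseq e k ++ mkseq f k>>%VS.
  by apply: outside_span; rewrite size_cat !size_mkseq; lia.
have Px : P x != 0.
  apply: contra xs; rewrite /P addr_eq0 => /eqP ->.
  rewrite memvN; apply: memvD; apply: memv_suml => i _; apply/memvZ/memv_span;
    rewrite mem_cat; apply/orP; [left|right]; apply/mapP; exists (i : nat) => //;
    by rewrite mem_iota /=.
have [y xy] := bf_nondeg Px.
pose d := (bf (P x) y)^-1.
exists (fun i => if i == k then P x else e i), (fun i => if i == k then d *: P y else f i).
have dl z w : bf z (d *: w) = d * bf z w by rewrite bfC bfZl bfC mulrN opprK.
move=> i j; rewrite !ltnS leq_eqVlt => /orP[/eqP ->|ik]; rewrite leq_eqVlt => /orP[/eqP ->|jk].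
- by rewrite !eqxx dl PP mulVf // bf_alt dl bfZl bf_alt !mulr0.
- by rewrite !eqxx (ltn_eqF jk) Pf // Pe // bfZl Pf // mulr0 gtn_eqF.
- rewrite !eqxx (ltn_eqF ik) !dl bfC Pe // bfC Pe // bfC Pf //.
  by rewrite !oppr0 mulr0.
by rewrite (ltn_eqF ik) (ltn_eqF jk); apply: hef.
Qed.

End Skew.
End Adapted.

(** * Isomorphisms of coloured involutions *)

Section Isomorphism.
Variables (T C : finType) (col col' : T -> C) (w w' : T -> T).
Hypotheses (wK : involutive w) (wK' : involutive w').

Definition ntype (cl : T -> C) (f : T -> T) (x : T) := (cl x, cl (f x), f x == x).

Hypothesis count : forall c,
  #|[set x | ntype col w x == c]| = #|[set x | ntype col' w' x == c]|.

(** A partial isomorphism on a set stable under the involution extends to one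
    more orbit, since the numbers of nodes of each type agree. *)
Lemma coloured_iso : exists p : {perm T}, forall x,
  col' (p x) = col x /\ w' (p x) = p (w x).
Proof.
have tyw f cl x : involutive f ->
    ntype cl f (f x) = ((ntype cl f x).1.2, (ntype cl f x).1.1, (ntype cl f x).2).
  by move=> fK; rewrite /ntype fK eq_sym.
pose G (p : {perm T}) := [set x | (ntype col' w' (p x) == ntype col w x) && (w' (p x) == p (w x))].
suff [p pG] : exists p, G p = setT.
  exists p => x; have : x \in G p by rewrite pG inE.
  by rewrite inE => /andP[/eqP[-> _ _] /eqP ->].
suff ext p : G p != setT -> exists p', (#|G p| < #|G p'|)%N.
  suff all (p : {perm T}) : exists p', G p' = setT by exact: (all 1%g).
  move en : (#|T| - #|G p|)%N => n; elim/ltn_ind: n p en => n IH p en.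
  have [E|/ext[p' lt]] := eqVneq (G p) setT; first by exists p.
  apply: (IH (#|T| - #|G p'|)%N _ p' erefl).
  have h q : (#|G q| <= #|T|)%N by apply: max_card.
  by rewrite -en; have := h p'; move: lt; lia.
move=> pG; have [x _ xG] : exists2 x, x \in setT & x \notin G p.
  by apply/subsetPn; rewrite subTset.
have Gw y : (w y \in G p) = (y \in G p).
  rewrite !inE wK tyw //; case: (w' (p y) =P p (w y)) => [E|E].
    rewrite -E wK' eqxx tyw // !andbT.
    case: (ntype col' w' (p y)) => [[a b] c]; case: (ntype col w y) => [[a' b'] c'] /=.
    apply/eqP/eqP => -[-> -> ->] //.
  rewrite andbF; apply/negbTE; rewrite negb_and orbC; apply/orP; left.
  by apply/eqP => E'; case: E; rewrite -E' wK'.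
have [y ytype yG] : exists2 y, ntype col' w' y = ntype col w x & y \notin p @: G p.
  pose c := ntype col w x.
  have [y|no] := pickP (fun y => (ntype col' w' y == c) && (y \notin p @: G p)).
    by case/andP=> /eqP h1 h2; exists y.
  have sub : [set y | ntype col' w' y == c] \subset p @: (G p :&: [set z | ntype col w z == c]).
    apply/subsetP => y; rewrite inE => yc; have := no y; rewrite yc /= => /negbFE.
    case/imsetP => z zG yz; apply/imsetP; exists z => //; rewrite inE zG inE.
    by move: zG yc; rewrite inE yz => /andP[/eqP -> _].
  have := subset_leq_card sub; rewrite (card_imset _ (@perm_inj _ p)) -count.
  rewrite leqNgt => /negP[]; apply: proper_card; rewrite properE subsetIr /=.
  by apply/subsetPn; exists x; rewrite !inE ?eqxx //; move: xG; rewrite inE => /negPf ->.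
pose t1 := tperm (p x) y; pose t2 := tperm (t1 (p (w x))) (w' y).
pose p' := (p * t1 * t2)%g.
have t1x : t1 (p x) = y by rewrite /t1 tpermL.
have fx : (w' y == y) = (w x == x) by case: ytype.
have p'x : p' x = y.
  rewrite !permM tpermL; have [wx|wx] := boolP (w x == x).
    by rewrite /t2 (eqP wx) tpermL; move: fx; rewrite wx => /eqP ->; rewrite tpermL.
  rewrite tpermD //; last by rewrite fx.
  by rewrite -[X in _ != X]t1x !(inj_eq perm_inj).
have p'w : p' (w x) = w' y by rewrite !permM tpermL.
have p'g g : g \in G p -> p' g = p g.
  move=> gG; have gx : p x != p g.
    by rewrite (inj_eq perm_inj); apply: contraNneq xG => ->.
  have gy : y != p g by apply: contraNneq yG => ->; apply: imset_f.
  rewrite !permM (tpermD gx gy) tpermD //.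
    have t1g : t1 (p g) = p g by rewrite /t1 tpermD.
    rewrite -[X in _ != X]t1g !(inj_eq perm_inj).
    by apply: contraNneq xG => E; rewrite -Gw E.
  apply: contraNneq yG => E; have -> : y = p (w g).
    by move: gG; rewrite inE => /andP[_ /eqP <-]; rewrite -E wK'.
  by apply: imset_f; rewrite Gw.
exists p'; apply: proper_card; rewrite properE; apply/andP; split.
  apply/subsetP => g gG; rewrite inE p'g // p'g ?Gw //.
  by move: gG; rewrite inE.
apply/subsetPn; exists x => //.
by rewrite inE p'x p'w ytype !eqxx.
Qed.

End Isomorphism.

(** * Transport by permutations that preserve the rows *)

Section Transport.
Variable r : nat.
Local Notation T := (node r r).
Implicit Types (D : diagram r r) (p q : {perm T}) (S I J : {set T}) (x y : T).

Lemma card_side_out S D b : stable S D -> through S D ->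
  #|[set z in ~: S | side z == b]| = #|[set z in ~: S | side z == ~~ b]|.
Proof.
move=> st th; rewrite -(card_imset _ (@dmate_inj _ _ D)); apply: eq_card => z.
rewrite !inE; apply/imsetP/andP => [[y]|[zS /eqP zb]].
  rewrite !inE => /andP[yS /eqP <-] ->; by rewrite st (negPf yS) th // eqxx.
exists (dmate D z); last by rewrite dmateK.
by rewrite !inE st zS th // zb negbK eqxx.
Qed.

Definition rowpart S b := [set z in S | side z == b].

Lemma card_rowpart_out S b : (#|rowpart S b| + #|rowpart (~: S) b|)%N = r.
Proof.
rewrite -[RHS](card_node_side r b) -[RHS](cardsID S); congr (_ + _)%N;
  by apply: eq_card => z; rewrite !inE andbC.
Qed.

Lemma card_rowpart S : (#|rowpart S true| + #|rowpart S false|)%N = #|S|.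
Proof.
rewrite -[RHS](cardsID [set z | side z == true]); congr (_ + _)%N.
  by apply: eq_card => z; rewrite !inE.
by apply: eq_card => z; rewrite !inE andbC; case: (side z).
Qed.

(** The arcs outside S match the lower with the upper nodes there. *)
Lemma card_rowpart_through S D b : stable S D -> through S D ->
  #|rowpart S b| = #|rowpart S (~~ b)|.
Proof.
move=> st th; have := card_rowpart_out S b; have := card_rowpart_out S (~~ b).
by have := card_side_out b st th; rewrite /rowpart; lia.
Qed.

(** An isomorphism of coloured involutions, with the row and the membership in
    the two sets as colours, and with the involutions cut off on these sets.
    The numbers of nodes of each type agree because the arcs outside join the
    two rows. *)
Lemma transport I J I0 J0 D D0 :
  I :&: J = set0 -> I0 :&: J0 = set0 ->
  stable (I :|: J) D -> stable (I0 :|: J0) D0 ->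
  through (I :|: J) D -> through (I0 :|: J0) D0 ->
  (forall b, #|rowpart I0 b| = #|rowpart I b|) ->
  (forall b, #|rowpart J0 b| = #|rowpart J b|) ->
  exists p, [/\ forall z, side (p z) = side z, p @: I0 = I, p @: J0 = J &
    agree (I :|: J) D (relabel p D0)].
Proof.
move=> IJ IJ0 st st0 th th0 cI cJ.
pose col (A B : {set T}) z := (side z, z \in A, z \in B).
pose cut S C z := if z \in S then z else dmate C z.
have cutK S C : stable S C -> involutive (cut S C).
  move=> h z; rewrite /cut; case zS: (z \in S); first by rewrite zS.
  by rewrite h zS dmateK.
have cnt c : #|[set z | col I0 J0 z == c]| = #|[set z | col I J z == c]|.
  case: c => [[b i] j]; pose c1 (A B : {set T}) := #|[set z | col A B z == (b, i, j)]|.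
  rewrite -/(c1 I0 J0) -/(c1 I J).
  have dis (A B : {set T}) z : A :&: B = set0 -> z \in A -> (z \in B) = false.
    by move=> AB zA; move/setP/(_ z): AB; rewrite !inE zA.
  have hA (A B : {set T}) : A :&: B = set0 -> i && ~~ j -> c1 A B = #|rowpart A b|.
    move=> AB /andP[i1 j0]; apply: eq_card => z; rewrite !inE /col !xpair_eqE i1 (negPf j0) eqb_id.
    by case zA: (z \in A); rewrite ?andbF // (dis _ _ _ AB zA) eqxx !andbT.
  have hB (A B : {set T}) : A :&: B = set0 -> ~~ i && j -> c1 A B = #|rowpart B b|.
    move=> AB /andP[i0 j1]; apply: eq_card => z; rewrite !inE /col !xpair_eqE j1 (negPf i0) eqb_id.
    case zA: (z \in A); first by rewrite (dis _ _ _ AB zA) andbF.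
    by rewrite eqxx andbT andbC.
  have hAB (A B : {set T}) : A :&: B = set0 -> i && j -> c1 A B = 0%N.
    move=> AB /andP[i1 j1]; apply/eqP; rewrite cards_eq0; apply/eqP/setP => z.
    rewrite !inE /col !xpair_eqE i1 j1 !eqb_id.
    by case zA: (z \in A); rewrite ?andbF // (dis _ _ _ AB zA) andbF.
  have h0 (A B : {set T}) : A :&: B = set0 -> ~~ i && ~~ j ->
      (c1 A B + (#|rowpart A b| + #|rowpart B b|))%N = r.
    move=> AB /andP[i0 j0]; rewrite -[RHS](card_node_side r b).
    rewrite -cardsUI -[X in (_ + X)%N]addn0 -[RHS](cardsID (A :|: B)).
    have -> : rowpart A b :&: rowpart B b = set0.
      apply/setP => z; rewrite !inE; case zA: (z \in A) => //=.
      by rewrite (dis _ _ _ AB zA) andbF.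
    rewrite cards0 !addn0 addnC; congr (_ + _)%N; apply: eq_card => z; rewrite !inE.
      by rewrite andb_orr ![(side z == b) && _]andbC.
    rewrite /col !xpair_eqE (negPf i0) (negPf j0) !eqbF_neg negb_or.
    by rewrite -andbA andbC.
  have [i1|i0] := boolP i; have [j1|j0] := boolP j.
  - by rewrite !hAB ?i1 ?j1.
  - by rewrite !hA ?i1 ?j0.
  - by rewrite !hB ?i0 ?j1.
  have := h0 _ _ IJ; have := h0 _ _ IJ0; rewrite i0 j0 => /(_ isT) e1 /(_ isT) e2.
  by move: e1 e2; rewrite cI cJ; lia.
have cnt2 c : #|[set z | ntype (col I0 J0) (cut (I0 :|: J0) D0) z == c]|
    = #|[set z | ntype (col I J) (cut (I :|: J) D) z == c]|.
  case: c => [[c d] f].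
  have main (A B : {set T}) C : stable (A :|: B) C -> through (A :|: B) C ->
      #|[set z | ntype (col A B) (cut (A :|: B) C) z == (c, d, f)]|
    = if (if c.1.2 || c.2 then (d == c) && f else (d == (~~ c.1.1, false, false)) && ~~ f)
      then #|[set z | col A B z == c]| else 0%N.
    move=> h1 h2; rewrite -[RHS]/(if _ then _ else _).
    set tst := if c.1.2 || c.2 then _ else _.
    have E z : (ntype (col A B) (cut (A :|: B) C) z == (c, d, f)) = tst && (col A B z == c).
      rewrite /ntype /cut 2!xpair_eqE.
      have [zc|] := eqVneq (col A B z) c; last by rewrite andbF.
      rewrite andbT /= /tst -zc /col /= -in_setU; case: ifP => zS.
        by rewrite eqxx eq_sym; congr (_ && _); case: (f).
      have wS : (dmate C z \in A :|: B) = false by rewrite h1.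
      rewrite (negPf (dmateN C z)) h2 ?zS //.
      move: wS zS; rewrite !inE => /norP[/negPf -> /negPf ->] _.
      by rewrite eq_sym; congr (_ && _); case: (f).
    case: tst E => E; first by apply: eq_card => z; rewrite !inE E.
    by apply/eqP; rewrite cards_eq0; apply/eqP/setP => z; rewrite !inE E.
  by rewrite !main // cnt.
have [p hp] := coloured_iso (cutK _ _ st0) (cutK _ _ st) cnt2.
have hc z : [/\ side (p z) = side z, (p z \in I) = (z \in I0) & (p z \in J) = (z \in J0)].
  by have [[-> -> ->] _] := hp z.
exists p; split=> [z|||z].
- by have [] := hc z.
- by apply/setP => z; rewrite perm_on_imset -{2}[z](permKV p); have [_ ->] := hc ((p^-1)%g z).
- by apply/setP => z; rewrite perm_on_imset -{2}[z](permKV p); have [_ _ ->] := hc ((p^-1)%g z).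
move=> zS; rewrite -[z](permKV p) dmate_relabelE.
move: zS; rewrite -{1}[z](permKV p); move: ((p^-1)%g z) => y yS.
have yS0 : (y \in I0 :|: J0) = false.
  by apply/negbTE; move: yS; rewrite !inE; have [_ -> ->] := hc y.
by have [_] := hp y; rewrite /cut (negPf yS) yS0 => ->.
Qed.

End Transport.

(** * Minors and Pfaffians *)

Section Relations.
Variables (K : fieldType) (r : nat).
Local Notation T := (node r r).
Local Notation "[b D ]" := (basis_elt K D) (at level 0, format "[b  D ]").
Implicit Types (D : diagram r r) (p q : {perm T}) (S I : {set T}) (x y : T).

Lemma scaled_basisE c D D' : (c *: [b D]) D' = c * (D' == D)%:R.
Proof. by rewrite -basis_eltE ffunE. Qed.

(** In the symmetric case, and if the arcs that meet I have only one end in I,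
    phi turns this into the determinant of the Gram matrix between I and the
    partners of I, times the values on the other arcs. *)
Definition minor I D : brauer K r r :=
  \sum_(p | perm_on I p) (-1) ^+ odd_perm p *: [b relabel p D].

Definition agreeb S D D' := [forall z, (z \notin S) ==> (dmate D' z == dmate D z)].

Lemma agreeP S D D' : reflect (agree S D D') (agreeb S D D').
Proof.
apply: (iffP forall_inP) => h z zS; first exact/eqP/h.
by apply/eqP/h.
Qed.

(** In the skew case phi turns this into the Pfaffian of the Gram matrix on S,
    times the values on the arcs outside S; the signs of the Pfaffian are part
    of phi. *)
Definition pfaffian S D : brauer K r r := \sum_(D' | agreeb S D D') [b D'].

Lemma perm_on_conj I p q : perm_on (q @: I) (p ^ q)%g = perm_on I p.
Proof.
apply/subsetP/subsetP => h x; rewrite !inE => px.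
  have := h (q x); rewrite inE permJ (inj_eq perm_inj) mem_imset => [->//|].
  exact: perm_inj.
rewrite perm_on_imset; apply: h; rewrite inE -(inj_eq (@perm_inj _ q)).
by move: px; rewrite -{1 2}[x](permKV q) permJ.
Qed.

Lemma nact_minor q I D : nact q (minor I D) = minor (q @: I) (relabel q D).
Proof.
rewrite nact_sum [RHS](reindex_inj (conjg_inj q)) /=.
apply: eq_big => [p|p _]; first by rewrite perm_on_conj.
rewrite nactZ nact_basis odd_permJ; congr (_ *: basis_elt K _).
by rewrite -!relabelM conjgE !mulgA mulgV mul1g.
Qed.

Lemma minor_relabel q I D : perm_on I q ->
  minor I (relabel q D) = (-1) ^+ odd_perm q *: minor I D.
Proof.
move=> qI; rewrite /minor [in RHS](reindex_inj (mulgI q)) scaler_sumr.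
apply: eq_big => [p|p _].
  apply/idP/idP => h; first exact: perm_onM.
  by rewrite -[p](mulKg q); apply: perm_onM => //; apply: perm_onV.
rewrite scalerA odd_permM signr_addb mulrA -expr2 sqrr_sign mul1r.
by rewrite relabelM.
Qed.

Lemma nact_minor_on q I D : perm_on I q ->
  nact q (minor I D) = (-1) ^+ odd_perm q *: minor I D.
Proof. by move=> qI; rewrite nact_minor im_perm_on // minor_relabel. Qed.

Lemma minor_support I D D' : minor I D D' != 0 ->
  exists2 p, perm_on I p & D' = relabel p D.
Proof.
move=> h; have [p /andP[pI /eqP ->]|no] := pickP (fun p =>
  perm_on I p && (D' == relabel p D)); first by exists p.
case/eqP: h; rewrite sum_ffunE big1 // => p pI; rewrite scaled_basisE.
by have := no p; rewrite pI /= => ->; rewrite mulr0.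
Qed.

Lemma minor_lead I D : (forall p, perm_on I p -> relabel p D = D -> p = 1%g) ->
  minor I D D = 1.
Proof.
move=> h; rewrite sum_ffunE (bigD1 1%g) ?perm_on1 //= big1 => [|p /andP[pI p1]].
  by rewrite scaled_basisE relabel1 eqxx odd_perm1 mulr1 addr0.
rewrite scaled_basisE; case: eqP => [E|]; last by rewrite mulr0.
by case/eqP: p1; apply: h.
Qed.

Lemma agree_perm_on I S D p : (forall x, x \in I -> x \in S /\ dmate D x \in S) ->
  perm_on I p -> agree S D (relabel p D).
Proof.
move=> hI pI z zS; have pz : (p^-1)%g z = z.
  apply: (out_perm (perm_onV pI)); apply: contra zS => /hI[] //.
rewrite dmate_relabel pz (out_perm pI) //; apply: contra zS => /hI[_].
by rewrite dmateK.
Qed.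

Lemma local_minor I S D : (forall x, x \in I -> x \in S /\ dmate D x \in S) ->
  local (minor I D) S D.
Proof.
by move=> hI D' /minor_support[p pI ->]; apply: agree_perm_on hI pI.
Qed.

Lemma local_pfaffian S D : local (pfaffian S D) S D.
Proof.
move=> D'; rewrite /pfaffian sum_ffunE.
have [/agreeP //|no] := boolP (agreeb S D D').
rewrite big1 ?eqxx // => D'' ag; rewrite basis_eltE; case: eqP => // E.
by move: no; rewrite E ag.
Qed.

Lemma pfaffianE S D D' : pfaffian S D D' = (agreeb S D D')%:R.
Proof.
rewrite /pfaffian sum_ffunE; have [ag|no] := boolP (agreeb S D D').
  rewrite (bigD1 D') //= big1 => [|D'' /andP[_ neq]].
    by rewrite basis_eltE eqxx addr0.
  by rewrite basis_eltE eq_sym (negPf neq).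
rewrite big1 // => D'' ag; rewrite basis_eltE; case: eqP => // E.
by move: no; rewrite E ag.
Qed.

Lemma nact_pfaffian q S D : nact q (pfaffian S D) = pfaffian (q @: S) (relabel q D).
Proof.
apply/ffunP => D'; rewrite nactE [LHS]pfaffianE [RHS]pfaffianE.
suff -> : agreeb S D (relabel q^-1 D') = agreeb (q @: S) (relabel q D) D' by [].
apply/agreeP/agreeP => ag.
  by rewrite -(relabelKV q D'); apply: agree_relabel.
have := agree_relabel q^-1 ag; rewrite relabelK; congr agree.
by rewrite -imset_comp -[RHS]imset_id; apply: eq_imset => x /=; rewrite permK.
Qed.

Lemma eq_pfaffian S D D' : agree S D D' -> pfaffian S D = pfaffian S D'.
Proof.
move=> ag; apply/ffunP => D''; rewrite [LHS]pfaffianE [RHS]pfaffianE.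
congr (_%:R); congr nat_of_bool; apply/agreeP/agreeP; apply: agree_trans => //.
exact: agree_sym.
Qed.

Lemma dvd_fact_neq0 (a n k : nat) : a \in [pchar K] -> (n < a)%N ->
  (k %| n`!)%N -> k%:R != 0 :> K.
Proof.
move=> aK na kn; rewrite -(dvdn_pcharf aK); apply/negP => ak.
have pa : prime a := pcharf_prime aK.
have : (a %| n`!)%N := dvdn_trans ak kn.
elim: n na {kn} => [|n IH] na; first by rewrite dvdn1 => /eqP a1; rewrite a1 in pa.
rewrite factS Euclid_dvdM // => /orP[/(dvdn_leq (ltn0Sn n))|]; last by apply: IH; lia.
by rewrite leqNgt na.
Qed.

Lemma fiber_count S I D D' : stable S D ->
  {in S &, forall a b, a \notin I -> b \notin I -> a = b} ->
  agree S D D' ->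
  #|[set p | perm_on I p & relabel p D == D']|
    = #|[set p | perm_on I p & relabel p D == D]|.
Proof.
move=> st hI ag; have [q qI qD] := conj_on st ag hI.
rewrite -(card_imset _ (mulIg q)); apply: eq_card => p; rewrite !inE.
apply/imsetP/andP => [[p']|[pI /eqP pD]].
  rewrite inE => /andP[pI /eqP pD] ->; rewrite perm_onM // relabelM pD qD.
  by rewrite eqxx.
exists (p * q^-1)%g; last by rewrite mulgKV.
rewrite inE perm_onM ?perm_onV //= relabelM pD -qD relabelK eqxx //.
Qed.

(** By Lagrange in the symmetric group of I. *)
Lemma stab_dvd (I : {set T}) (Q : pred {perm T}) :
  Q 1%g -> (forall p q, Q p -> Q q -> Q (p * q)%g) ->
  (#|[set p | perm_on I p & Q p]| %| (#|I|)`!)%N.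
Proof.
move=> Q1 QM.
have gH : group_set [set p | perm_on I p & Q p].
  apply/group_setP; split=> [|p q]; first by rewrite inE perm_on1 Q1.
  by rewrite !inE => /andP[pI Qp] /andP[qI Qq]; rewrite perm_onM ?QM.
have gG : group_set [set p : {perm T} | perm_on I p].
  apply/group_setP; split=> [|p q]; first by rewrite inE perm_on1.
  by rewrite !inE => pI qI; rewrite perm_onM.
have -> : (#|I|)`! = #|Group gG|.
  by rewrite -card_perm; apply: eq_card => p; rewrite inE.
rewrite -[#|_|]/#|Group gH|; apply: cardSg.
by apply/subsetP => p; rewrite !inE => /andP[].
Qed.

(** The symmetric group of all nodes of S but one is transitive on the
    diagrams that differ from D only on S. *)
Lemma sum_relabel_pfaffian S I D : stable S D -> I \subset S ->
  {in S &, forall a b, a \notin I -> b \notin I -> a = b} ->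
  \sum_(p | perm_on I p) [b relabel p D]
    = #|[set p | perm_on I p & relabel p D == D]|%:R *: pfaffian S D.
Proof.
move=> st IS hI; rewrite scaler_sumr.
rewrite (partition_big (fun p => relabel p D) (agreeb S D)) /= => [|p pI].
  apply: eq_bigr => D' /agreeP ag; rewrite -(fiber_count st hI ag).
  rewrite scaler_nat -sumr_const; apply: eq_big => [p|p /andP[_ /eqP -> //]].
  by rewrite inE.
apply/agreeP; apply: agree_perm_on pI => x xI.
by rewrite st (subsetP IS).
Qed.

Variables (m : nat).
Local Notation V := 'rV[K]_m.
Variable bf : V -> V -> K.
Hypothesis bf_linear : forall c (x y z : V), bf (c *: x + y) z = c * bf x z + bf y z.
Hypothesis two : 2%:R != 0 :> K.

Lemma phix_minor I D v : (forall x y : V, bf x y = (-1) ^+ false * bf y x) ->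
  (m < #|I|)%N -> phix false bf (minor I D) v = 0.
Proof.
move=> bfC mI; rewrite phix_sum -[RHS](phi_alternate bf_linear bfC D v two mI).
apply: eq_bigr => p _; rewrite phixZ phix_basis (phi_relabel bfC).
by rewrite /sg mul1r.
Qed.

(** In the skew case the signs of the alternating sum are absorbed by phi. *)
Lemma phix_pfaffian S D v : (forall x y : V, bf x y = (-1) ^+ true * bf y x) ->
  stable S D -> #|S| = m.+2 ->
  (forall k, (k %| (m.+1)`!)%N -> k%:R != 0 :> K) -> phix true bf (pfaffian S D) v = 0.
Proof.
move=> bfC st cS fact0.
have [z zS] : exists z, z \in S by apply/set0Pn; rewrite -card_gt0 cS.
pose I := S :\ z; have cI : #|I| = m.+1 by have := cardsD1 z S; rewrite zS cS /I; lia.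
have hI : {in S &, forall a b, a \notin I -> b \notin I -> a = b}.
  by move=> a b aS bS; rewrite !inE aS bS !andbT !negbK => /eqP -> /eqP ->.
have E := sum_relabel_pfaffian st (subsetDl S [set z]) hI.
set c := #|_|%:R in E; have c0 : c != 0.
  apply: fact0; rewrite -cI; apply: stab_dvd; first by rewrite relabel1.
  by move=> p q /eqP pD /eqP qD; rewrite relabelM pD qD.
apply: (mulfI c0); rewrite -phixZ -E phix_sum mulr0.
rewrite -[RHS](phi_alternate bf_linear bfC D v two (I := I)); last by rewrite cI.
apply: eq_bigr => p _; rewrite phix_basis (phi_relabel bfC).
by rewrite /sg.
Qed.

End Relations.

(** * The skew case: one Pfaffian generates all *)

Section SkewIdeal.
Variables (K : fieldType) (r : nat) (delta : K) (J : brauer K r r -> Prop).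
Hypothesis hJ : two_sided_ideal delta J.
Implicit Types (S : {set node r r}) (D : diagram r r).

(** Once the other arcs join the two rows, S has equally many nodes in each
    row, and any two such configurations are conjugate under the permutations
    of the rows. *)
Lemma pfaffian_ideal S0 D0 S D : stable S0 D0 -> through S0 D0 ->
  J (pfaffian K S0 D0) -> stable S D -> #|S| = #|S0| -> J (pfaffian K S D).
Proof.
move=> st0 th0 J0 st cS.
have [p [th pJ]] := reduce hJ st (@local_pfaffian K r S D).
apply: pJ; rewrite nact_pfaffian; move: th (stable_relabel p st).
have cS' : #|p @: S| = #|S0| by rewrite card_imset //; apply: perm_inj.
move: (p @: S) (relabel p D) cS' => S1 D1 cS1 th1 st1.
have card_half (A : {set node r r}) C b : stable A C -> through A C ->
    (#|rowpart A b|).*2 = #|A|.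
  move=> st2 th2; have := card_rowpart A; have := card_rowpart_through b st2 th2.
  by case: b => /=; lia.
have [||||||||q [qs qS _ ag]] := @transport r S1 set0 S0 set0 D1 D0.
- by rewrite setI0.
- by rewrite setI0.
- by rewrite setU0.
- by rewrite setU0.
- by rewrite setU0.
- by rewrite setU0.
- by move=> b; have := card_half S1 D1 b st1 th1; have := card_half S0 D0 b st0 th0; lia.
- by move=> b; congr #|pred_of_set _|; apply/setP => z; rewrite !inE.
rewrite setU0 in ag; rewrite (eq_pfaffian K ag) -qS -nact_pfaffian.
exact: ideal_side hJ _ _ qs J0.
Qed.

End SkewIdeal.

(** * The symmetric case: the minors of one type generate all *)

Section SymmetricIdeal.
Variables (K : fieldType) (r : nat) (delta : K) (J : brauer K r r -> Prop).
Hypothesis hJ : two_sided_ideal delta J.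
Hypothesis two : 2%:R != 0 :> K.
Local Notation T := (node r r).
Local Notation "[b D ]" := (basis_elt K D) (at level 0, format "[b  D ]").
Implicit Types (D : diagram r r) (p q : {perm T}) (S I : {set T}) (x y : T).
Local Notation minor := (minor K).

Definition mates I D : {set T} := dmate D @: I.

Lemma in_mates I D x : (x \in mates I D) = (dmate D x \in I).
Proof.
rewrite /mates -{1}[x](dmateK D) mem_imset //; exact: dmate_inj.
Qed.

Lemma mates_stable I D : stable (I :|: mates I D) D.
Proof. by move=> z; rewrite !inE !in_mates dmateK orbC. Qed.

Definition split_by I D := I :&: mates I D = set0.

Lemma split_byP I D x : split_by I D -> x \in I -> dmate D x \notin I.
Proof.
move=> sp xI; apply/negP => wI; move/setP/(_ x): sp.
by rewrite !inE in_mates xI wI.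
Qed.

Lemma mates_relabel p I D : mates (p @: I) (relabel p D) = p @: mates I D.
Proof.
apply/setP => z; rewrite in_mates !perm_on_imset in_mates dmate_relabel.
by rewrite permK.
Qed.

Lemma split_relabel p I D : split_by I D -> split_by (p @: I) (relabel p D).
Proof.
rewrite /split_by mates_relabel => sp; apply/setP => z; rewrite !inE !perm_on_imset.
by move/setP/(_ ((p^-1)%g z)): sp; rewrite !inE.
Qed.

(** A minor can be expanded along its rows or along its columns: conjugating a
    permutation of I by D gives a permutation of the partners. *)
Lemma minor_mates I D : split_by I D -> minor (mates I D) D = minor I D.
Proof.
move=> sp; pose wd : {perm T} := perm (@dmate_inj _ _ D).
have wdE x : wd x = dmate D x by rewrite permE.
have wdI : mates I D = wd @: I by apply: eq_imset => x; rewrite wdE.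
pose f p := ((p^-1) ^ wd)%g.
have f_inj : injective f by move=> p q /conjg_inj /invg_inj.
rewrite /minor (reindex_inj f_inj) /=; apply: eq_big => [p|p].
  rewrite wdI perm_on_conj; apply/idP/idP => h; last exact: perm_onV.
  by rewrite -[p]invgK; apply: perm_onV.
rewrite wdI perm_on_conj => pV; have pI : perm_on I p by rewrite -[p]invgK; apply: perm_onV.
rewrite odd_permJ odd_permV; congr (_ *: basis_elt K _); apply: relabel_eqP => x.
have fE z : f p (dmate D z) = dmate D ((p^-1)%g z) by rewrite -!wdE permJ.
have fE' z : f p z = dmate D ((p^-1)%g (dmate D z)) by rewrite -fE dmateK.
have pVE z : ((p^-1)%g z \in I) = (z \in I) := perm_closed z pV.
have out z : z \notin I -> (p^-1)%g z = z := out_perm pV.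
have out' z : z \notin I -> p z = z := out_perm pI.
rewrite fE fE' dmate_relabel.
have [xI|xI] := boolP (dmate D x \in I).
  set y := (p^-1)%g (dmate D x); have yI : y \in I by rewrite pVE.
  rewrite (out (dmate D y)) ?dmateK; last exact: split_byP yI.
  rewrite permKV (out x) //; have := split_byP sp xI; rewrite dmateK //.
rewrite (out _ xI) dmateK; have [xI'|xI'] := boolP (x \in I).
  by rewrite out' //; apply: split_byP sp _; rewrite pVE.
by rewrite out' ?(out x xI').
Qed.

(** The alternating sum over I and one further node j, the partner of an
    element of I, vanishes because the two ends of an arc can be exchanged;
    its cosets modulo the symmetric group of I give the terms. *)
Lemma exchange I D j : split_by I D -> j \in mates I D ->
  minor I D = \sum_(x in I) nact (tperm j x) (minor I D).
Proof.
move=> sp jJ; have wjI : dmate D j \in I by rewrite -in_mates.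
have jI : j \notin I by have := split_byP sp wjI; rewrite dmateK.
pose I' := j |: I.
pose F p := (-1) ^+ odd_perm p *: [b relabel p D].
have zero : \sum_(p | perm_on I' p) F p = 0.
  pose t : {perm T} := tperm j (dmate D j).
  have tI : perm_on I' t.
    by apply: perm_on_tperm; rewrite !inE ?eqxx ?wjI ?orbT.
  have : \sum_(p | perm_on I' p) F p = - \sum_(p | perm_on I' p) F p.
    rewrite {1}(reindex_inj (mulgI t)) -sumrN /=; apply: eq_big => p.
      apply/idP/idP => h; last exact: perm_onM.
      by rewrite -[p](mulKg t); apply: perm_onM => //; apply: perm_onV.
    move=> _; rewrite /F odd_permM odd_tperm eq_sym dmateN addTb signrN scaleNr.
    by rewrite relabelM relabel_arc.
  move/eqP; rewrite -subr_eq0 opprK -mulr2n -scaler_nat scaler_eq0 (negPf two).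
  by move/eqP.
have step x : x \in I' -> \sum_(p | perm_on I' p && (p j == x)) F p
    = (-1) ^+ (j != x) *: nact (tperm j x) (minor I D).
  move=> xI'; rewrite (reindex_inj (mulIg (tperm j x))) nact_sum scaler_sumr.
  have tI : perm_on I' (tperm j x).
    by apply: perm_on_tperm; rewrite // !inE eqxx.
  apply: eq_big => [p|p _]; last first.
    rewrite /F odd_permM odd_tperm nactZ nact_basis scalerA relabelM addbC.
    by rewrite signr_addb.
  rewrite permM; apply/andP/idP => [[h /eqP pj]|pI]; last first.
    rewrite (out_perm pI jI) tpermL eqxx; split=> //; apply: perm_onM => //.
    by apply: subset_trans pI _; apply: subsetUr.
  have pI' : perm_on I' p.
    by rewrite -[p](mulgK (tperm j x)); apply: perm_onM => //; rewrite tpermV.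
  have pjj : p j = j by apply: (@perm_inj _ (tperm j x)); rewrite pj tpermL.
  apply/subsetP => z; rewrite inE => pz; have := subsetP pI' z; rewrite !inE pz.
  by move=> /(_ isT) /orP[/eqP zj|//]; rewrite zj pjj eqxx in pz.
move: zero; rewrite (partition_big (fun p => p j) (mem I')) /= => [|p pI']; last first.
  by rewrite (perm_closed _ pI') !inE eqxx.
under eq_bigr => x xI' do rewrite step //.
rewrite big_setU1 //= eqxx scale1r tperm1 nact1.
under eq_bigr => x xI.
  have -> : j != x by apply: contraNneq jI => ->.
  rewrite expr1 scaleN1r; over.
by rewrite sumrN => /eqP; rewrite subr_eq0 => /eqP.
Qed.

(** * Counting exchanges *)

Section Count.
Variables (U W : {set T}) (Y : brauer K r r).
Hypothesis dUW : U :&: W = set0.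
Hypothesis lUW : (#|U| < #|W|)%N.
Hypothesis fact0 : forall k, (k %| (#|U :|: W|)`!)%N -> k%:R != 0 :> K.
Hypothesis JUW : forall p (X : brauer K r r),
  perm_on (U :|: W) p -> J X -> J (nact p X).
Hypothesis altU : forall p, perm_on U p -> nact p Y = (-1) ^+ odd_perm p *: Y.
Hypothesis altW : forall p, perm_on W p -> nact p Y = (-1) ^+ odd_perm p *: Y.

Let rho p (X : brauer K r r) := (-1) ^+ odd_perm p *: nact p X.
Hypothesis garnir : forall y, y \in W -> J (\sum_(x in y |: U) rho (tperm x y) Y).

Let rhoM p q X : rho (p * q)%g X = rho q (rho p X).
Proof.
rewrite /rho nactM nactZ scalerA odd_permM signr_addb mulrC //.
Qed.

Let rho_sum p (A : Type) (s : seq A) (P : pred A) (F : A -> brauer K r r) :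
  rho p (\sum_(i <- s | P i) F i) = \sum_(i <- s | P i) rho p (F i).
Proof. by rewrite /rho nact_sum scaler_sumr. Qed.

Let Jrho p X : perm_on (U :|: W) p -> J X -> J (rho p X).
Proof. by move=> pUW JX; apply: (idealZ hJ); apply: JUW. Qed.

Let N := U :|: W.
Let c := #|U|.
Let w := #|W|.
Let cN : #|N| = (c + w)%N.
Proof. by rewrite cardsU dUW cards0 subn0. Qed.

Let natN0 k : (0 < k <= c + w)%N -> k%:R != 0 :> K.
Proof. by move=> hk; apply: fact0; rewrite cN; apply: dvdn_fact. Qed.

Let moved (A : {set T}) p := #|p @: A :\: W|.

Let Sg j := \sum_(p | perm_on N p && (moved W p == j)) rho p Y.

(** The exchange relation for y, averaged over the permutations by which
    exactly j of the elements of W other than y leave W. *)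
Let average y j : y \in W ->
  J (\sum_(p | perm_on N p && (moved (W :\ y) p == j)) rho p Y).
Proof.
move=> yW; pose P p := perm_on N p && (moved (W :\ y) p == j).
have yU : y \notin U.
  by apply/negP => yU; move/setP/(_ y): dUW; rewrite !inE yU yW.
have cU : #|y |: U| = c.+1 by rewrite cardsU1 yU.
apply: (idealZ_inv hJ (c := c.+1%:R)); first by apply: natN0; rewrite /c /w; lia.
have -> : c.+1%:R *: (\sum_(p | P p) rho p Y)
    = \sum_(p | P p) rho p (\sum_(x in y |: U) rho (tperm x y) Y).
  under [RHS]eq_bigr do rewrite rho_sum.
  rewrite exchange_big /= scaler_nat -cU -sumr_const; apply: eq_bigr => x xU.
  rewrite (reindex_inj (mulgI (tperm x y))) /=; apply: eq_big => [p|p _]; last exact: rhoM.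
  have tN : perm_on N (tperm x y).
    apply: perm_on_tperm; last by rewrite inE yW orbT.
    by move: xU; rewrite !inE => /orP[/eqP ->|->]; rewrite ?yW ?orbT.
  rewrite /P; have -> : perm_on N (tperm x y * p)%g = perm_on N p.
    apply/idP/idP => h; last exact: perm_onM.
    by rewrite -[p](mulKg (tperm x y)); apply: perm_onM => //; rewrite tpermV.
  congr (_ && (#|pred_of_set (_ :\: W)| == j)).
  have -> : (tperm x y * p)%g @: (W :\ y) = p @: (tperm x y @: (W :\ y)).
    by rewrite -imset_comp; apply: eq_imset => z /=; rewrite permM.
  suff -> : tperm x y @: (W :\ y) = W :\ y by [].
  apply/setP => z; rewrite perm_on_imset tpermV.
  have xW : x \notin W :\ y.
    rewrite !inE; move: xU; rewrite !inE => /orP[/eqP ->|xU]; first by rewrite eqxx.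
    rewrite negb_and; apply/orP; right; apply/negP => xW.
    by move/setP/(_ x): dUW; rewrite !inE xU xW.
  have yW' : y \notin W :\ y by rewrite !inE eqxx.
  by case: tpermP => // ->; rewrite (negPf xW) (negPf yW').
apply: (ideal_sum hJ) => p /andP[pN _]; apply: Jrho => //; exact: garnir.
Qed.

(** The sum over y of the averaged relations: if j elements leave W, then y is
    one of the w - j that stay; if j + 1 leave, then y is one of these. *)
Let recursion j : J ((w - j)%:R *: Sg j + (j.+1)%:R *: Sg j.+1).
Proof.
have <- : \sum_(y in W) \sum_(p | perm_on N p && (moved (W :\ y) p == j)) rho p Y
    = (w - j)%:R *: Sg j + (j.+1)%:R *: Sg j.+1; last first.
  by apply: (ideal_sum hJ) => y yW; apply: average.
have countE p : #|[set y in W | moved (W :\ y) p == j]|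
    = (if moved W p == j then w - j else if moved W p == j.+1 then j.+1 else 0)%N.
  have E y : y \in W -> moved (W :\ y) p = (moved W p - (p y \notin W))%N.
    move=> yW; rewrite /moved; have -> : p @: (W :\ y) = p @: W :\ p y.
      apply/setP => z; have zE : (z == p y) = ((p^-1)%g z == y).
        by apply/eqP/eqP => [->|<-]; rewrite ?permK ?permKV.
      by rewrite !inE zE !perm_on_imset !inE.
    have -> : (p @: W :\ p y) :\: W = (p @: W :\: W) :\ p y.
      by apply/setP => z; rewrite !inE; do !case: (_ \in _); rewrite ?andbF.
    rewrite [in RHS](cardsD1 (p y)) !inE mem_imset ?yW ?andbT; last exact: perm_inj.
    by rewrite addKn.
  have c1 : #|[set y in W | p y \notin W]| = moved W p.
    rewrite /moved -(card_imset _ (@perm_inj _ p)); apply: eq_card => z.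
    by rewrite !inE !perm_on_imset !inE permKV andbC.
  have c2 : #|[set y in W | p y \in W]| = (w - moved W p)%N.
    have := cardsID [set y | p y \in W] W; rewrite -c1 /w.
    have -> : W :&: [set y | p y \in W] = [set y in W | p y \in W].
      by apply/setP => z; rewrite !inE.
    have -> : W :\: [set y | p y \in W] = [set y in W | p y \notin W].
      by apply/setP => z; rewrite !inE andbC.
    lia.
  have [e|ne] := eqVneq (moved W p) j.
    rewrite -e -c2; apply: eq_card => y; rewrite !inE.
    case yW: (y \in W) => //=; rewrite E //; case pyW: (p y \in W) => /=.
      by rewrite subn0 eqxx.
    have : (0 < moved W p)%N.
      by rewrite -c1 card_gt0; apply/set0Pn; exists y; rewrite inE yW pyW.
    by move=> h; apply/negbTE; apply/eqP; lia.
  have [e|ne'] := eqVneq (moved W p) j.+1.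
    rewrite -e -c1; apply: eq_card => y; rewrite !inE.
    case yW: (y \in W) => //=; rewrite E // e; case pyW: (p y \in W) => /=.
      by apply/negbTE/eqP; lia.
    by rewrite subn1 eqxx.
  apply/eqP; rewrite cards_eq0; apply/eqP/setP => y; rewrite !inE.
  apply/negbTE; rewrite negb_and; case yW: (y \in W) => //=; rewrite E //.
  by case: (p y \in W) => /=; apply/eqP; move: ne ne' => /eqP ne /eqP ne'; lia.
transitivity (\sum_(p | perm_on N p) #|[set y in W | moved (W :\ y) p == j]|%:R *: rho p Y).
  under eq_bigr do rewrite big_mkcondr.
  rewrite exchange_big /=; apply: eq_bigr => p _.
  rewrite -big_mkcondr scaler_nat -sumr_const; apply: eq_bigl => y.
  by rewrite inE.
under eq_bigr do rewrite countE.
rewrite /Sg !scaler_sumr !big_mkcondr -big_split /=; apply: eq_bigr => p _.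
case: eqP => [->|_] /=; last by case: eqP => _; rewrite ?add0r // scale0r.
by rewrite (ltn_eqF (ltnSn j)) addr0.
Qed.

(** Let Sg j be the alternating sum over the permutations by which exactly j
    elements leave W. It vanishes for j > |U|, since there is no room for more
    elements, and the recursion can be solved downwards because |U| < |W|.
    This leads to Sg 0, a multiple of Y by an invertible integer, as Y is
    alternating on U and on W. *)
Lemma count_ideal : J Y.
Proof.
have all j : J (Sg j).
  have big k : (c < k)%N -> J (Sg k).
    move=> ck; rewrite /Sg big1; first exact: ideal0 hJ.
    move=> p /andP[pN /eqP mk].
    suff : (moved W p <= c)%N by rewrite mk leqNgt ck.
    apply: subset_leq_card; apply/subsetP => z; rewrite !inE => /andP[zW].
    case/imsetP => y yW zy; have : z \in N by rewrite zy (perm_closed _ pN) inE yW orbT.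
    by rewrite inE (negPf zW) orbF.
  move en : (c.+1 - j)%N => n; elim: n j en => [|n IH] j en; first by apply: big; lia.
  have [/big //|jc] := ltnP c j.
  apply: (idealZ_inv hJ (c := (w - j)%:R)).
    by apply: natN0; move: lUW; rewrite -/c -/w; lia.
  rewrite -[_ *: _](addrK (j.+1%:R *: Sg j.+1)).
  apply: (idealB hJ); first exact: recursion.
  by apply: (idealZ hJ); apply: IH; lia.
have fixW p : perm_on N p -> moved W p = 0%N -> p @: W = W.
  move=> pN m0; apply/eqP; rewrite eqEcard card_imset ?leqnn ?andbT; last exact: perm_inj.
  move/eqP: m0; rewrite cards_eq0 => /eqP m0; apply/subsetP => z zp.
  by apply/negPn/negP => zW; move/setP/(_ z): m0; rewrite !inE zp zW.
have rhoY p : perm_on N p -> moved W p = 0%N -> rho p Y = Y.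
  move=> pN m0; have pW := fixW p pN m0.
  have pWE y : (p y \in W) = (y \in W) by rewrite -{1}pW mem_imset //; apply: perm_inj.
  have f_inj : injective (fun y => if y \in U then p y else y).
    have pUE y : y \in U -> p y \in U.
      move=> yU; have : p y \in N by rewrite (perm_closed _ pN) inE yU.
      rewrite inE => /orP[//|]; rewrite pWE => yW.
      by move/setP/(_ y): dUW; rewrite !inE yU yW.
    move=> x y; case: ifP => xU; case: ifP => yU //; first exact: perm_inj.
      by move=> E; move: (pUE x xU); rewrite E yU.
    by move=> E; move: (pUE y yU); rewrite -E xU.
  pose pU := perm f_inj; have pUE y : pU y = if y \in U then p y else y by rewrite permE.
  have onU : perm_on U pU.
    by apply/subsetP => y; rewrite inE pUE; case: ifP => //; rewrite eqxx.
  have onW : perm_on W (pU^-1 * p)%g.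
    apply/subsetP => z; rewrite inE -[z](permKV pU) permM permK pUE.
    move: ((pU^-1)%g z) => y; case: ifP => yU; first by rewrite eqxx.
    by move=> /(subsetP pN); rewrite inE yU.
  have alt q : nact q Y = (-1) ^+ odd_perm q *: Y -> rho q Y = Y.
    by move=> h; rewrite /rho h scalerA -expr2 sqrr_sign scale1r.
  rewrite -[p](mulKVg pU) rhoM (alt pU) ?altU //.
  by apply: alt; apply: altW.
have : J (#|[set p | perm_on N p & moved W p == 0%N]|%:R *: Y).
  rewrite scaler_nat -sumr_const.
  rewrite (eq_bigr (fun p => rho p Y)) => [|p]; last first.
    by rewrite inE => /andP[pN /eqP m0]; rewrite rhoY.
  have := all 0%N; congr J; apply: eq_bigl => p; by rewrite inE.
apply: (idealZ_inv hJ); apply: fact0.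
have -> : [set p | perm_on N p & moved W p == 0%N] = [set p | perm_on N p & p @: W == W].
  apply/setP => p; rewrite !inE; case pN: (perm_on N p) => //=.
  apply/eqP/eqP => [/(fixW p pN) //|pW].
  by rewrite /moved pW setDv cards0.
apply: stab_dvd.
  by apply/eqP; rewrite -[RHS]imset_id; apply: eq_imset => x; rewrite perm1.
move=> p q /eqP pW /eqP qW; apply/eqP; rewrite -[RHS]qW -{2}pW -imset_comp.
by apply: eq_imset => x; rewrite /= permM.
Qed.

End Count.

(** * Minors of all types *)

Variable n : nat.
Hypothesis fact0 : forall k, (k %| n`!)%N -> k%:R != 0 :> K.

(** The minors of size n with a lower nodes among the nodes that index their
    rows. It suffices to consider those whose other arcs join the two rows. *)
Definition typed a := forall I D, #|I| = n -> split_by I D ->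
  through (I :|: mates I D) D -> #|rowpart I true| = a -> J (minor I D).

Lemma mates_sizes I D : #|I| = n -> split_by I D -> through (I :|: mates I D) D ->
  [/\ #|mates I D| = n,
     (#|rowpart I true| + #|rowpart I false|)%N = n,
     (#|rowpart (mates I D) true| + #|rowpart (mates I D) false|)%N = n &
     #|rowpart (mates I D) false| = #|rowpart I true|].
Proof.
move=> cI sp th; have cJ : #|mates I D| = n.
  by rewrite card_imset ?cI //; apply: dmate_inj.
have rU b : #|rowpart (I :|: mates I D) b| = (#|rowpart I b| + #|rowpart (mates I D) b|)%N.
  rewrite -cardsUI.
  have -> : rowpart I b :&: rowpart (mates I D) b = set0.
    apply/setP => z; move/setP/(_ z): sp; rewrite !inE.
    by case: (z \in I); case: (z \in mates I D); rewrite ?andbF.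
  by rewrite cards0 addn0; apply: eq_card => z; rewrite !inE andb_orl.
have h := card_rowpart_through true (mates_stable I D) th.
have h1 := card_rowpart I; have h2 := card_rowpart (mates I D).
move: h h1 h2; rewrite !rU cI cJ [~~ true]/=.
set a := #|rowpart I true|; set b := #|rowpart I false|.
set c := #|rowpart (mates I D) true|; set d := #|rowpart (mates I D) false|.
by move=> h h1 h2; split=> //; lia.
Qed.

Lemma typed_swap a : (a <= n)%N -> typed a -> typed (n - a)%N.
Proof.
move=> an ha I D cI sp th ta; have [cJ h1 h2 h3] := mates_sizes cI sp th.
have mm : mates (mates I D) D = I by apply/setP => z; rewrite !in_mates dmateK.
rewrite -(minor_mates sp); apply: ha => //.
- by rewrite /split_by mm setIC.
- by rewrite mm setUC.
by move: h2; rewrite h3 ta; lia.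
Qed.

(** A lower node j of I is exchanged with an upper node y among the partners
    of I, which gives a minor of type a. In the exchange relation of this
    minor for j, the terms that exchange j with lower nodes are conjugate to
    it under permutations of the rows, and the other terms form the relation
    that the count requires; the count runs over the upper nodes of I and of
    its partners. *)
Lemma typed_step a : (n <= a.*2.+1)%N -> typed a -> typed a.+1.
Proof.
move=> na ha I D cI sp th tI; have [cJ h1 h2 h3] := mates_sizes cI sp th.
pose U := rowpart I false; pose W := rowpart (mates I D) false.
have UI x : x \in U -> x \in I by rewrite inE => /andP[].
have WJ x : x \in W -> x \in mates I D by rewrite inE => /andP[].
have sU x : x \in U -> side x = false by rewrite inE => /andP[_ /eqP].
have sW x : x \in W -> side x = false by rewrite inE => /andP[_ /eqP].
have dis x : x \in I -> x \in mates I D -> False.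
  by move=> xI xJ; move/setP/(_ x): sp; rewrite !inE xI xJ.
have dUW : U :&: W = set0.
  apply/setP => x; rewrite !inE; apply/negP => /andP[/andP[xI _] /andP[xJ _]].
  exact: dis xI xJ.
have cUW : #|U :|: W| = n.
  by rewrite cardsU dUW cards0 subn0; move: h1 h3; rewrite tI -/U -/W => h1 ->; lia.
have [j jA] : exists j, j \in rowpart I true.
  by apply/set0Pn; rewrite -card_gt0 tI.
have [jI sj] : j \in I /\ side j = true by move: jA; rewrite inE => /andP[? /eqP].
have side_p p : perm_on (U :|: W) p -> forall z, side (p z) = side z.
  move=> pN z; have [zN|zN] := boolP (z \in U :|: W); last by rewrite (out_perm pN).
  have sN y : y \in U :|: W -> side y = false by rewrite inE => /orP[/sU|/sW].
  by rewrite !sN // (perm_closed _ pN).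
apply: (@count_ideal U W) => //.
- by move: h3 h1; rewrite tI -/U -/W => ->; lia.
- by rewrite cUW.
- by move=> p X pN; apply: (ideal_side hJ); apply: side_p.
- by move=> p pU; apply: nact_minor_on; apply: subset_trans pU _; apply/subsetP.
- move=> p pW; rewrite -(minor_mates sp); apply: nact_minor_on.
  by apply: subset_trans pW _; apply/subsetP.
move=> y yW; have yJ := WJ _ yW; have yI : y \notin I by apply/negP => /dis; apply.
have jJ : j \notin mates I D by apply/negP; apply: dis.
have jy : j != y by apply: contraNneq yI => <-.
pose t := tperm j y; pose I2 := t @: I; pose D2 := relabel t D.
have sp2 : split_by I2 D2 := split_relabel t sp.
have I2E x : (x \in I2) = if x == y then true else (x != j) && (x \in I).
  rewrite perm_on_imset tpermV; case: (eqVneq x y) => [->|xy]; first by rewrite tpermR.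
  case: (eqVneq x j) => [->|xj]; first by rewrite tpermL (negPf yI).
  by rewrite tpermD // eq_sym.
have jJ2 : j \in mates I2 D2 by rewrite mates_relabel perm_on_imset tpermV tpermL.
have S2 : I2 :|: mates I2 D2 = I :|: mates I D.
  apply/setP => x; rewrite mates_relabel !inE !perm_on_imset tpermV.
  case: tpermP => [->|->|//]; rewrite ?jI ?yJ ?orbT //.
have tS : perm_on (I :|: mates I D) t.
  by apply: perm_on_tperm; rewrite inE ?jI ?yJ ?orbT.
have ag : agree (I :|: mates I D) D D2.
  apply: agree_perm_on tS => x; rewrite mates_stable; split=> //.
have th2 : through (I2 :|: mates I2 D2) D2.
  by rewrite S2 => z zS; rewrite ag // th.
have J2 : J (minor I2 D2).
  apply: ha => //; first by rewrite card_imset //; apply: perm_inj.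
  have -> : rowpart I2 true = rowpart I true :\ j.
    apply/setP => x; rewrite !inE I2E; case: (eqVneq x y) => [->|_].
      by rewrite (sW _ yW) /= !andbF.
    by rewrite andbA.
  by apply: succn_inj; rewrite -tI (cardsD1 j (rowpart I true)) jA.
have := exchange sp2 jJ2; rewrite (bigID (fun x => side x)) /= => E.
have Jlow : J (\sum_(x in I2 | side x) nact (tperm j x) (minor I2 D2)).
  apply: (ideal_sum hJ) => x /andP[_ sx]; apply: (ideal_side hJ) => // z.
  by case: tpermP => [->|->|//]; rewrite sx sj.
have := idealB hJ J2 Jlow; move: E.
set low := \sum_(x in I2 | side x) _; set high := \sum_(x in I2 | ~~ _) _ => E.
have -> : minor I2 D2 - low = high by apply/eqP; rewrite subr_eq addrC; apply/eqP.
congr J; rewrite /high /I2 /D2 -nact_minor -/I2.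
apply: eq_big => [x|x].
  rewrite I2E !inE; case: (eqVneq x y) => [->|xy] /=; first by rewrite (sW _ yW).
  case: (eqVneq x j) => [->|_] /=; first by rewrite sj andbF.
  by case: (side x); rewrite ?andbF ?andbT.
rewrite I2E; case: (eqVneq x y) => [->|xy] /=.
  by rewrite -nactM tperm2 nact1 tperm1 nact1 odd_perm1 scale1r.
case/andP=> /andP[xj xI] sx; rewrite -nactM odd_tperm xy.
have -> : (tperm j y * tperm j x = tperm j x * tperm x y)%g.
  rewrite -[(tperm x y)](_ : (tperm j y ^ tperm j x)%g = _).
    by rewrite /conjg mulKVg.
  by rewrite tpermJ tpermL tpermD // 1?eq_sym // (contraNneq _ yI) // => <-.
rewrite nactM nact_minor_on; last first.
  exact: perm_on_tperm.
by rewrite odd_tperm eq_sym xj nactZ.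
Qed.

(** Upwards from a0 by steps, and down to the other types by transposition. *)
Lemma typed_all a0 : (n <= a0.*2.+1)%N -> (a0.*2 <= n.+1)%N -> typed a0 ->
  forall I D, #|I| = n -> split_by I D -> J (minor I D).
Proof.
move=> na na' h0 I D cI sp.
have up k : typed (a0 + k)%N.
  elim: k => [|k IH]; first by rewrite addn0.
  by rewrite addnS; apply: typed_step => //; lia.
have all a : (a <= n)%N -> typed a.
  move=> an; have [le|lt] := leqP a0 a; first by rewrite -(subnKC le); apply: up.
  rewrite -(subKn an); apply: typed_swap; first exact: leq_subr.
  have le : (a0 <= n - a)%N by lia.
  by rewrite -(subnKC le); apply: up.
have loc : local (minor I D) (I :|: mates I D) D.
  by apply: local_minor => x xI; rewrite mates_stable !inE xI.
have [p [th pJ]] := reduce hJ (mates_stable I D) loc.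
apply: pJ; rewrite nact_minor.
have cI' : #|p @: I| = n by rewrite card_imset //; apply: perm_inj.
apply: (all #|rowpart (p @: I) true|) => //.
- rewrite -cI'; apply: subset_leq_card; apply/subsetP => x; by rewrite inE => /andP[].
- exact: split_relabel.
by rewrite mates_relabel -imsetU.
Qed.

(** Minors of one type are conjugate under the permutations of the rows, up to
    the matching between rows and columns, which only affects the sign. *)
Lemma typed_base I0 D0 : #|I0| = n -> split_by I0 D0 ->
  through (I0 :|: mates I0 D0) D0 -> J (minor I0 D0) ->
  typed #|rowpart I0 true|.
Proof.
move=> c0 sp0 th0 J0 I D cI sp th tI.
have [_ h1 h2 h3] := mates_sizes cI sp th; have [_ h4 h5 h6] := mates_sizes c0 sp0 th0.
have [||p [ps pI pJ ag]] := transport sp sp0 (mates_stable I D) (mates_stable I0 D0) th th0.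
- by case; lia.
- by case; lia.
pose D1 := relabel p D0.
have m1 : mates I D1 = mates I D by rewrite -pJ -pI mates_relabel.
have sp1 : split_by I D1 by rewrite /split_by m1.
have J1 : J (minor I D1) by rewrite -pI -nact_minor; apply: (ideal_side hJ).
pose f x := if x \in I then dmate D (dmate D1 x) else x.
have fI x : x \in I -> dmate D (dmate D1 x) \in I.
  by move=> xI; rewrite -in_mates -m1 in_mates dmateK.
have f_inj : injective f.
  move=> x y; rewrite /f; case: ifP => xI; case: ifP => yI //.
  - by move/dmate_inj/dmate_inj.
  - by move=> E; move: (fI x xI); rewrite E yI.
  by move=> E; move: (fI y yI); rewrite -E xI.
pose q := perm f_inj; have qE x : q x = f x by rewrite permE.
have qI : perm_on I q.
  by apply/subsetP => x; rewrite inE qE /f; case: ifP => //; rewrite eqxx.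
have -> : D = relabel q D1.
  apply/esym/relabel_eqP => x; rewrite !qE /f.
  case xI: (x \in I).
    have w1 : dmate D1 x \notin I := split_byP sp1 xI.
    by rewrite (negPf w1) dmateK.
  case wI: (dmate D1 x \in I); first by rewrite dmateK.
  apply/esym/ag; rewrite !inE xI in_mates /=; apply/negP => wxI.
  by move: wI; rewrite -in_mates m1 in_mates wxI.
by rewrite minor_relabel //; apply: (idealZ hJ).
Qed.

End SymmetricIdeal.

(** * The element E_i is a minor *)

Section OrthElement.
Variables (m i : nat).
Hypothesis le_im : (i <= m.+1)%N.
Local Notation N := m.+1.
Local Notation p := (N - i)%N.
Local Notation q := (N + (p + p))%N.
Variable K : fieldType.
Local Notation "[b D ]" := (basis_elt K D) (at level 0, format "[b  D ]").
Implicit Types (s : 'S_N).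

Let eA : (i + (p + p) + p = q)%N. Proof. by lia. Qed.
Let eA' : (i + 0 + p = N)%N. Proof. by lia. Qed.

Definition capN : diagram q N :=
  castd eA eA' (juxt_diag (juxt_diag (id_diag i) (cap_diag p)) (id_diag p)).
Definition cupN : diagram N q :=
  castd eA' eA (juxt_diag (juxt_diag (id_diag i) (cup_diag p)) (id_diag p)).

Lemma capN1 (y : 'I_q) (x : 'I_N) : (x < i)%N -> y = x :> nat ->
  dmate capN (inl y) = inr x.
Proof.
move=> xi yx; pose a := Ordinal xi.
have -> : inl y = castn eA eA' (node_left p p (node_left (p + p) 0 (inl a))).
  by congr inl; apply: val_inj.
rewrite dmate_castd !dmate_juxt_left dmate_id /=.
by congr inr; apply: val_inj.
Qed.

Lemma capN2 (y y' : 'I_q) b : (b < p + p)%N -> y = (i + b)%N :> nat ->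
  y' = (i + (p + p - b.+1))%N :> nat -> dmate capN (inl y) = inl y'.
Proof.
move=> bp yb yb'; pose a := Ordinal bp.
have -> : inl y = castn eA eA' (node_left p p (node_right i i (inl a))).
  by congr inl; apply: val_inj.
rewrite dmate_castd !(dmate_juxt_left, dmate_juxt_right) [dmate (cap_diag p) _]dmate_of_inv /=.
by congr inl; apply: val_inj.
Qed.

Lemma capN3 (y : 'I_q) (x : 'I_N) c : (c < p)%N -> y = (i + (p + p) + c)%N :> nat ->
  x = (i + c)%N :> nat -> dmate capN (inl y) = inr x.
Proof.
move=> cp yc xc; pose a := Ordinal cp.
have -> : inl y = castn eA eA' (node_right (i + (p + p)) (i + 0) (inl a)).
  by congr inl; apply: val_inj.
rewrite dmate_castd dmate_juxt_right dmate_id /=.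
by congr inr; apply: val_inj => /=; lia.
Qed.

Lemma cupN1 (y : 'I_q) (x : 'I_N) : (x < i)%N -> y = x :> nat ->
  dmate cupN (inl x) = inr y.
Proof.
move=> xi yx; pose a := Ordinal xi.
have -> : inl x = castn eA' eA (node_left p p (node_left 0 (p + p) (inl a))).
  by congr inl; apply: val_inj.
rewrite dmate_castd !dmate_juxt_left dmate_id /=.
by congr inr; apply: val_inj.
Qed.

Lemma cupN2 (y y' : 'I_q) b : (b < p + p)%N -> y = (i + b)%N :> nat ->
  y' = (i + (p + p - b.+1))%N :> nat -> dmate cupN (inr y) = inr y'.
Proof.
move=> bp yb yb'; pose a := Ordinal bp.
have -> : inr y = castn eA' eA (node_left p p (node_right i i (inr a))).
  by congr inr; apply: val_inj.
rewrite dmate_castd !(dmate_juxt_left, dmate_juxt_right) [dmate (cup_diag p) _]dmate_of_inv /=.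
by congr inr; apply: val_inj.
Qed.

Lemma cupN3 (y : 'I_q) (x : 'I_N) c : (c < p)%N -> y = (i + (p + p) + c)%N :> nat ->
  x = (i + c)%N :> nat -> dmate cupN (inl x) = inr y.
Proof.
move=> cp yc xc; pose a := Ordinal cp.
have -> : inl x = castn eA' eA (node_right (i + 0) (i + (p + p)) (inl a)).
  by congr inl; apply: val_inj => /=; lia.
rewrite dmate_castd dmate_juxt_right dmate_id /=.
by congr inr; apply: val_inj.
Qed.

(** The permutation diagram in the middle of E_i. *)
Definition middle s : diagram q q := juxt_diag (perm_diag s) (cross_diag p p).

Lemma middle1 s (x : 'I_N) :
  dmate (middle s) (inl (lshift (p + p) x)) = inr (lshift (p + p) (s x)).
Proof.
have := dmate_juxt_left (perm_diag s) (cross_diag p p) (inl x).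
by rewrite dmate_perm.
Qed.

Lemma middle2 s (y y' : 'I_q) c : (c < p)%N -> y = (N + c)%N :> nat ->
  y' = (N + p + c)%N :> nat ->
  dmate (middle s) (inl y) = inr y' /\ dmate (middle s) (inl y') = inr y.
Proof.
move=> cp yc yc'; pose a := Ordinal cp.
have -> : y = rshift N (lshift p a) by apply: val_inj.
have -> : y' = rshift N (rshift p a) by apply: val_inj => /=; lia.
have h z := dmate_juxt_right (perm_diag s) (cross_diag p p) (inl z).
split.
  have := h (lshift p a); rewrite [dmate (cross_diag _ _) _]dmate_of_inv /=.
  by have -> : split (lshift p a) = inl a by exact: (unsplitK (inl a)).
have := h (rshift p a); rewrite [dmate (cross_diag _ _) _]dmate_of_inv /=.
by have -> : split (rshift p a) = inr a by exact: (unsplitK (inr a)).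
Qed.

(** The nested caps and cups of E_i reverse the order of the last m + 1 - i
    indices. *)
Definition refl_fun (x : 'I_N) : 'I_N := 
  inord (if (x < i)%N then val x else (m - x + i)%N).

Lemma refl_funE (x : 'I_N) :
  refl_fun x = (if (x < i)%N then x : nat else (m - x + i)%N) :> nat.
Proof.
rewrite inordK //; have := ltn_ord x.
by case: (ltnP x i) => xi /=; lia.
Qed.

Lemma refl_funK : involutive refl_fun.
Proof.
move=> x; apply: val_inj; rewrite /= !refl_funE; have := ltn_ord x.
by case: (ltnP x i) => xi xN; case: ltnP; lia.
Qed.

Lemma refl_lt (x : 'I_N) : (refl_fun x < i)%N = (x < i)%N.
Proof. by rewrite refl_funE; case: (ltnP x i) => // ix; apply/negbTE; rewrite -leqNgt leq_addl. Qed.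

(** The rows and columns of the determinant E_i; the identity diagram joins
    row k with column k. *)
Definition orth_row (k : 'I_N) : node N N :=
  if (k < i)%N then inl k else inr (refl_fun k).
Definition orth_col (k : 'I_N) : node N N :=
  if (k < i)%N then inr k else inl (refl_fun k).

Lemma orth_col_inj : injective orth_col.
Proof.
move=> k l; rewrite /orth_col; case: ifP => _; case: ifP => _ //; first by case.
by case=> /(inv_inj refl_funK).
Qed.

Lemma orth_row_col k : dmate (id_diag N) (orth_row k) = orth_col k.
Proof. by rewrite dmate_id /orth_row /orth_col; case: ifP. Qed.

Lemma orth_row_neq k l : orth_row k != orth_col l.
Proof.
rewrite /orth_row /orth_col; case: ifP => ki; case: ifP => li //; apply/eqP => -[E].
  by move: (refl_lt l); rewrite -E ki li.
by move: (refl_lt k); rewrite E ki li.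
Qed.

Lemma orth_nodeP z : exists k, z = orth_row k \/ z = orth_col k.
Proof.
case: z => x; case xi: (x < i)%N.
- by exists x; left; rewrite /orth_row xi.
- by exists (refl_fun x); right; rewrite /orth_col refl_lt xi refl_funK.
- by exists x; right; rewrite /orth_col xi.
by exists (refl_fun x); left; rewrite /orth_row refl_lt xi refl_funK.
Qed.

Definition orth_diag s : diagram N N :=
  relabel (extp orth_col_inj s) (id_diag N).

Lemma orth_diag_row s k : dmate (orth_diag s) (orth_row k) = orth_col (s k).
Proof.
have fix_row : extp orth_col_inj s (orth_row k) = orth_row k.
  by apply: extp_id; apply/codomP => -[l E]; have := orth_row_neq k l; rewrite E eqxx.
rewrite -{1}fix_row dmate_relabelE orth_row_col extpE //.
Qed.

Lemma comp_middle_cup (delta : K) s : exists D1 : diagram N q,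
  [/\ brauer_comp delta [b middle s] [b cupN] = [b D1],
      forall k : 'I_N, (k < i)%N -> dmate D1 (inl k) = inr (lshift (p + p) (s k)),
      forall (k : 'I_N) (y : 'I_q), (i <= k)%N ->
        y = (N + p + (m - k))%N :> nat -> dmate D1 (inr y) = inr (lshift (p + p) (s k))
    & forall (k : 'I_N) (y : 'I_q) c, (c < p)%N -> k = (i + c)%N :> nat ->
        y = (N + c)%N :> nat -> dmate D1 (inl k) = inr y].
Proof.
have [t ms] : exists t : 'S_q, middle s = perm_diag t.
  apply: no_cap_perm => y; have [yN|yN] := ltnP y N.
    have -> : y = lshift (p + p) (Ordinal yN) by apply: val_inj.
    by rewrite middle1.
  have [yp|yp] := ltnP y (N + p).
    have hc : (y - N < p)%N by lia.
    have hy' : (N + p + (y - N) < q)%N by lia.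
    by have [->] := @middle2 s y (Ordinal hy') _ hc (esym (subnKC yN)) erefl.
  have hc : (y - (N + p) < p)%N by have := ltn_ord y; lia.
  have hy : (N + (y - (N + p)) < q)%N by lia.
  by have [_ ->] := @middle2 s (Ordinal hy) y _ hc erefl (esym (subnKC yp)).
have tE y z : dmate (middle s) (inl y) = inr z -> t y = z.
  by rewrite ms dmate_perm => -[].
pose D1 := relabel (extp (@inr_inj 'I_N 'I_q) t) cupN.
have upr j : extp (@inr_inj 'I_N 'I_q) t (inr j) = inr (t j) by exact: extpE.
have upl j : extp (@inr_inj 'I_N 'I_q) t (inl j) = inl j.
  by apply: extp_id; apply/codomP => -[].
exists D1; split=> [|k ki|k y ik yk|k y c cp kc yc].
- by rewrite ms comp_perm_top.
- rewrite -upl dmate_relabelE (cupN1 (y := lshift (p + p) k)) // upr.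
  by rewrite (tE _ _ (middle1 s k)).
- have hc : (m - k < p)%N by have := ltn_ord k; lia.
  pose y0 := (N + (m - k))%N; have hy0 : (y0 < q)%N by rewrite /y0; lia.
  have -> : inr y = extp (@inr_inj 'I_N 'I_q) t (inr (Ordinal hy0)).
    by rewrite upr (tE _ _ (@middle2 s (Ordinal hy0) y _ hc erefl yk).1).
  rewrite dmate_relabelE (@cupN2 (Ordinal hy0) (lshift (p + p) k) (p + (m - k))%N) /=.
  + by rewrite upr (tE _ _ (middle1 s k)).
  + by lia.
  + by rewrite /y0; lia.
  + by have := ltn_ord k; lia.
pose y0 := (N + p + c)%N; have hy0 : (y0 < q)%N by rewrite /y0; lia.
rewrite -(upl k) dmate_relabelE (@cupN3 (Ordinal hy0) k c) //=; last by rewrite /y0; lia.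
by rewrite upr (tE _ _ (@middle2 s y (Ordinal hy0) c cp yc erefl).2).
Qed.

(** Follow the strands through the three layers of E_i; from row k they lead
    to column s k. *)
Lemma comp_orth (delta : K) s D1 :
  (forall k : 'I_N, (k < i)%N -> dmate D1 (inl k) = inr (lshift (p + p) (s k))) ->
  (forall (k : 'I_N) (y : 'I_q), (i <= k)%N ->
     y = (N + p + (m - k))%N :> nat -> dmate D1 (inr y) = inr (lshift (p + p) (s k))) ->
  (forall (k : 'I_N) (y : 'I_q) c, (c < p)%N -> k = (i + c)%N :> nat ->
     y = (N + c)%N :> nat -> dmate D1 (inl k) = inr y) ->
  brauer_comp delta [b capN] [b D1] = [b orth_diag s].
Proof.
move=> h1 h2 h3; pose e := glued_adj capN D1.
pose mid (k : 'I_N) : gnode N q N := inr (inl (lshift (p + p) k)).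
have row k : connect e (gnode_out q (orth_row k)) (mid (s k)).
  rewrite /orth_row; case: ifP => ki.
    by have := connect1 (glued_bot capN D1 (inl k)); rewrite h1.
  have ik : (i <= k)%N by rewrite leqNgt ki.
  have kN := ltn_ord k; have hc : (m - k < p)%N by lia.
  have hy : (N + p + (m - k) < q)%N by lia.
  have top : dmate capN (inl (Ordinal hy)) = inr (refl_fun k).
    by apply: (capN3 hc) => /=; rewrite ?refl_funE ?ki; lia.
  have := connect1 (glued_top capN D1 (inl (Ordinal hy))); rewrite top.
  move=> hh; rewrite glued_adj_sym in hh; apply: (connect_trans hh).
  by have := connect1 (glued_bot capN D1 (inr (Ordinal hy))); rewrite (h2 k).
have col k : connect e (mid k) (gnode_out q (orth_col k)).
  rewrite /orth_col; case: ifP => ki.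
    have := connect1 (glued_top capN D1 (inl (lshift (p + p) k))).
    by rewrite (capN1 ki).
  have ik : (i <= k)%N by rewrite leqNgt ki.
  have kN := ltn_ord k; have hc : (m - k < p)%N by lia.
  have hy : (N + (m - k) < q)%N by lia.
  have hb : (k - i < p + p)%N by lia.
  have top : dmate capN (inl (lshift (p + p) k)) = inl (Ordinal hy).
    by apply: (capN2 hb) => /=; lia.
  have := connect1 (glued_top capN D1 (inl (lshift (p + p) k))); rewrite top.
  move=> /connect_trans; apply.
  have bot : dmate D1 (inl (refl_fun k)) = inr (Ordinal hy).
    by apply: (h3 _ _ (m - k)%N) => //=; rewrite refl_funE ki; lia.
  have := connect1 (glued_bot capN D1 (inl (refl_fun k))); rewrite bot.
  by move=> hh; rewrite glued_adj_sym in hh.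
have main k : connect e (gnode_out q (orth_row k)) (gnode_out q (orth_col (s k))).
  exact: connect_trans (row k) (col (s k)).
apply: comp_basis => [z|y].
  have [k [->|->]] := orth_nodeP z; first by rewrite orth_diag_row.
  rewrite -(permKV s k) -orth_diag_row dmateK glued_adj_sym orth_diag_row.
  exact: main.
have [yN|yN] := ltnP y N.
  exists (orth_col (Ordinal yN)); have := col (Ordinal yN).
  by congr connect; congr (inr (inl _)); apply: val_inj.
have [yp|yp] := ltnP y (N + p).
  have hc : (y - N < p)%N by lia.
  have hk : (i + (y - N) < N)%N by lia.
  exists (inl (Ordinal hk)); rewrite glued_adj_sym.
  have := connect1 (glued_bot capN D1 (inl (Ordinal hk))).
  by rewrite (h3 _ y _ hc) //= subnKC.
have hc : (y - (N + p) < p)%N by have := ltn_ord y; lia.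
have hk : (i + (y - (N + p)) < N)%N by lia.
exists (inr (Ordinal hk)); have := connect1 (glued_top capN D1 (inl y)).
by rewrite (capN3 (x := Ordinal hk) hc) //=; lia.
Qed.

Lemma Eorth_sum : Eorth K m i
  = \sum_(s : 'S_N) (-1) ^+ odd_perm s *: [b orth_diag s].
Proof.
have HA : brauer_cast q N (brauer_tens (brauer_tens (brauer_id K i) (brauer_A K p))
    (brauer_id K p)) = [b capN].
  by rewrite /brauer_id /brauer_A !brauer_tens_basis (brauer_cast_basis _ eA eA').
have HU : brauer_cast N q (brauer_tens (brauer_tens (brauer_id K i) (brauer_U K p))
    (brauer_id K p)) = [b cupN].
  by rewrite /brauer_id /brauer_U !brauer_tens_basis (brauer_cast_basis _ eA' eA).
rewrite /Eorth /= HA HU brauer_comp_suml brauer_comp_sumr; apply: eq_bigr => s _.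
rewrite brauer_compZl brauer_compZr; congr (_ *: _).
have [D1 [E h1 h2 h3]] := comp_middle_cup (m%:R : K) s.
have HX : brauer_tens (brauer_perm K s) (brauer_X K p p) = [b middle s].
  by rewrite /brauer_perm /brauer_X brauer_tens_basis.
apply: etrans (congr1 (fun x => brauer_comp _ _ (brauer_comp _ x _)) HX) _.
apply: etrans (congr1 (fun x => brauer_comp _ _ x) E) _.
exact: comp_orth.
Qed.

End OrthElement.

Section OrthEmbed.
Variables (K : fieldType) (m i r : nat).
Hypotheses (le_im : (i <= m.+1)%N) (le_mr : (m.+1 <= r)%N).

Definition orth_cols : {set node r r} :=
  (fun k => emb_node le_mr (orth_col i k)) @: [set: 'I_m.+1].

Lemma embd_id : embd le_mr (id_diag m.+1) = id_diag r.
Proof.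
apply: diagram_ext => z; have [/codomP[x ->]|zc] := boolP (z \in codom (emb_node le_mr)).
  by rewrite dmate_embd !dmate_id; case: x.
by rewrite dmate_embd_out.
Qed.

Lemma embed_Eorth :
  brauer_embed r (Eorth K m i) = minor K orth_cols (id_diag r).
Proof.
have g_inj : injective (fun k => emb_node le_mr (orth_col i k)).
  by move=> k l /emb_node_inj /(orth_col_inj le_im).
rewrite Eorth_sum (brauer_embed_sum le_mr).
rewrite /minor /orth_cols -(sum_extp g_inj (fun p => (-1) ^+ odd_perm p *:
  basis_elt K (relabel p (id_diag r)))).
apply: eq_bigr => s _; rewrite odd_extp; congr (_ *: basis_elt K _).
rewrite /orth_diag embd_relabel embd_id; congr (relabel _ _); apply/esym/extp_eq => [x|z zc].
  by rewrite !extpE.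
have [/codomP[y ye]|ze] := boolP (z \in codom (emb_node le_mr)); last first.
  by rewrite extp_id.
rewrite ye extpE; congr (emb_node _ _); apply: extp_id; apply: contra zc.
by move=> /codomP[k yk]; rewrite ye yk; apply/codomP; exists k.
Qed.

Lemma orth_cols_card : #|orth_cols| = m.+1.
Proof.
rewrite card_imset ?cardsT ?card_ord //.
by move=> k l /emb_node_inj /(orth_col_inj le_im).
Qed.

Lemma orth_colsP z : reflect (exists k, z = emb_node le_mr (orth_col i k))
  (z \in orth_cols).
Proof.
by apply: (iffP imsetP) => [[k _ ->]|[k ->]]; exists k; rewrite ?inE.
Qed.

Lemma orth_cols_mate z : z \in orth_cols -> dmate (id_diag r) z \notin orth_cols.
Proof.
case/orth_colsP => k ->; apply/negP => /orth_colsP[l].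
rewrite -embd_id dmate_embd -orth_row_col dmateK => /emb_node_inj E.
by have := orth_row_neq le_im k l; rewrite E eqxx.
Qed.

Lemma orth_cols_low :
  #|[set z in orth_cols | (if z is inl _ then true else false) == true]| = (m.+1 - i)%N.
Proof.
rewrite -[RHS](card_ord (m.+1 - i)) -cardsT.
have hk (c : 'I_(m.+1 - i)) : (i + c < m.+1)%N by have := ltn_ord c; lia.
pose f (c : 'I_(m.+1 - i)) := emb_node le_mr (orth_col i (Ordinal (hk c))).
have f_inj : injective f.
  move=> c d /emb_node_inj /(orth_col_inj le_im) /(congr1 val) /= /addnI; exact: val_inj.
rewrite -(card_imset _ f_inj); apply: eq_card => z; rewrite inE.
have low c : orth_col i (Ordinal (hk c)) = inl (refl_fun i (Ordinal (hk c))).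
  by rewrite /orth_col /= ltnNge leq_addr.
apply/andP/imsetP => [[/orth_colsP[k ->]]|[c _ ->]]; last first.
  by rewrite /f low; split=> //; apply/orth_colsP; exists (Ordinal (hk c)); rewrite low.
rewrite /orth_col; case: ifP => // ki _; have ik : (i <= k)%N by rewrite leqNgt ki.
have hc : (k - i < m.+1 - i)%N by have := ltn_ord k; lia.
exists (Ordinal hc) => //; rewrite /f low; congr (emb_node _ (inl (refl_fun _ _))).
by apply: val_inj; rewrite /= subnKC.
Qed.

End OrthEmbed.

(** * The element Phi is the sum of all diagrams *)

(** The double factorial. *)
Fixpoint dfact (j : nat) : nat := if j is j'.+2 then (j * dfact j')%N else 1%N.

Lemma dfact_double k : dfact k.*2 = (2 ^ k * k`!)%N.
Proof.
elim: k => // k IH; rewrite doubleS /= IH factS expnS -doubleS -mul2n.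
by rewrite mulnACA.
Qed.

Section Stabilizer.
Variables (r : nat) (D : diagram r r).
Local Notation T := (node r r).
Implicit Types (p q : {perm T}) (S : {set T}) (x y : T) (a b : bool).
Local Open Scope nat_scope.
Local Notation w := (dmate D).

Definition sidep p := [forall z, side (p z) == side z].

Lemma sidepP p : reflect (forall z, side (p z) = side z) (sidep p).
Proof. by apply: (iffP forallP) => h z; apply/eqP; rewrite h. Qed.

Definition stab S p := [&& perm_on S p, sidep p & relabel p D == D].

Lemma stab1 S : stab S 1%g.
Proof.
rewrite /stab perm_on1 relabel1 eqxx andbT; apply/sidepP => z.
by rewrite perm1.
Qed.

Lemma stabM S p q : stab S p -> stab S q -> stab S (p * q)%g.
Proof.
move=> /and3P[p1 /sidepP p2 /eqP p3] /and3P[q1 /sidepP q2 /eqP q3].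
rewrite /stab perm_onM // relabelM p3 q3 eqxx andbT; apply/sidepP => z.
by rewrite permM q2 p2.
Qed.

Lemma stabV S p : stab S p -> stab S (p^-1)%g.
Proof.
move=> /and3P[p1 /sidepP p2 /eqP p3].
rewrite /stab perm_onV //= -{1}p3 relabelK eqxx andbT; apply/sidepP => z.
by rewrite -p2 permKV.
Qed.

Lemma stab_mate S p x : stab S p -> p (w x) = w (p x).
Proof. by case/and3P => _ _ /eqP pD; rewrite -dmate_relabelE pD. Qed.

Definition arcs S a b := [set x in S | (side x == a) && (side (w x) == b)].

Lemma stab_swap S x y : stable S D -> x \in S -> y \in arcs S (side x) (side (w x)) ->
  exists2 q, stab S q & q y = x.
Proof.
move=> st xS; rewrite inE => /and3P[yS /eqP syx /eqP swyx].
have [->|yx] := eqVneq y x; first by exists 1%g; rewrite ?perm1 ?stab1.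
have wxS : w x \in S by rewrite st.
have wyS : w y \in S by rewrite st.
have [ywx|ywx] := eqVneq y (w x).
  exists (tperm x (w x)); last by rewrite ywx tpermR.
  rewrite /stab perm_on_tperm // relabel_arc eqxx andbT; apply/sidepP => z.
  by case: tpermP => // ->; rewrite -ywx.
pose q := (tperm x y * tperm (w x) (w y))%g; exists q; last first.
  by rewrite permM tpermR tpermD // ?dmateN // -(inj_eq (@dmate_inj _ _ D)) dmateK.
have disj : [disjoint [set x; y] & [set w x; w y]].
  have ne1 z : z != w z by rewrite eq_sym dmateN.
  have ne2 : x != w y by rewrite -(inj_eq (@dmate_inj _ _ D)) dmateK eq_sym.
  by rewrite disjoints_subset subUset !sub1set !inE !negb_or !ne1 ne2 ywx.
have comm : commute (tperm x y) (tperm (w x) (w y)).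
  by apply: perm_onC disj; apply: tperm_on.
apply/and3P; split; first by apply: perm_onM; apply: perm_on_tperm.
  apply/sidepP => z; rewrite permM.
  have -> : side (tperm (w x) (w y) (tperm x y z)) = side (tperm x y z).
    by case: (tpermP (w x) (w y)) => // ->; rewrite swyx.
  by case: tpermP => // ->; rewrite syx.
apply/eqP/relabel_eqP => z; rewrite /q [in RHS]comm !permM.
rewrite !(inj_tperm _ _ _ (@dmate_inj _ _ D)) !dmateK //.
Qed.

(** The orbit of x under the stabilizer consists of the ends of arcs of the
    same kind, and a permutation that fixes x fixes its partner. *)
Lemma stab_step S x : stable S D -> x \in S ->
  #|[set p | stab S p]| = #|arcs S (side x) (side (w x))|
                          * #|[set p | stab (S :\ x :\ w x) p]|.
Proof.
move=> st xS; set O := arcs _ _ _; set S' := S :\ x :\ w x.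
have fixx p : stab S' p = stab S p && (p x == x).
  apply/idP/andP => [h|[h /eqP px]].
    have pS' : perm_on S' p by case/and3P: h.
    split; last by apply/eqP/(out_perm pS'); rewrite !inE eqxx andbF.
    case/and3P: h => _ h2 h3; rewrite /stab h2 h3 !andbT.
    by apply: subset_trans pS' _; apply/subsetP => z; rewrite !inE => /and3P[].
  have pwx : p (w x) = w x by rewrite (stab_mate _ h) px.
  case/and3P: h => h1 h2 h3; rewrite /stab h2 h3 !andbT.
  apply/subsetP => z; rewrite inE => pz; rewrite !inE (subsetP h1 z) ?inE // andbT.
  by apply/andP; split; apply: contraNneq pz => ->; rewrite ?px ?pwx eqxx.
rewrite -sum1_card (partition_big (fun p => p x) (mem O)) /= => [|p]; last first.
  rewrite inE => h; have [h1 /sidepP h2 _] := and3P h.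
  by rewrite inE (perm_closed _ h1) xS h2 -(stab_mate _ h) h2 !eqxx.
rewrite -sum_nat_const; apply: eq_bigr => y yO.
have [q hq qy] := stab_swap st xS yO.
rewrite sum1dep_card -(card_imset _ (mulIg q)); apply: eq_card => p; rewrite inE fixx.
apply/imsetP/andP => [[p']|[hp /eqP px]].
  rewrite !inE => /andP[hp' /eqP px] ->; rewrite stabM // permM px qy eqxx //.
exists (p * q^-1)%g; last by rewrite mulgKV.
rewrite !inE; apply/andP; split; first exact: stabM hp (stabV hq).
by rewrite permM px -qy permK.
Qed.

Lemma arcs_sym S a b : stable S D -> #|arcs S a b| = #|arcs S b a|.
Proof.
move=> st; rewrite -(card_imset _ (@dmate_inj _ _ D)); apply: eq_card => z.
rewrite -{1}[z](dmateK D) mem_imset; last exact: dmate_inj.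
by rewrite !inE st dmateK [(side (w z) == _) && _]andbC.
Qed.

Lemma arcs_remove S x a b : stable S D -> x \in S ->
  #|arcs S a b| = ((side x == a) && (side (w x) == b))
     + ((side (w x) == a) && (side x == b)) + #|arcs (S :\ x :\ w x) a b|.
Proof.
move=> st xS; rewrite (cardsD1 x) (cardsD1 (w x)) addnA; congr (_ + _ + _).
- by rewrite inE xS.
- by rewrite !inE st xS dmateN dmateK.
by apply: eq_card => z; rewrite !inE; do !case: (_ == _); rewrite ?andbF.
Qed.

Lemma card_stab S : stable S D -> #|[set p | stab S p]|
  = dfact #|arcs S true true| * dfact #|arcs S false false| * (#|arcs S true false|)`!.
Proof.
move en : #|S| => n; elim/ltn_ind: n S en => n IH S en st.
have [S0|[x0 x0S]] := set_0Vmem S.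
  have arcs0 a b : #|arcs S a b| = 0.
    by apply/eqP; rewrite cards_eq0; apply/eqP/setP => z; rewrite !inE S0 inE.
  rewrite !arcs0 /= -[RHS](cards1 (1%g : {perm T})); apply: eq_card => p; rewrite !inE.
  apply/idP/eqP => [|->]; last exact: stab1.
  case/and3P => h _ _; apply/permP => z; rewrite perm1 (out_perm h) // S0 inE.
  by [].
have [x xS hx] : exists2 x, x \in S & side x || ~~ side (w x).
  have [h|h] := boolP (side x0 || ~~ side (w x0)); first by exists x0.
  by exists (w x0); rewrite ?st // dmateK; move: h; rewrite negb_or negbK => /andP[_ ->].
pose S' := S :\ x :\ w x; have st' : stable S' D.
  move=> z; rewrite !inE st (inj_eq (@dmate_inj _ _ D)) -{2}[x](dmateK D).
  by rewrite (inj_eq (@dmate_inj _ _ D)) andbCA.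
have ltS : #|S'| < n.
  rewrite -en (cardsD1 x S) xS add1n ltnS; apply: subset_leq_card.
  by apply/subsetP => z; rewrite inE => /andP[].
rewrite (stab_step st xS) (IH _ ltS S' erefl st').
have hTT := arcs_remove true true st xS; have hFF := arcs_remove false false st xS.
have hTF := arcs_remove true false st xS; rewrite -/S' in hTT hFF hTF.
move: hx hTT hFF hTF; case: (side x); case: (side (w x)) => //= _ hTT hFF hTF.
- rewrite hFF hTF hTT !add0n add1n add2n /= -!mulnA //.
- rewrite hFF hTF hTT !add0n addn0 add1n factS mulnCA //.
rewrite hFF hTF hTT !add0n add1n add2n /= -!mulnA mulnCA //.
Qed.

End Stabilizer.

Section RowSymmetrization.
Variables (K : fieldType) (r : nat) (delta : K).
Local Notation T := (node r r).
Local Notation "[b D ]" := (basis_elt K D) (at level 0, format "[b  D ]").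
Implicit Types (D : diagram r r) (p q : {perm T}).

Lemma sum_sidep (M : nmodType) (F : {perm T} -> M) :
  \sum_(t : 'S_r) \sum_(s : 'S_r) F (lowp s * upp t)%g = \sum_(p | sidep p) F p.
Proof.
rewrite pair_big /=; pose g (u : 'S_r * 'S_r) := (lowp u.2 * upp u.1)%g.
have g_inj : injective g.
  move=> [t s] [t' s'] /permP E; have El i := E (inl i); have Er i := E (inr i).
  congr pair; apply/permP => i.
    by have := Er i; rewrite /g /= !permM !luE => -[].
  by have := El i; rewrite /g /= !permM !luE => -[].
transitivity (\sum_(u in [set: 'S_r * 'S_r]) F (g u)).
  by apply: eq_bigl => u; rewrite inE.
rewrite -(big_imset F) /=; last by move=> u v _ _; apply: g_inj.
apply: eq_bigl => p; apply/imsetP/sidepP => [[u _ ->] z|/side_permP[s [t ->]]].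
  by rewrite permM; case: z => i; rewrite !luE.
by exists (t, s); rewrite ?inE.
Qed.

Lemma Sigma_comp D : brauer_comp delta (Sigma K r) (brauer_comp delta [b D] (Sigma K r))
  = \sum_(p | sidep p) [b relabel p D].
Proof.
have inner : brauer_comp delta [b D] (Sigma K r)
    = \sum_(s : 'S_r) [b relabel (lowp s) D].
  rewrite [RHS](reindex_inj (@invg_inj 'S_r)) /=.
  apply: etrans (brauer_comp_sumr _ _ _ _ _) _; apply: eq_bigr => s _.
  exact: comp_perm_r.
rewrite inner -(sum_sidep (fun p => [b relabel p D])).
apply: etrans (brauer_comp_suml _ _ _ _ _) _; apply: eq_bigr => t _.
apply: etrans (brauer_comp_sumr _ _ _ _ _) _; apply: eq_bigr => s _.
by rewrite relabelM; apply: comp_perm_l.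
Qed.

(** Twice the number of arcs in the lower row. *)
Definition caps D := #|arcs D setT true true|.

Lemma card_arcsT D a : (#|arcs D setT a true| + #|arcs D setT a false|)%N = r.
Proof.
rewrite -[RHS](card_node_side r a) -[RHS](cardsID [set x | side (dmate D x)]).
by congr (_ + _)%N; apply: eq_card => x; rewrite !inE; case: (side (dmate D x));
  rewrite ?andbT ?andbF.
Qed.

Lemma stableT D : stable setT D.
Proof. by move=> x; rewrite !inE. Qed.

Lemma caps_arcs D : [/\ #|arcs D setT true false| = (r - caps D)%N,
  #|arcs D setT false true| = (r - caps D)%N & #|arcs D setT false false| = caps D].
Proof.
have h1 := card_arcsT D true; have h2 := card_arcsT D false.
have h3 := arcs_sym true false (stableT D).
rewrite -/(caps D) in h1.
have le : (caps D <= r)%N by rewrite -[X in (_ <= X)%N]h1 leq_addr.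
have e1 : #|arcs D setT true false| = (r - caps D)%N.
  by apply: (@addnI (caps D)); rewrite subnKC.
have e2 : #|arcs D setT false true| = (r - caps D)%N by rewrite -h3.
split=> //; apply: (@addnI (r - caps D)%N); rewrite subnK //.
by apply: etrans h2; rewrite e2.
Qed.

Lemma caps_le D : (caps D <= r)%N.
Proof. by rewrite -[X in (_ <= X)%N](card_arcsT D true) leq_addr. Qed.

(** The number of arcs in the lower row determines the numbers of arcs of each
    kind. *)
Lemma caps_conj D D' : caps D = caps D' -> exists2 p, sidep p & relabel p D = D'.
Proof.
move=> E.
have cnt c : #|[set x | ntype (@side r) (dmate D) x == c]|
    = #|[set x | ntype (@side r) (dmate D') x == c]|.
  case: c => [[a b] f].
  have main C : #|[set x | ntype (@side r) (dmate C) x == (a, b, f)]|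
      = if f then 0%N else #|arcs C setT a b|.
    case: f; last by apply: eq_card => x; rewrite !inE !xpair_eqE (negPf (dmateN _ _)) andbT.
    apply/eqP; rewrite cards_eq0; apply/eqP/setP => x.
    by rewrite !inE !xpair_eqE (negPf (dmateN _ _)) andbF.
  rewrite !main; case: f {main} => //.
  have [e1 e2 e3] := caps_arcs D; have [e1' e2' e3'] := caps_arcs D'.
  by case: a; case: b; rewrite ?e1 ?e2 ?e3 ?e1' ?e2' ?e3' -?/(caps D) -?/(caps D') E.
have [p hp] := coloured_iso (@dmateK _ _ D) (@dmateK _ _ D') cnt.
exists p; first by apply/sidepP => z; case: (hp z).
by apply: relabel_eqP => x; case: (hp x).
Qed.

Lemma caps_relabel p D : sidep p -> caps (relabel p D) = caps D.
Proof.
move/sidepP => ps; rewrite /caps -(card_imset (mem (arcs D _ _ _)) (@perm_inj _ p)).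
apply: eq_card => z; rewrite perm_on_imset !inE dmate_relabel ps.
by rewrite -{1}[z](permKV p) ps.
Qed.

(** Orbit and stabilizer for the permutations of the two rows. *)
Lemma orbit_sum D : \sum_(p | sidep p) [b relabel p D]
  = (dfact (caps D) * dfact (caps D) * (r - caps D)`!)%:R
      *: \sum_(C | caps C == caps D) [b C].
Proof.
have [e1 _ e3] := caps_arcs D.
have := card_stab (stableT D); rewrite -/(caps D) e1 e3 => <-.
rewrite scaler_sumr (partition_big (fun p => relabel p D) (fun C => caps C == caps D)) /=.
  apply: eq_bigr => C /eqP capsC; have [q qs qC] := caps_conj capsC.
  rewrite scaler_nat.
  have -> : #|[set p | stab D setT p]| = #|[set p | sidep p & relabel p D == C]|.
    rewrite -(card_imset _ (mulIg (q^-1)%g)); apply: eq_card => p; rewrite !inE.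
    have qVs : sidep (q^-1)%g.
      by apply/sidepP => z; rewrite -[z in RHS](permKV q) (sidepP _ qs).
    have sM p1 p2 : sidep p1 -> sidep p2 -> sidep (p1 * p2)%g.
      by move=> /sidepP h1 /sidepP h2; apply/sidepP => z; rewrite permM h2 h1.
    have onT p1 : perm_on [set: T] p1 by apply/subsetP => z; rewrite inE.
    apply/imsetP/andP => [[p']|[ps /eqP pD]].
      rewrite inE => /and3P[_ h1 /eqP h2] ->; split; first exact: sM.
      by rewrite relabelM h2 -qC relabelK.
    exists (p * q)%g; last by rewrite mulgK.
    by rewrite inE /stab onT sM //= relabelM pD qC eqxx.
  rewrite -sumr_const; apply: eq_big => [p|p /andP[_ /eqP -> //]].
  by rewrite inE.
by move=> p ps; rewrite caps_relabel.
Qed.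

(** The orbits of the involution have two elements. *)
Lemma even_fpf (T0 : finType) (f : T0 -> T0) (S : {set T0}) :
  involutive f -> (forall x, f x != x) -> (forall x, (f x \in S) = (x \in S)) ->
  ~~ odd #|S|.
Proof.
move=> fK fN; move en : #|S| => n; elim/ltn_ind: n S en => n IH S en st.
have [S0|[x xS]] := set_0Vmem S; first by rewrite -en S0 cards0.
have c1 : #|S| = (#|S :\ x :\ f x|).+2.
  by rewrite (cardsD1 x) xS (cardsD1 (f x) (S :\ x)) !inE fN st xS.
rewrite -en c1 /= negbK; apply: (IH _ _ _ erefl); first by rewrite -en c1.
move=> z; rewrite !inE st (inj_eq (inv_inj fK)) -{2}[x]fK (inj_eq (inv_inj fK)).
by rewrite andbCA.
Qed.

Lemma caps_even D : ~~ odd (caps D).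
Proof.
apply: (@even_fpf _ (dmate D)); [exact: dmateK|exact: dmateN|].
by move=> x; rewrite !inE /= dmateK; apply: andbC.
Qed.

End RowSymmetrization.

Section PhiSum.
Variables (K : fieldType) (n : nat).
Local Notation N := n.+1.
Local Notation "[b D ]" := (basis_elt K D) (at level 0, format "[b  D ]").
Hypothesis fact0 : forall k, (k %| N`!)%N -> k%:R != 0 :> K.

(** The factor with index j0 adds an arc to each row, at nodes at which the
    product of the later factors is still the identity. *)
Lemma Ek_range (delta : K) l j0 : (0 < j0)%N -> ((j0 + l).*2 <= N.+2)%N ->
  exists D : diagram N N,
  [/\ \big[@brauer_comp K delta N N N / brauer_id K N]_(j0 <= j < j0 + l)
         brauer_e delta N (n + 2 - 2 * j) = [b D], caps D = l.*2
    & forall z : 'I_N, (n + 3 <= z + 2 * j0)%N -> dmate D (inr z) = inl z].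
Proof.
elim: l j0 => [|l IH] j0 j0_gt0 hj.
  exists (id_diag N); split=> [||z _]; last by rewrite dmate_id.
    by rewrite addn0 big_geq.
  rewrite /caps; apply/eqP; rewrite cards_eq0; apply/eqP/setP => z; rewrite !inE.
  by rewrite dmate_id; case: z.
have [||D [E cD hD]] := IH j0.+1; rewrite ?addSnnS //.
rewrite addSnnS in E.
have hx : (n + 1 - 2 * j0 < N)%N by lia.
have hy : (n + 2 - 2 * j0 < N)%N by lia.
pose x := Ordinal hx; pose y := Ordinal hy.
have yx : y = x.+1 :> nat by rewrite /=; lia.
have xy : x != y by apply/eqP => /(congr1 val) /=; lia.
have wx : dmate D (inr x) = inl x by apply: hD => /=; lia.
have wy : dmate D (inr y) = inl y by apply: hD => /=; lia.
pose t := tperm (inr x : node N N) (inl y); pose D1 := relabel t D.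
have D1E z : dmate D1 z = t (dmate D (t z)) by rewrite dmate_relabel tpermV.
have D1x : dmate D1 (inr x) = inr y.
  by rewrite D1E tpermL -wy dmateK /t tpermD.
have D1D : relabel t D1 = D by rewrite -relabelM tperm2 relabel1.
have wl : dmate D (inl x) = inr x by rewrite -wx dmateK.
have wl' : dmate D (inl y) = inr y by rewrite -wy dmateK.
have D1l : dmate D1 (inl x) = inl y.
  by rewrite D1E /t [tperm _ _ (inl x)]tpermD ?wl ?tpermL // (inj_eq inl_inj) eq_sym.
have D1l' : dmate D1 (inl y) = inl x by rewrite -D1l dmateK.
exists D1; split.
- rewrite big_ltn ?E; last by lia.
  have -> : (n + 2 - 2 * j0)%N = x.+1 by rewrite /=; lia.
  apply: etrans (congr1 (fun z => brauer_comp delta z _) (brauer_eE delta yx)) _.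
  have := comp_e_l delta y D1x; rewrite -/t D1D; apply.
- have inD z : (z \in arcs D1 setT true true) =
    [|| z == inl x, z == inl y | z \in arcs D setT true true].
    have [->|zx] := eqVneq z (inl x); first by rewrite !inE D1l.
    have [->|zy] := eqVneq z (inl y); first by rewrite !inE D1l' orbT.
    case: z zx zy => [i|i] zx zy; last by rewrite !inE.
    rewrite !inE D1E [t (inl i)]tpermD ?(inj_eq inl_inj) 1?eq_sym //=.
    rewrite /t; case: tpermP => [E1|E1|//].
      by move: zx; rewrite -wl in E1; move: E1 => /dmate_inj ->; rewrite eqxx.
    by rewrite E1; have := congr1 (dmate D) E1; rewrite dmateK wl'.
  have xn : inl x \notin arcs D setT true true by rewrite !inE wl.
  have yn : inl y \notin arcs D setT true true by rewrite !inE wl'.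
  have -> : caps D1 = #|inl x |: (inl y |: arcs D setT true true)|.
    by apply: eq_card => z; rewrite inD !in_setU !in_set1.
  rewrite cardsU1 in_setU1 (inj_eq inl_inj) (negPf xy) (negPf xn) cardsU1 yn.
  by rewrite -/(caps D) cD.
move=> z hz; have zx : z != x by apply/eqP => /(congr1 val) /=; lia.
have zy : z != y by apply/eqP => /(congr1 val) /=; lia.
rewrite D1E [t (inr z)]tpermD ?(inj_eq inr_inj) 1?eq_sym // hD; last by lia.
by rewrite /t tpermD // (inj_eq inl_inj) eq_sym.
Qed.

Lemma Ek_basis k : (k.*2 <= N)%N -> exists2 D : diagram N N,
  Ek K n k = [b D] & caps D = k.*2.
Proof.
move=> kN; have [//||D [E cD _]] := @Ek_range (- (n.*2)%:R) k 1; first by lia.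
by exists D; rewrite // /Ek -add1n.
Qed.

(** The denominators in Phi are the orders of the stabilizers, so that every
    diagram has coefficient 1. *)
Lemma Phi_sum : Phi K n = \sum_(D : diagram N N) [b D].
Proof.
pose f (D : diagram N N) : 'I_(N./2.+1) := inord (caps D)./2.
have fE D (k : 'I_(N./2.+1)) : (f D == k) = (caps D == k.*2).
  have lt : ((caps D)./2 < N./2.+1)%N by rewrite ltnS half_leq // caps_le.
  have ev := even_halfK (caps_even D).
  apply/eqP/eqP => [<-|E]; first by rewrite inordK.
  by apply: val_inj; rewrite /= inordK // E doubleK.
rewrite [RHS](partition_big f predT) //= /Phi big_mkord; apply: eq_bigr => k _.
have kN : (k.*2 <= N)%N by have := ltn_ord k; rewrite ltnS => h; have := half_leq; lia.
have [D ED cD] := Ek_basis kN; rewrite ED.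
apply: etrans (congr1 (fun z => _ *: z) (Sigma_comp _ D)) _.
apply: etrans (congr1 (fun z => _ *: z) (orbit_sum K D)) _.
rewrite scalerA cD dfact_double mul2n.
have -> : ((2 ^ k * k`!) ^ 2)%N = (2 ^ k * k`! * (2 ^ k * k`!))%N by rewrite expnS expn1.
rewrite mulVf ?scale1r; last first.
  have f2 : (2 ^ k)%:R != 0 :> K.
    rewrite natrX expf_eq0 negb_and; apply/orP.
    case: (posnP k) => [k0|k0]; first by left.
    by right; apply: fact0; apply: dvdn_fact; lia.
  have fk j : (j <= N)%N -> (j`!)%:R != 0 :> K.
    by move=> jN; apply: fact0; rewrite -(bin_fact jN) mulnCA dvdn_mulr.
  rewrite !natrM !mulf_neq0 ?fk //; first by lia.
    by lia.
  exact: leq_subr.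
by apply: eq_bigl => C; rewrite fE.
Qed.

End PhiSum.

Section PhiEmbed.
Variables (K : fieldType) (n r : nat).
Hypothesis le_nr : (n.+1 <= r)%N.
Hypothesis fact0 : forall k, (k %| (n.+1)`!)%N -> k%:R != 0 :> K.

Definition first_nodes : {set node r r} := emb_node le_nr @: [set: node n.+1 n.+1].

Lemma first_nodesP z : (z \in first_nodes) = (z \in codom (emb_node le_nr)).
Proof.
apply/imsetP/codomP => [[x _ ->]|[x ->]]; first by exists x.
by exists x.
Qed.

Lemma first_nodes_card : #|first_nodes| = (n.+1).*2.
Proof.
rewrite card_imset ?cardsT ?card_sum ?card_ord ?addnn //.
exact: emb_node_inj.
Qed.

Lemma first_nodes_stable : stable first_nodes (id_diag r).
Proof.
apply: stableP => z /imsetP[x _ ->]; apply/imsetP; exists (dmate (id_diag n.+1) x) => //.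
by rewrite !dmate_id; case: x.
Qed.

Lemma embd_inj : injective (embd le_nr).
Proof.
move=> D D' E; apply: diagram_ext => x; apply: (@emb_node_inj _ _ le_nr).
by rewrite -!dmate_embd E.
Qed.

Lemma embd_onto D : agree first_nodes (id_diag r) D -> exists C, D = embd le_nr C.
Proof.
move=> ag; have st := stable_agree first_nodes_stable ag.
have ex x : {y | emb_node le_nr y == dmate D (emb_node le_nr x)}.
  apply: sigW; have : dmate D (emb_node le_nr x) \in first_nodes by rewrite st imset_f ?inE.
  by case/imsetP => y _ ->; exists y.
pose f x := sval (ex x).
have fE x : emb_node le_nr (f x) = dmate D (emb_node le_nr x) := eqP (svalP (ex x)).
have fK : involutive f.
  by move=> x; apply: (@emb_node_inj _ _ le_nr); rewrite !fE dmateK.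
have fN x : f x != x.
  by rewrite -(inj_eq (@emb_node_inj _ _ le_nr)) fE dmateN.
exists (diagram_of_inv fK fN); apply: diagram_ext => z.
have [zS|zS] := boolP (z \in first_nodes); last first.
  by rewrite ag // dmate_embd_out // -first_nodesP.
by case/imsetP: zS => x _ ->; rewrite dmate_embd dmate_of_inv fE.
Qed.

Lemma embed_Phi : brauer_embed r (Phi K n) = pfaffian K first_nodes (id_diag r).
Proof.
rewrite Phi_sum // (eq_bigr (fun D => 1 *: basis_elt K D)); last first.
  by move=> D _; rewrite scale1r.
rewrite (brauer_embed_sum le_nr) /pfaffian.
transitivity (\sum_(D in [set: diagram n.+1 n.+1]) basis_elt K (embd le_nr D)).
  by apply: eq_big => [D|D _]; rewrite ?inE ?scale1r.
rewrite -(big_imset (fun D => basis_elt K D)) /=; last by move=> D D' _ _; apply: embd_inj.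
apply: eq_bigl => D; apply/imsetP/agreeP => [[C _ ->]|/embd_onto[C ->]]; last by exists C; rewrite ?inE.
by move=> z; rewrite first_nodesP => /dmate_embd_out ->.
Qed.

End PhiEmbed.

(** * The kernel *)

Section IdealGen.
Variables (K : fieldType) (r : nat) (delta : K) (g : brauer K r r).

Lemma ideal_gen_ideal : two_sided_ideal delta (ideal_gen delta g).
Proof.
split=> [J [] //|x y hx hy J hJ Jg|a x hx].
  by case: (hJ) => _ h _; apply: h; [apply: hx|apply: hy].
by split=> J hJ Jg; case: (hJ) => _ _ h; case: (h a x (hx J hJ Jg)).
Qed.

Lemma ideal_gen_self : ideal_gen delta g g.
Proof. by move=> J. Qed.

Lemma ideal_gen_id x : g = brauer_id K r -> ideal_gen delta g x.
Proof.
by move=> g1 J [_ _ h] Jg; have [+ _] := h x g Jg; rewrite g1 comp_id_r.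
Qed.

End IdealGen.

Section Kernel.
Variables (K : fieldType) (r m : nat) (eps : bool).
Local Notation V := 'rV[K]_m.
Variable form : {hermitian V for eps & idfun}.
Variables (b b' : m.-tuple V).
Variable F : {linear brauer K r r -> 'End(tensor_space K m r)}.
Hypothesis b_basis : basis_of fullv b.
Hypothesis b_dual : forall i j, form (tnth b' i) (tnth b j) = (i == j)%:R.
Hypothesis hF : brauer_rep form b b' F.
Local Notation delta := ((-1) ^+ eps * m%:R : K).
Local Notation bf := (bform form).
Variables (g : brauer K r r) (good : pred (diagram r r)).
Local Notation wt := (@weight r eps).
Hypothesis g_phi : forall v, phix eps bf g v = 0.
Hypothesis rel : forall J, two_sided_ideal delta J -> J g ->
  forall D, ~~ good D -> exists x : brauer K r r,
  [/\ J x, x D != 0 & forall D', D' != D -> x D' != 0 -> (wt D < wt D')%N].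
Hypothesis word : forall D, good D -> exists2 v : node r r -> V, phi eps bf D v != 0 &
  forall D', phi eps bf D' v != 0 -> D' = D \/ (wt D' < wt D)%N.

(** An ideal in the kernel with enough relations is the kernel. *)
Lemma kernel_ideal x : F x = 0 <-> ideal_gen delta g x.
Proof.
have kerJ : two_sided_ideal delta (fun y => F y = 0).
  split=> [|y z Fy Fz|a y Fy]; first exact: linear0.
    by rewrite linearD /= Fy Fz addr0.
  by split; rewrite (brauer_repM hF) Fy ?comp_lfun0r ?comp_lfun0l.
have ker y : ideal_gen delta g y -> F y = 0.
  by move=> h; apply: (h _ kerJ); apply: (proj2 (F_eq0 b_basis b_dual hF g)).
split=> [Fx|]; last exact: ker.
have genJ := ideal_gen_ideal delta g.
apply: (straightening genJ _ (rel genJ (@ideal_gen_self _ _ _ _)) word).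
  by move=> y /ker /(F_eq0 b_basis b_dual hF).
exact/(F_eq0 b_basis b_dual hF).
Qed.

End Kernel.

Section Forms.
Variables (K : fieldType) (m : nat) (eps : bool).
Local Notation V := 'rV[K]_m.
Variable form : {hermitian V for eps & idfun}.

Lemma nondegenerateP : nondegenerate form -> forall x : V, x != 0 ->
  exists y, bform form x y != 0.
Proof.
move=> /eqP nd x x0; have : x \notin orthov form fullv by rewrite nd memv0.
by case/mem_orthovPn => y _ xy; exists y.
Qed.

End Forms.

Section Symplectic.
Variables (K : fieldType) (n r : nat).
Local Notation m := (2 * n)%N.
Local Notation V := 'rV[K]_m.
Variable form : {skew_symmetric V}.
Local Notation bf := (bform form).
Hypothesis nd : nondegenerate form.
Hypothesis two : 2%:R != 0 :> K.

(** The ends of an arc of depth i receive the i-th hyperbolic pair, so that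
    two of these vectors pair nontrivially exactly if their labels are those
    of the ends of an arc. *)
Lemma symplectic_word D : ~~ bad_chain true n.+1 D ->
  exists2 v : node r r -> V, phi true bf D v != 0 &
  forall D', phi true bf D' v != 0 -> D' = D \/ (weight true D' < weight true D)%N.
Proof.
move=> good.
have bfC x y : bf x y = - bf y x by rewrite [LHS](bformC form) expr1 mulN1r.
have [|e [f hef]] := hyperbolic_vectors (bform_linear form)
  (nondegenerateP nd) two bfC (k := n); first by rewrite mul2n.
pose v z := if (label true n D z).2 then e (label true n D z).1 else f (label true n D z).1.
have vE x y : (bf (v x) (v y) != 0) =
    (label true n D y == colabel true (label true n D x)).
  have := label_valid x good; have := label_valid y good; rewrite /v.
  case: (label true n D x) => i a; case: (label true n D y) => j c /=.
  rewrite !andbT => jn inn; rewrite /colabel /= addbT xpair_eqE.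
  have [h1 h2 h3] := hef i j inn jn; have [h4 _ _] := hef j i jn inn.
  case: a; case: c => /=; rewrite ?h1 ?h2 ?h3 ?eqxx ?andbF ?andbT //.
    by rewrite [RHS]eq_sym; case: (i == j); rewrite ?oner_eq0 ?eqxx.
  by rewrite bfC h4 oppr_eq0; case: (j == i); rewrite ?oner_eq0 ?eqxx.
exists v; first by apply: phi_neq0 => x; rewrite vE label_mate.
move=> D' hD'; apply: (label_weight good) => x; apply/eqP; rewrite -vE.
exact: (phi_neq0_arc (bformC form)).
Qed.

End Symplectic.

Section Orthogonal.
Variables (K : fieldType) (m r : nat).
Local Notation V := 'rV[K]_m.
Variable form : {symmetric V}.
Local Notation bf := (bform form).
Hypothesis nd : nondegenerate form.
Hypothesis two : 2%:R != 0 :> K.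

(** Both ends of an arc of depth i receive the i-th orthogonal vector. *)
Lemma orthogonal_word D : ~~ bad_chain false m.+1 D ->
  exists2 v : node r r -> V, phi false bf D v != 0 &
  forall D', phi false bf D' v != 0 -> D' = D \/ (weight false D' < weight false D)%N.
Proof.
move=> good.
have bfC x y : bf x y = bf y x by rewrite [LHS](bformC form) mul1r.
have [f hf] := orthogonal_vectors (bform_linear form)
  (nondegenerateP nd) two bfC (leqnn m).
pose v z := f (label false m D z).1.
have vE x y : (bf (v x) (v y) != 0) =
    (label false m D y == colabel false (label false m D x)).
  have := label_valid x good; have := label_valid y good; rewrite /v.
  case: (label false m D x) => i a; case: (label false m D y) => j c /=.
  move=> /andP[jm ->] /andP[im ->].
  by rewrite hf // xpair_eqE andbT eq_sym.
exists v; first by apply: phi_neq0 => x; rewrite vE label_mate.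
move=> D' hD'; apply: (label_weight good) => x; apply/eqP; rewrite -vE.
exact: (phi_neq0_arc (bformC form)).
Qed.

End Orthogonal.

Lemma through_id r (S : {set node r r}) : through S (id_diag r).
Proof. by move=> z _; rewrite dmate_id; case: z. Qed.

Lemma End_tensor_space0 (K : fieldType) m r (f : 'End(tensor_space K m r)) :
  m = 0%N -> (0 < r)%N -> f = 0.
Proof.
move=> m0 r0; apply/lfunP => t; apply/ffunP => w.
by have := leq_trans (ltn_ord (w (Ordinal r0))) (eq_leq m0).
Qed.

Lemma minor_singleton (K : fieldType) r (I : {set node r r}) D : (#|I| <= 1)%N ->
  minor K I D = basis_elt K D.
Proof.
move=> I1; rewrite /minor (big_pred1 1%g) => [|p].
  by rewrite odd_perm1 scale1r relabel1.
by apply/idP/eqP => [pI|->]; [apply: perm_on_id pI I1|apply: perm_on1].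
Qed.

Lemma pfaffian_pair (K : fieldType) r (S : {set node r r}) D : stable S D ->
  #|S| = 2 -> pfaffian K S D = basis_elt K D.
Proof.
move=> st S2; rewrite /pfaffian (big_pred1 D) // => D'.
apply/agreeP/eqP => [ag|-> //].
have [z zS] : exists z, z \in S by apply/set0Pn; rewrite -card_gt0 S2.
have cI : (#|S :\ z| <= 1)%N by have := cardsD1 z S; rewrite zS S2; lia.
have [|p pI pE] := conj_on (I := S :\ z) st ag.
  by move=> a b aS bS; rewrite !inE aS bS !andbT !negbK => /eqP -> /eqP ->.
by rewrite -pE (perm_on_id pI cI) relabel1.
Qed.

Section OrthIdeal.
Variables (K : fieldType) (m r : nat) (delta : K) (J : brauer K r r -> Prop).
Hypothesis hJ : two_sided_ideal delta J.
Hypothesis two : 2%:R != 0 :> K.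
Hypothesis fact0 : forall k, (k %| (m.+1)`!)%N -> k%:R != 0 :> K.
Hypotheses (le_im : ((m.+1)./2 <= m.+1)%N) (le_mr : (m.+1 <= r)%N).

(** The type of the generator is the middle one. *)
Lemma orth_minors (I : {set node r r}) D : J (minor K (orth_cols (m.+1)./2 le_mr) (id_diag r)) ->
  #|I| = m.+1 -> split_by I D -> J (minor K I D).
Proof.
move=> J0; set a0 := #|rowpart (orth_cols (m.+1)./2 le_mr) true|.
have a0E : a0 = (m.+1 - (m.+1)./2)%N := orth_cols_low le_im le_mr.
have hn := odd_double_half m.+1.
have sp0 : split_by (orth_cols (m.+1)./2 le_mr) (id_diag r).
  apply/setP => z; rewrite !inE in_mates; apply/negP => /andP[zc].
  by apply/negP; apply: (orth_cols_mate le_im).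
have typed0 := typed_base hJ two (orth_cols_card le_im le_mr) sp0 (@through_id _ _) J0.
by move=> cI sp; apply: (typed_all hJ two fact0 _ _ typed0) => //; rewrite -/a0 a0E; lia.
Qed.

End OrthIdeal.

Theorem mainTheorem8 (K : fieldType) (p : nat) (m : nat)
    (charK : p \in [pchar K]) (le_m2_p : (m + 2 <= p)%N) :
  (forall (form : {skew_symmetric 'rV[K]_m}) (b b' : m.-tuple 'rV[K]_m)
      (n r : nat) (F : {linear brauer K r r -> 'End(tensor_space K m r)}),
    nondegenerate form ->
    basis_of fullv b ->
    (forall i j, form (tnth b' i) (tnth b j) = (i == j)%:R) ->
    m = (2 * n)%N ->
    (n + 1 <= r)%N ->
    brauer_rep form b b' F ->
    forall x, F x = 0 <-> ideal_gen (- m%:R) (brauer_embed r (Phi K n)) x)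
  /\
  (forall (form : {symmetric 'rV[K]_m}) (b b' : m.-tuple 'rV[K]_m)
      (r : nat) (F : {linear brauer K r r -> 'End(tensor_space K m r)}),
    nondegenerate form ->
    basis_of fullv b ->
    (forall i j, form (tnth b' i) (tnth b j) = (i == j)%:R) ->
    (m + 1 <= r)%N ->
    brauer_rep form b b' F ->
    forall x,
      F x = 0 <-> ideal_gen m%:R (brauer_embed r (Eorth K m ((m + 1)./2))) x).
Proof.
have fact0 k : (k %| (m.+1)`!)%N -> k%:R != 0 :> K.
  by apply: dvd_fact_neq0 charK _; lia.
have two : (0 < m)%N -> 2%:R != 0 :> K.
  by move=> m0; apply: fact0; apply: dvdn_fact; lia.
split=> [form b b' n r F nd bb bd mn nr hF x|form b b' r F nd bb bd mr hF x].
  move: form b b' F nd bb bd hF x fact0 two; rewrite mn.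
  move=> form b b' F nd bb bd hF x fact0 two.
  have le_nr : (n.+1 <= r)%N by rewrite -addn1.
  have factn k : (k %| (n.+1)`!)%N -> k%:R != 0 :> K.
    move=> kn; apply: fact0; apply: dvdn_trans kn _.
    have le : (n.+1 <= (2 * n).+1)%N by lia.
    by rewrite -(bin_fact le) mulnCA dvdn_mulr.
  rewrite (embed_Phi le_nr factn).
  have st0 := first_nodes_stable le_nr; have c0 := first_nodes_card le_nr.
  have cS : #|first_nodes le_nr| = (2 * n).+2 by rewrite c0 mul2n.
  (* If V = 0, then F = 0 and the generator is the identity. *)
  have [n0|n0] := posnP n.
    split=> [_|_]; last by apply: End_tensor_space0; lia.
    apply: ideal_gen_id; apply: pfaffian_pair => //.
    by rewrite cS n0.
  have -> : - (2 * n)%:R = (-1) ^+ true * (2 * n)%:R :> K by rewrite expr1 mulN1r.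
  have two' : 2%:R != 0 :> K by apply: two; lia.
  apply: (kernel_ideal bb bd hF (good := fun D => ~~ bad_chain true n.+1 D)).
  - move=> v; apply: (phix_pfaffian (bform_linear form) two' _ (bformC form)) => //.
  - move=> J hJ Jg D; rewrite negbK => /chain_symp[S [cD st hS]]; exists (pfaffian K S D).
    split.
    + by apply: (pfaffian_ideal hJ st0 _ Jg st); [exact: through_id|rewrite cD c0].
    + by rewrite pfaffianE (introT (agreeP _ _ _)) ?oner_eq0.
    move=> D' neq; rewrite pfaffianE; case: (agreeP S D D') => [ag _|]; last by rewrite eqxx.
    exact: hS.
  by move=> D; apply: symplectic_word.
move: mr; rewrite addn1 => le_mr.
have le_im : ((m.+1)./2 <= m.+1)%N by rewrite -{2}(odd_double_half m.+1); lia.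
rewrite (embed_Eorth K le_im le_mr).
(* If V = 0, then F = 0 and the generator is the identity. *)
have [m0|m0] := posnP m.
  split=> [_|_]; last by apply: End_tensor_space0; lia.
  apply: ideal_gen_id; apply: minor_singleton.
  by rewrite orth_cols_card m0.
have -> : m%:R = (-1) ^+ false * m%:R :> K by rewrite mul1r.
apply: (kernel_ideal bb bd hF (good := fun D => ~~ bad_chain false m.+1 D)).
- move=> v; apply: (phix_minor (bform_linear form) (two m0) _ _ (bformC form)).
  by rewrite orth_cols_card.
- move=> J hJ Jg D; rewrite negbK => /chain_orth[I [cI dI hI]]; exists (minor K I D).
  have sp : split_by I D.
    apply/setP => z; rewrite !inE in_mates; apply/negP => /andP[zI].
    exact/negP/dI.
  split.
  + exact: (orth_minors hJ (two m0) fact0 le_im Jg).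
  + rewrite minor_lead ?oner_eq0 // => q qI qD; apply/eqP/negPn/negP => q1.
    by have := hI q qI q1; rewrite qD ltnn.
  move=> D' neq /minor_support[q qI E]; rewrite E; apply: hI => //.
  by apply: contraNneq neq => q1; rewrite E q1 relabel1.
exact: orthogonal_word nd (two m0).
Qed.
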